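(* Let $d\in\mathbb{N}$, $a>0$, $b\in\mathbb{R}$. There exist constants $c(a,d)$, $c'(a,d)$ and $C'(a,b,d)$ such that for every $v\in\mathbb{N}$ there is $M$ with $|\Gamma(M)|\le v^{c(a,d)}$ such that, with $\Phi_N:=\{e^{i(\mathbf{k},\mathbf{x})}\}_{\mathbf{k}\in\Gamma(M)}$, $$\varrho^{ls}_{m,v}(\mathbf{W}^{a,b}_A,\Phi_N,L_2(\mathbb{T}^d))\le C'(a,b,d)\,v^{-a-1/2}(\log v)^{(d-1)(a+b)}$$ for any $m\ge c'(a,d)\,v(\log(2v))^4$.
   Context: $\mathbb{T}^d=[0,2\pi)^d$ with normalized Lebesgue measure, $\|f\|_p=((2\pi)^{-d}\int_{\mathbb{T}^d}|f|^p)^{1/p}$, $\hat f(\mathbf{k})=(2\pi)^{-d}\int f(\mathbf{x})e^{-i(\mathbf{k},\mathbf{x})}d\mathbf{x}$. $\Gamma(M)=\{\mathbf{k}\in\mathbb{Z}^d:\prod_j\max(|k_j|,1)\le M\}$. For $\mathbf{s}\in\mathbb{N}_0^d$, $\rho(\mathbf{s})=\{\mathbf{k}\in\mathbb{Z}^d:[2^{s_j-1}]\le|k_j|<2^{s_j}\}$, $\delta_{\mathbf{s}}(f)=\sum_{\mathbf{k}\in\rho(\mathbf{s})}\hat f(\mathbf{k})e^{i(\mathbf{k},\cdot)}$, $f_j=\sum_{\|\mathbf{s}\|_1=j}\delta_{\mathbf{s}}(f)$, $\|g\|_A=\sum_{\mathbf{k}}|\hat g(\mathbf{k})|$. $\mathbf{W}^{a,b}_A:=\{f\in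 L_1(\mathbb{T}^d):\|f_j\|_A\le2^{-aj}\bar j^{(d-1)b},\ \bar j=\max(j,1),\ j\in\mathbb{N}_0\}$. $\mathcal{X}_v(\Phi_N)$ is the collection of spans of $v$-element subsets of $\Phi_N$; $LS(\xi,L)(f)$ is an element $u\in L$ minimizing $\frac1m\sum_j|f(\xi^j)-u(\xi^j)|^2$; $\varrho^{ls}_{m,v}(\mathbf{F},\Phi_N,L_2(\mathbb{T}^d)):=\inf_{\xi\in(\mathbb{T}^d)^m}\sup_{f\in\mathbf{F}}\min_{L\in\mathcal{X}_v(\Phi_N)}\|f-LS(\xi,L)(f)\|_2$.
   Formalization: The claim is stated for v ≥ 2: at v = 1 the condition |Γ(M)| ≤ 1 forces Γ(M) to be empty, since Γ(M) has at least 3^d elements for M ≥ 1, so there is no subspace L over which to minimize. *)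

(* Defs.v *)
From HB Require Import structures.
From mathcomp Require Import all_boot all_order all_algebra.
From mathcomp Require Import all_classical all_reals all_analysis.
From mathcomp Require Import complex.
Set Implicit Arguments. Unset Strict Implicit. Unset Printing Implicit Defensive.
Import Order.TTheory GRing.Theory Num.Theory.
Import numFieldNormedType.Exports.
Local Open Scope classical_set_scope.
Local Open Scope ring_scope.

Section Defs.
Variable R : realType.
Variable d : nat.

(* points of T^d = [0,2pi)^d, represented in R^d as row vectors *)
Definition pt := 'rV[R]_d.
Definition freq := {ffun 'I_d -> int}.

Definition cre (z : R[i]) : R := complex.Re z.
Definition cim (z : R[i]) : R := complex.Im z.
Definition cabs2 (z : R[i]) : R := cre z ^+ 2 + cim z ^+ 2.
Definition cabs (z : R[i]) : R := Num.sqrt (cabs2 z).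
Definition cconj (z : R[i]) : R[i] := (cre z +i* (- cim z))%C.

Definition kdot (k : freq) (x : pt) : R := \sum_(i < d) (k i)%:~R * x 0 i.
Definition echar (k : freq) (x : pt) : R[i] :=
  (cos (kdot k x) +i* sin (kdot k x))%C.

Definition upd (x : pt) (i : 'I_d) (t : R) : pt :=
  \row_(j < d) (if j == i then t else x 0 j).

Fixpoint iter_int (s : seq 'I_d) (g : pt -> R) (x : pt) : R :=
  match s with
  | [::] => g x
  | i :: s' => (2 * pi)^-1 *
      Rintegral (@lebesgue_measure R) `[0, 2 * pi]%classic
        (fun t => iter_int s' g (upd x i t))
  end.
Definition torus_int (g : pt -> R) : R := iter_int (enum 'I_d) g 0.

Definition fcoef (f : pt -> R[i]) (k : freq) : R[i] :=
  (torus_int (fun x => cre (f x * cconj (echar k x))) +i*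
   torus_int (fun x => cim (f x * cconj (echar k x))))%C.

Definition l2norm (g : pt -> R[i]) : R :=
  Num.sqrt (torus_int (fun x => cabs2 (g x))).

(* dyadic block rho(s): [2^{s_j-1}] <= |k_j| < 2^{s_j}; note [2^{-1}] = 0 *)
Definition in_rho (s : {ffun 'I_d -> nat}) (k : freq) : bool :=
  [forall i, ((2 ^ s i)./2 <= `|k i|%N)%N && (`|k i|%N < 2 ^ s i)%N].

Definition box (n : nat) := {ffun 'I_d -> 'I_(n.*2.+1)}.
Definition box_freq (n : nat) (t : box n) : freq :=
  [ffun i => (t i)%:Z - n%:Z].

(* ||f_j||_A, f_j = sum_{||s||_1 = j} delta_s(f).  All frequencies of f_j
   satisfy |k_i| < 2^j, so the sum over Z^d reduces to the box |k_i| <= 2^j;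
   the s with ||s||_1 = j range over {ffun 'I_d -> 'I_(j.+1)}. *)
Definition coef_fj (f : pt -> R[i]) (j : nat) (k : freq) : R[i] :=
  \sum_(s : {ffun 'I_d -> 'I_(j.+1)} |
        (\sum_(i < d) (s i : nat))%N == j)
     (if in_rho [ffun i => (s i : nat)] k then fcoef f k else 0).
Definition normA_fj (f : pt -> R[i]) (j : nat) : R :=
  \sum_(t : box (2 ^ j)) cabs (coef_fj f j (box_freq t)).

(* the class W^{a,b}_A; functions are taken as their continuous
   (2pi-periodic) representatives *)
Definition W_A (a b : R) : set (pt -> R[i]) :=
  [set f | continuous (fun x => cre (f x)) /\ continuous (fun x => cim (f x))
      /\ (forall (x : pt) (i : 'I_d), f (upd x i (x 0 i + 2 * pi)) = f x)
      /\ (forall j : nat,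
            normA_fj f j <= 2 `^ (- a * j%:R) *
                            (maxn j 1)%:R `^ ((d%:R - 1) * b))].

Definition Gamma (M : nat) : {set box M} :=
  [set t | (\prod_(i < d) maxn `|box_freq t i|%N 1 <= M)%N].

Definition span_of (M : nat) (S : {set box M}) : set (pt -> R[i]) :=
  [set u | exists c : box M -> R[i],
      forall x, u x = \sum_(t in S) c t * echar (box_freq t) x].

Definition Xv (M v : nat) : set (set (pt -> R[i])) :=
  [set L | exists S : {set box M},
      [/\ S \subset Gamma M, #|S| = v & L = span_of S]].

Definition emp_err (m : nat) (xi : 'I_m -> pt) (f u : pt -> R[i]) : R :=
  (m%:R)^-1 * \sum_(j < m) cabs2 (f (xi j) - u (xi j)).

Definition LS_set (m : nat) (xi : 'I_m -> pt) (L : set (pt -> R[i]))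
    (f : pt -> R[i]) : set (pt -> R[i]) :=
  [set u | L u /\ forall w, L w -> emp_err xi f u <= emp_err xi f w].

Definition in_torus (x : pt) : Prop := forall i, 0 <= x 0 i < 2 * pi.

(* rho^{ls}_{m,v}(F, Phi_N, L_2); LS(xi,L)(f) is "an element" minimizing the
   empirical error: we take the worst such element (sup over minimizers). *)
Definition rho_ls (m v M : nat) (F : set (pt -> R[i])) : \bar R :=
  ereal_inf [set ereal_sup
     [set ereal_inf [set ereal_sup
          [set (l2norm (f \- u))%:E | u in LS_set xi L f] | L in Xv M v]
      | f in F]
   | xi in [set xi : 'I_m -> pt | forall j, in_torus (xi j)]].

End Defs.

(* Main.v *)
Require Import Defs.
From HB Require Import structures.
From mathcomp Require Import all_boot all_order all_algebra.
From mathcomp Require Import all_classical all_reals all_analysis.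
From mathcomp Require Import complex.
From mathcomp Require Import ring lra zify.
Import Order.TTheory GRing.Theory Num.Theory.
Import numFieldNormedType.Exports.
Local Open Scope ring_scope.

(* For every point set, a Maurey average of k exponentials approximates a block f_j
   simultaneously in L_2 and in the empirical norm, with error ||f_j||_A / sqrt k and no
   logarithm.  With 2^n n^(d-1) ~ v, keep all frequencies of dyadic level below n - 1 and give
   the later blocks geometrically decreasing shares of the remaining budget, down to a level
   O(log v) beyond which the tail is bounded uniformly (through Fourier inversion with the
   Fejer kernel).  The v-term approximant lies in the space L that is used for least squares,
   so only a lower frame bound ||u||_2^2 <= C (1/m) sum |u(xi^j)|^2 for v-sparse u is needed.

   The points are taken from a finite grid on which the exponentials are orthonormal.  After
   normalizing the l_1 norm of the coefficients, the real part of u is a convex combination h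
   of +-cos, +-sin.  At scale 2^-i it agrees, off a small set of points, with an average of
   about 4^i log v of these atoms; there are few such averages, and a Chernoff bound for the
   lower tail of their level sets with additive error 4^i / (v log v) survives the union bound
   once m >= C v (log v)^3.  Summing over the scales i bounds E h^2 by its empirical analogue.
   All probabilistic choices are made by conditional expectations. *)

Set Implicit Arguments. Unset Strict Implicit. Unset Printing Implicit Defensive.

(** * Averaging over a finite type *)

(** The points are fixed before [f], whereas the span may follow [f]; so the points must be good for
    all v-sparse polynomials at once. For these ||c||_1^2 <= 2 v ||c||_2^2, where ||c||_1 adds the
    absolute values of real and imaginary parts. An additive error delta on the normalized convex
    hull therefore costs a multiple of v delta relative to ||u||_2^2, and it is absorbed once 8 v
    delta <= 1. This is what fixes the size of [eta]. The powers of 4 balance each other: at scale i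
    the net has entropy of order 4^i (log v)^2, the Chernoff exponent is m 4^i eta, and the layer
    enters the second moment with weight 4^-i. So all scales ask for the same m and each contributes
    a multiple of eta. The number of grid points enters no union bound, only the number of atoms,
    which is a power of v because the blocks stop at a level O(log v). For the approximation, the
    decay 2^-a is split into two equal factors: one pays for the square root of the geometric share
    of the budget, the other makes the block errors summable against any power of the level. Hence
    no logarithm is lost. *)

Section Averaging.
Variables (R : realType) (T : finType) (w : T -> R).
Hypothesis w_ge0 : forall t, 0 <= w t.
Hypothesis w_sum1 : \sum_t w t = 1.

Lemma exists_le_average (F : T -> R) (c : R) :
  \sum_t w t * F t <= c -> exists t, F t <= c.
Proof.
move=> le_c; apply: contrapT => /forallNP gt_c.
have {}gt_c t : c < F t by rewrite ltNge; apply/negP/gt_c.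
have wF t : w t * c <= w t * F t by rewrite ler_wpM2l// ltW.
have: \sum_t w t * c < \sum_t w t * F t.
  have [t wt_gt0] : exists t, 0 < w t.
    apply: contrapT => /forallNP w_le0; move: w_sum1.
    rewrite big1 => [/eqP|t _]; first by rewrite eq_sym oner_eq0.
    by apply/eqP; rewrite eq_le w_ge0 leNgt andbT; apply/negP/w_le0.
  rewrite (bigD1 t)//= [ltRHS](bigD1 t)//= ltr_leD ?ltr_pM2l//.
  exact: ler_sum.
by rewrite -mulr_suml w_sum1 mul1r ltNge le_c.
Qed.

(** Derandomization: [Phi s] estimates the outcome once the draws [s] are fixed. Some next draw does
    no worse than the average, so [n] greedy choices suffice. *)
Lemma conditional_expectations (Phi : seq T -> R) (c : R) (n : nat) :
  0 <= c -> (forall s, \sum_t w t * Phi (t :: s) <= c * Phi s) ->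
  exists s : n.-tuple T, Phi s <= c ^+ n * Phi [::].
Proof.
move=> c_ge0 step; elim: n => [|n [s IHs]]; first by exists [tuple]; rewrite mul1r.
have [t le_t] := exists_le_average (step s).
exists [tuple of t :: s]; rewrite (le_trans le_t)// exprS -mulrA.
exact: ler_wpM2l.
Qed.

Variables (X : finType) (omega : X -> R) (psi : T -> X -> R).
Hypothesis omega_ge0 : forall x, 0 <= omega x.

Let h x := \sum_t w t * psi t x.

Lemma sum_deviation x : \sum_t w t * (h x - psi t x) = 0.
Proof.
under eq_bigr do rewrite mulrBr.
by rewrite sumrB -mulr_suml w_sum1 mul1r subrr.
Qed.

(** For independent draws from [w] the variances of the deviations add up, at most [b] per draw in
    the [omega]-weighted norm. Subtracting [b] per draw makes [Phi] a supermartingale. *)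
Lemma maurey_l2 (b : R) (n : nat) :
  (forall t, \sum_x omega x * psi t x ^+ 2 <= b) ->
  exists s : n.-tuple T,
    \sum_x omega x * (n%:R * h x - \sum_(t <- s) psi t x) ^+ 2 <= n%:R * b.
Proof.
move=> psi_b.
pose Phi s := \sum_x omega x *
  ((size s)%:R * h x - \sum_(t <- s) psi t x) ^+ 2 - (size s)%:R * b.
have step s : \sum_t w t * Phi (t :: s) <= 1 * Phi s.
  rewrite mul1r /Phi /=.
  set g := fun x => (size s)%:R * h x - \sum_(t <- s) psi t x.
  have -> : \sum_t w t * (\sum_x omega x * ((size s).+1%:R * h x -
        \sum_(t0 <- t :: s) psi t0 x) ^+ 2 - (size s).+1%:R * b) =
      \sum_x omega x * (g x ^+ 2 + \sum_t w t * (psi t x) ^+ 2 - h x ^+ 2)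
        - (size s).+1%:R * b.
    under eq_bigr do rewrite mulrBr.
    rewrite sumrB -mulr_suml w_sum1 mul1r; congr (_ - _).
    under eq_bigr do rewrite mulr_sumr.
    rewrite exchange_big/=; apply: eq_bigr => x _.
    transitivity (omega x * \sum_t (w t * g x ^+ 2 + (2 * g x) *
       (w t * (h x - psi t x)) + w t * psi t x ^+ 2 + h x ^+ 2 * w t
        - (2 * h x) * (w t * psi t x))).
      rewrite mulr_sumr; apply: eq_bigr => t _.
      rewrite big_cons /g -natr1; ring.
    rewrite sumrB !big_split/= -!mulr_sumr sum_deviation w_sum1 -/(h x).
    rewrite -mulr_suml w_sum1; ring.
  rewrite -natr1 mulrDl opprD addrA mul1r.
  have le2 : \sum_x omega x * (\sum_t w t * (psi t x) ^+ 2) <= b.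
    under eq_bigr do rewrite mulr_sumr.
    rewrite exchange_big/= -[b]mul1r -w_sum1 mulr_suml.
    apply: ler_sum => t _; under eq_bigr do rewrite mulrCA.
    by rewrite -mulr_sumr ler_wpM2l.
  have le1 : \sum_x omega x * (g x ^+ 2 + \sum_t w t * (psi t x) ^+ 2 - h x ^+ 2)
     <= \sum_x omega x * g x ^+ 2 +
        \sum_x omega x * (\sum_t w t * (psi t x) ^+ 2).
    rewrite -big_split/=; apply: ler_sum => x _.
    by rewrite -mulrDr ler_wpM2l// gerBl sqr_ge0.
  by rewrite -/(g _); move: le1 le2; rewrite /g; lra.
have [s le_s] := conditional_expectations n ler01 step.
have Phi0 : Phi [::] = 0.
  rewrite /Phi /= mul0r subr0 big1// => x _.
  by rewrite big_nil mul0r subrr expr0n mulr0.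
by exists s; move: le_s; rewrite Phi0 mulr0 /Phi size_tuple subr_le0.
Qed.

Hypothesis psi_le1 : forall t x, `|psi t x| <= 1.

(** [expR (- y) >= 1 - y] gives [expR y <= 1 / (1 - y)], and the quadratic times [1 - y] is 1 + y^2
    (1 - 2 y), at least 1 on this range. *)
Lemma expR_le_quadratic (y : R) : `|y| <= 2^-1 -> expR y <= 1 + y + 2 * y ^+ 2.
Proof.
rewrite ler_norml => /andP[y1 y2].
have lt0 : 0 < 1 - y by lra.
have : expR y * (1 - y) <= 1.
  rewrite -[leRHS](expRxMexpNx_1 y) ler_wpM2l ?expR_ge0//.
  exact: expR_ge1Dx.
rewrite -ler_pdivlMr// => /le_trans; apply.
by rewrite ler_pdivrMr//; nra.
Qed.

Lemma norm_hull x : `|h x| <= 1.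
Proof.
rewrite /h (le_trans (ler_norm_sum _ _ _))// -w_sum1 ler_sum// => t _.
by rewrite normrM ger0_norm// ler_piMr.
Qed.

(** Hoeffding's bound for both signs, integrated against [omega]: one average of [n] atoms serves
    all points outside a set of small mass, so no union bound over [X] is paid. *)
Lemma hull_approximation (tau : R) (n : nat) :
  0 < tau -> tau <= 4 ->
  exists s : n.-tuple T,
    \sum_(x | tau * n%:R < `|n%:R * h x - \sum_(t <- s) psi t x|) omega x <=
    2 * expR (- (n%:R * tau ^+ 2 / 32)) * \sum_x omega x.
Proof.
(* Each draw adds 8 lam^2 to the exponent and the threshold subtracts lam tau; the difference is
   least here, with value - tau^2 / 32. Deviations are at most 2, so [tau <= 4] keeps the arguments
   of [expR] within 1/2. *)
move=> tau_gt0 tau_le4; pose lam := tau / 16.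
have lam_gt0 : 0 < lam by rewrite divr_gt0.
have lam_le : lam * 2 <= 2^-1 by rewrite /lam; lra.
pose g s x := (size s)%:R * h x - \sum_(t <- s) psi t x.
pose Phi s := \sum_x omega x * (expR (lam * g s x) + expR (- lam * g s x)).
have dev_le t x : `|h x - psi t x| <= 2.
  by rewrite (le_trans (ler_normB _ _))// (_ : 2 = 1 + 1 :> R) ?lerD ?norm_hull.
have mgf (e : R) x : `|e| = lam ->
    \sum_t w t * expR (e * (h x - psi t x)) <= expR (8 * lam ^+ 2).
  move=> ne; have e2 : e ^+ 2 = lam ^+ 2 by rewrite -ne real_normK ?num_real.
  apply: (@le_trans _ _ (\sum_t (w t + e * (w t * (h x - psi t x)) +
        w t * (8 * lam ^+ 2)))).
    apply: ler_sum => t _; set y := e * _.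
    have ny : `|y| <= 2^-1.
      by rewrite /y normrM ne (le_trans _ lam_le)// ler_pM2l.
    have -> : w t + e * (w t * (h x - psi t x)) + w t * (8 * lam ^+ 2) =
       w t * (1 + y + 8 * lam ^+ 2) by rewrite /y; ring.
    rewrite ler_wpM2l// (le_trans (expR_le_quadratic ny))// lerD2l.
    have : (h x - psi t x) ^+ 2 <= 2 ^+ 2.
      by rewrite -real_normK ?num_real// lerXn2r ?nnegrE.
    have := sqr_ge0 lam.
    rewrite /y [(e * _) ^+ 2]exprMn e2; nra.
  rewrite !big_split/= -!mulr_sumr -mulr_suml sum_deviation w_sum1.
  by rewrite mulr0 addr0 mul1r expR_ge1Dx.
have step s : \sum_t w t * Phi (t :: s) <= expR (8 * lam ^+ 2) * Phi s.
  under eq_bigr do rewrite mulr_sumr.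
  rewrite exchange_big mulr_sumr; apply: ler_sum => x _ /=.
  under eq_bigr do rewrite mulrCA mulrDr.
  rewrite -mulr_sumr mulrCA ler_wpM2l// big_split/= mulrDr.
  have part (e : R) : `|e| = lam ->
      \sum_t w t * expR (e * g (t :: s) x) <=
      expR (8 * lam ^+ 2) * expR (e * g s x).
    move=> ne; have gE t : e * g (t :: s) x = e * (h x - psi t x) + e * g s x.
      by rewrite /g big_cons /= -natr1; ring.
    under eq_bigr do rewrite gE expRD mulrA.
    by rewrite -mulr_suml ler_wpM2r ?expR_ge0 ?mgf.
  by rewrite lerD ?part ?normrN// gtr0_norm.
have [s le_s] := conditional_expectations n (expR_ge0 _) step.
exists s; rewrite -(ler_pM2r (expR_gt0 (lam * (tau * n%:R)))).
apply: (@le_trans _ _ (Phi s)).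
  rewrite mulr_suml big_mkcond /=; apply: ler_sum => x _.
  case: ifPn => [|_]; last by rewrite mulr_ge0// addr_ge0// expR_ge0.
  rewrite /g size_tuple => lt_tau; rewrite ler_wpM2l//.
  move: lt_tau; rewrite ltr_normr => /orP[] lt_tau.
    by rewrite ler_wpDr ?expR_ge0// ler_expR ler_pM2l// ltW.
  by rewrite ler_wpDl ?expR_ge0// ler_expR mulNr -mulrN ler_pM2l// ltW.
apply: (le_trans le_s); rewrite /Phi /g /= big_mkcond /=.
under eq_bigr do rewrite mul0r big_nil subr0 !mulr0 expR0.
rewrite -mulr_suml -expRM_natl mulrAC -[2 * _ * _]mulrA -expRD.
rewrite [leLHS](_ : _ = 2 * expR (n%:R * (8 * lam ^+ 2)) * \sum_x omega x).
  rewrite ler_wpM2r ?sumr_ge0// ler_wpM2l// ler_expR /lam; nra.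
by rewrite big_mkcond/=; ring.
Qed.
End Averaging.

(** * Lower bounds for empirical second moments *)

Section Layers.
Variable R : realType.

(** If 2^-(i+1) < y <= 2^-i with i < t, layer i alone has weight 4^-i >= y^2; smaller y is covered
    by the last term. The induction doubles [y] to move by one layer. *)
Lemma sqr_le_dyadic_layers (t : nat) (y : R) : 0 <= y <= 1 ->
  y ^+ 2 <= \sum_(i < t) 4^-1 ^+ i * (2^-1 ^+ i.+1 < y)%R%:R + 4^-1 ^+ t.
Proof.
elim: t y => [|t IHt] y /andP[y_ge0 y_le1].
  by rewrite big_ord0 add0r expr0 expr_le1.
rewrite big_ord_recl /= expr0 mul1r expr1.
have [y_gt|y_le] := ltP 2^-1 y.
  rewrite -addrA -[leLHS]addr0 lerD ?expr_le1// addr_ge0 ?exprn_ge0//.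
  by apply: sumr_ge0 => i _; rewrite mulr_ge0 ?exprn_ge0.
rewrite add0r.
have /IHt : 0 <= 2 * y <= 1 by lra.
have -> : \sum_(i < t) 4^-1 ^+ i * (2^-1 ^+ i.+1 < 2 * y)%R%:R =
   4 * \sum_(i < t) 4^-1 ^+ lift ord0 i * (2^-1 ^+ (lift ord0 i).+1 < y)%R%:R :> R.
  rewrite mulr_sumr; apply: eq_bigr => i _.
  rewrite lift0 [4^-1 ^+ i.+1]exprS !mulrA divff// mul1r.
  by rewrite [2^-1 ^+ i.+2]exprS ltr_pdivrMl.
by rewrite exprMn [4^-1 ^+ t.+1]exprS; lra.
Qed.

(** The thresholds are half those of the upper estimate, which leaves room for approximation. The
    first active weight is below 16 y^2 and the later ones decrease by 1/4, whence 64/3. *)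
Lemma dyadic_layers_le_sqr (t : nat) (y : R) : 0 <= y ->
  \sum_(i < t) 4^-1 ^+ i * (2^-1 ^+ i.+2 < y)%R%:R <= 64 / 3 * y ^+ 2.
Proof.
have geom (s : nat) : \sum_(i < s) 4^-1 ^+ i <= 4 / 3 :> R.
  suff -> : \sum_(i < s) 4^-1 ^+ i = 4 / 3 - 4 / 3 * 4^-1 ^+ s :> R.
    by rewrite gerBl mulr_ge0 ?exprn_ge0// divr_ge0.
  by elim: s => [|s IHs]; rewrite ?big_ord0 ?big_ord_recr/= ?IHs ?exprS; lra.
elim: t y => [|t IHt] y y_ge0.
  by rewrite big_ord0 mulr_ge0 ?sqr_ge0// divr_ge0.
have [y_gt|y_le] := ltP 4^-1 y.
  apply: (@le_trans _ _ (4 / 3)); last nra.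
  apply: le_trans (geom t.+1); apply: ler_sum => i _.
  by rewrite ler_piMr ?exprn_ge0// lern1 leq_b1.
rewrite big_ord_recl /= expr0 mul1r.
have -> : (2^-1 ^+ 2 < y) = false by rewrite ltNge (le_trans y_le)//; lra.
rewrite add0r; have /IHt : 0 <= 2 * y by lra.
have -> : \sum_(i < t) 4^-1 ^+ i * (2^-1 ^+ i.+2 < 2 * y)%R%:R =
   4 * \sum_(i < t) 4^-1 ^+ lift ord0 i * (2^-1 ^+ (lift ord0 i).+2 < y)%R%:R :> R.
  rewrite mulr_sumr; apply: eq_bigr => i _.
  rewrite lift0 [4^-1 ^+ i.+1]exprS !mulrA divff// mul1r.
  by rewrite [2^-1 ^+ i.+3]exprS [in RHS]ltr_pdivrMl.
by rewrite exprMn; lra.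
Qed.

End Layers.

Section Sampling.
Variables (R : realType) (G : finType).
Hypothesis G_gt0 : (0 < #|G|)%N.

Let mu : R := #|G|%:R^-1.

Let mu_ge0 : 0 <= mu. Proof. by rewrite invr_ge0. Qed.

Let mu_sum1 : \sum_(x : G) mu = 1.
Proof. by rewrite sumr_const -[X in X = _]mulr_natl divff// pnatr_eq0 -lt0n. Qed.

(** Chernoff's lower tail with half of the mean given away: no variance enters, and index [i] fails
    with probability at most [expR (- (m%:R * err i))]. [Phi] adds these costs; a final sum at most
    1 bounds each of its nonnegative terms by 1, which is the claim for its index. *)
Lemma lower_tail_selection (I : finType) (B : I -> pred G) (err : I -> R) (m : nat) :
  \sum_i expR (- (m%:R * err i)) <= 1 ->
  exists xi : m.-tuple G, forall i,
    m%:R * (2^-1 * (\sum_x mu * (B i x)%:R) - err i) <= \sum_(x <- xi) (B i x)%:R.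
Proof.
move=> sum_le1; pose p i := \sum_x mu * (B i x)%:R.
have p_le1 i : p i <= 1.
  by rewrite -mu_sum1 ler_sum// => x _; rewrite ler_piMr// lern1 leq_b1.
pose Phi s := \sum_i expR (- (m%:R * err i)) *
  \prod_(x <- s) expR (2^-1 * p i - (B i x)%:R).
have mean i : \sum_x mu * expR (2^-1 * p i - (B i x)%:R) <= 1.
  under eq_bigr do rewrite expRD mulrCA.
  have -> : \sum_x expR (2^-1 * p i) * (mu * expR (- (B i x)%:R)) =
     expR (2^-1 * p i) * (1 - p i * (1 - expR (-1))).
    rewrite -mulr_sumr; congr (_ * _).
    rewrite -[X in X - _]mu_sum1 mulr_suml -sumrB; apply: eq_bigr => x _.
    by case: (B i x) => /=; rewrite ?mulr0 ?oppr0 ?expR0; ring.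
  have e1 : expR (-1) <= 2^-1 :> R.
    by rewrite expRN lef_pV2 ?posrE ?expR_gt0// (le_trans _ (expR_ge1Dx 1)).
  have p_ge0 : 0 <= p i by apply: sumr_ge0 => x _; rewrite mulr_ge0.
  (* As 1 - 1/e >= 1/2, the mean is at most expR (p/2) (1 - p/2), and 1 - p/2 <= expR (- p/2). *)
  rewrite -[leRHS](expRxMexpNx_1 (2^-1 * p i)) ler_wpM2l ?expR_ge0//.
  by apply: le_trans (expR_ge1Dx _); nra.
have step s : \sum_(x : G) mu * Phi (x :: s) <= 1 * Phi s.
  under eq_bigr do rewrite mulr_sumr.
  rewrite exchange_big mul1r; apply: ler_sum => i _ /=.
  under eq_bigr do rewrite big_cons mulrCA [in X in _ * X]mulrA.
  rewrite -mulr_sumr ler_wpM2l ?expR_ge0// -mulr_suml ler_piMl//.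
  by apply: prodr_ge0 => x _; apply: expR_ge0.
have [xi le_xi] := conditional_expectations (fun=> mu_ge0) mu_sum1 m ler01 step.
exists xi => i; have {}le_xi : Phi xi <= 1.
  rewrite (le_trans le_xi)// expr1n mul1r /Phi.
  by under eq_bigr do rewrite big_nil mulr1.
have : expR (- (m%:R * err i)) * \prod_(x <- xi) expR (2^-1 * p i - (B i x)%:R) <= 1.
  apply: le_trans le_xi; rewrite /Phi (bigD1 i)//= lerDl sumr_ge0// => j _.
  by rewrite mulr_ge0 ?expR_ge0// prodr_ge0// => x _; apply: expR_ge0.
rewrite -expR_sum -expRD -[leRHS]expR0 ler_expR sumrB.
rewrite big_const_seq count_predT size_tuple iter_addr_0 -/(p i) -mulr_natl.
by lra.
Qed.

Variables (T : finType) (psi : T -> G -> R).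
Hypothesis psi_le1 : forall t x, `|psi t x| <= 1.

(* Only a lower bound for the empirical second moment: the level sets of a convex
   combination [h] are sandwiched between those of an average of [4 ^ i * kap]
   atoms, and there are few such averages. *)
Theorem convex_hull_sampling (m t kap : nat) (eta : R) :
  (0 < m)%N -> (0 < kap)%N -> 4 * expR (- (kap%:R / 2048)) <= eta ->
  (forall i, (i < t)%N ->
     t%:R * (#|T| ^ (4 ^ i * kap))%:R * expR (- (m%:R * (4 ^+ i * eta))) <= 1) ->
  exists xi : m.-tuple G, forall w : T -> R,
    (forall s, 0 <= w s) -> \sum_s w s = 1 ->
    \sum_x mu * (\sum_s w s * psi s x) ^+ 2 <=
    43 * (m%:R^-1 * \sum_(x <- xi) (\sum_s w s * psi s x) ^+ 2)
     + 4^-1 ^+ t + 6 * t%:R * eta.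
Proof.
move=> m_gt0 kap_gt0 eta_kap eta_m.
pose K i := (4 ^ i * kap)%N.
have eta_gt0 : 0 < eta by apply: lt_le_trans eta_kap; rewrite mulr_gt0 ?expR_gt0.
pose I := {i : 'I_t & (K i).-tuple T}.
(* In units of 2^-i the threshold 3/8 lies midway between the levels 1/2 of [U] and 1/4 of [D]; an
   approximation error [tau] of 1/8 then gives both inclusions off [bad]. *)
pose B (j : I) (x : G) :=
  3 / 8 * 2^-1 ^+ tag j * (K (tag j))%:R < `|\sum_(s <- tagged j) psi s x|.
pose err (j : I) := 4 ^+ tag j * eta.
have [|xi xiB] := @lower_tail_selection I B err m.
  have [t0|t_gt0] := posnP t.
    by rewrite big1 ?ler01// => j; move: (tag j); rewrite t0 => -[].
  rewrite -(@sig_big_dep _ _ _ _ (fun i : 'I_t => (K i).-tuple T : finType)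
     predT (fun _ => predT) (fun i _ => expR (- (m%:R * (4 ^+ i * eta)))))/=.
  (* Each of the [t] scales receives the share 1/t of the union bound. *)
  apply: (@le_trans _ _ (\sum_(i < t) t%:R^-1)); last first.
    by rewrite sumr_const card_ord -[X in X <= _]mulr_natl divff// pnatr_eq0 -lt0n.
  apply: ler_sum => i _; rewrite sumr_const card_tuple -[leLHS]mulr_natl.
  by rewrite -[leRHS]mul1r ler_pdivlMr ?ltr0n// mulrC [leLHS]mulrA eta_m.
exists xi => w w_ge0 w_sum1; set h := fun x => \sum_s w s * psi s x.
pose muQ x : R := m%:R^-1 * \sum_(y <- xi) (y == x)%:R.
have m0 : m%:R != 0 :> R by rewrite pnatr_eq0 -lt0n.
have muQ_ge0 x : 0 <= muQ x.
  by rewrite mulr_ge0 ?invr_ge0// sumr_ge0.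
have muQE (F : G -> R) : \sum_x muQ x * F x = m%:R^-1 * \sum_(y <- xi) F y.
  rewrite /muQ; under eq_bigr do rewrite -mulrA mulr_suml.
  rewrite -mulr_sumr exchange_big; congr (_ * _); apply: eq_bigr => y _ /=.
  rewrite (bigD1 y)//= eqxx mul1r big1 ?addr0// => x /negbTE.
  by rewrite eq_sym => ->; rewrite mul0r.
have muQ_sum1 : \sum_x muQ x = 1.
  have := muQE (fun=> 1); rewrite big_const_seq count_predT size_tuple.
  rewrite iter_addr_0 mulVf// => <-.
  by apply: eq_bigr => x _; rewrite mulr1.
pose U i x : R := (2^-1 ^+ i.+1 < `|h x|)%R%:R.
pose D i x : R := (2^-1 ^+ i.+2 < `|h x|)%R%:R.
have level (i : 'I_t) : 2^-1 * \sum_x mu * U i x - 3 * (4 ^+ i * eta) <=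
    \sum_x muQ x * D i x.
  have half_gt0 : 0 < 2^-1 ^+ i :> R by rewrite exprn_gt0.
  have half_le1 : 2^-1 ^+ i <= 1 :> R by rewrite exprn_ile1// invf_le1// ler1n.
  pose tau : R := 2^-1 ^+ i / 8.
  have tau_gt0 : 0 < tau by rewrite divr_gt0.
  have tau_le4 : tau <= 4 by rewrite /tau; lra.
  (* The sum of the uniform and the empirical measure, of mass 2, lets one average [g] and one
     exceptional set serve both. This mass and the two signs give the factor 4 in [eta_kap]; the
     exponent kap / 2048 is independent of i because [K i] grows as tau^-2. *)
  have ome_ge0 x : 0 <= mu + muQ x by rewrite addr_ge0.
  have [g] := hull_approximation w_ge0 w_sum1 ome_ge0 psi_le1 (K i) tau_gt0 tau_le4.
  rewrite -/(h _); pose bad x := tau * (K i)%:R < `|(K i)%:R * h x - \sum_(s <- g) psi s x|.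
  have -> : \sum_x (mu + muQ x) = 2 by rewrite big_split/= mu_sum1 muQ_sum1.
  have -> : (K i)%:R * tau ^+ 2 / 32 = kap%:R / 2048 :> R.
    have e4 : 4 ^+ i * (2^-1 ^+ i) ^+ 2 = 1 :> R.
      by rewrite -exprM mulnC exprM -exprMn (_ : 4 * 2^-1 ^+ 2 = 1) ?expr1n//; lra.
    rewrite /K /tau natrM natrX exprMn.
    by transitivity (kap%:R / 2048 * (4 ^+ i * 2^-1 ^+ i ^+ 2) : R);
      [field | rewrite e4 mulr1].
  move=> bad_le.
  have {}bad_le : \sum_x mu * (bad x)%:R + \sum_x muQ x * (bad x)%:R <= 4 ^+ i * eta.
    rewrite -big_split/=.
    apply: (@le_trans _ _ eta); last first.
      by rewrite ler_peMl ?(ltW eta_gt0)// exprn_ege1// ler1n.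
    apply: le_trans eta_kap; apply: le_trans (le_trans bad_le _); last by lra.
    rewrite [leRHS]big_mkcond/= le_eqVlt; apply/orP; left; apply/eqP.
    apply: eq_bigr => x _; rewrite /bad; case: ifP; rewrite ?mulr1 ?mulr0 ?addr0//.
  have K_gt0 : 0 < (K i)%:R :> R by rewrite ltr0n muln_gt0 expn_gt0.
  pose j : I := Tagged (fun i : 'I_t => (K i).-tuple T) g.
  have UB x : U i x <= (B j x)%:R + (bad x)%:R.
    rewrite /U /bad /B /= -natrD ler_nat; case: ltP => //= hU.
    case: ltP => //= gB; case: ltP => //= hb; exfalso.
    have : `|(K i)%:R * h x| <= 2^-1 ^+ i / 2 * (K i)%:R.
      rewrite -[(K i)%:R * h x](subrK (\sum_(s <- g) psi s x)).
      by rewrite (le_trans (ler_normD _ _))//; rewrite /tau in hb; lra.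
    rewrite normrM gtr0_norm// mulrC ler_pM2r// leNgt => /negP[].
    by move: hU; rewrite exprSr.
  have BD x : (B j x)%:R <= D i x + (bad x)%:R.
    rewrite /D /bad /B /= -natrD ler_nat; case: ltP => //= hB.
    case: ltP => //= hD; case: ltP => //= hb; exfalso.
    have hK : (K i)%:R * `|h x| <= (K i)%:R * (2^-1 ^+ i / 4).
      by rewrite ler_pM2l// (le_trans hD)// exprSr exprSr; lra.
    have := ler_normB ((K i)%:R * h x) ((K i)%:R * h x - \sum_(s <- g) psi s x).
    rewrite opprB addrC subrK normrM gtr0_norm// => hn.
    by move: hB hb; rewrite /tau; lra.
  have sumUB : \sum_x mu * U i x <= \sum_x mu * (B j x)%:R + \sum_x mu * (bad x)%:R.
    by rewrite -big_split/=; apply: ler_sum => x _; rewrite -mulrDr ler_wpM2l.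
  have sumBD : \sum_x muQ x * (B j x)%:R <= \sum_x muQ x * D i x + \sum_x muQ x * (bad x)%:R.
    by rewrite -big_split/=; apply: ler_sum => x _; rewrite -mulrDr ler_wpM2l.
  have mub_ge0 : 0 <= \sum_x mu * (bad x)%:R by rewrite sumr_ge0// => x _; rewrite mulr_ge0.
  have muQb_ge0 : 0 <= \sum_x muQ x * (bad x)%:R by rewrite sumr_ge0// => x _; rewrite mulr_ge0.
  have := xiB j; rewrite mulrC -ler_pdivlMr ?ltr0n// [X in _ <= X]mulrC -muQE /err /=.
  have := exprn_ge0 i (ler0n R 4); have := mulr_ge0 (exprn_ge0 i (ler0n R 4)) (ltW eta_gt0).
  by lra.
have h_le1 x : `|h x| <= 1 by apply: norm_hull.
have up : \sum_x mu * h x ^+ 2 <=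
    \sum_(i < t) 4^-1 ^+ i * (\sum_x mu * U i x) + 4^-1 ^+ t.
  apply: (@le_trans _ _
      (\sum_x mu * (\sum_(i < t) 4^-1 ^+ i * U i x + 4^-1 ^+ t))).
    apply: ler_sum => x _; rewrite ler_wpM2l// -real_normK ?num_real//.
    by apply: sqr_le_dyadic_layers; rewrite normr_ge0 h_le1.
  under eq_bigr do rewrite mulrDr.
  rewrite big_split/= -mulr_suml mu_sum1 mul1r lerD2r.
  under eq_bigr do rewrite mulr_sumr.
  rewrite exchange_big/= le_eqVlt; apply/orP; left; apply/eqP.
  by apply: eq_bigr => i _; rewrite mulr_sumr; apply: eq_bigr => x _; rewrite mulrCA.
have down : \sum_(i < t) 4^-1 ^+ i * (\sum_x muQ x * D i x) <=
    64 / 3 * \sum_x muQ x * h x ^+ 2.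
  under eq_bigr do rewrite mulr_sumr.
  rewrite exchange_big mulr_sumr/=; apply: ler_sum => x _.
  under eq_bigr do rewrite mulrCA.
  rewrite -mulr_sumr mulrCA ler_wpM2l// -real_normK ?num_real//.
  exact: dyadic_layers_le_sqr.
(* The layer weight 4^-i cancels the factor 4^i of the error, so each scale costs only 3 eta. *)
have mid : 2^-1 * (\sum_(i < t) 4^-1 ^+ i * (\sum_x mu * U i x)) - 3 * t%:R * eta <=
    \sum_(i < t) 4^-1 ^+ i * (\sum_x muQ x * D i x).
  have -> : 3 * t%:R * eta = \sum_(i < t) 3 * eta.
    by rewrite sumr_const card_ord -[RHS]mulr_natl mulrCA mulrA.
  rewrite mulr_sumr -sumrB; apply: ler_sum => i _.
  have e4 : 4^-1 ^+ i * 4 ^+ i = 1 :> R by rewrite -exprMn mulVf ?expr1n.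
  have e_gt0 : 0 < 4^-1 ^+ i :> R by rewrite exprn_gt0.
  apply: (@le_trans _ _ (4^-1 ^+ i *
      (2^-1 * (\sum_x mu * U i x) - 3 * (4 ^+ i * eta)))); last by rewrite ler_pM2l.
  rewrite mulrBr [4^-1 ^+ i * (3 * _)]mulrCA [4^-1 ^+ i * (4 ^+ i * _)]mulrA e4 mul1r.
  by rewrite mulrCA.
(* Doubling [mid] and inserting [down] gives the factor 128/3 <= 43 and the error 6 t eta. *)
rewrite -muQE.
have : 0 <= \sum_x muQ x * h x ^+ 2.
  by apply: sumr_ge0 => x _; rewrite mulr_ge0// sqr_ge0.
by lra.
Qed.

End Sampling.

(** * Iterated integrals over the torus *)

Section TorusIntegral.
Local Open Scope classical_set_scope.
Variable R : realType.

Lemma ball_normr (x e y : R) : ball x e y = (`|x - y| < e).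
Proof. by []. Qed.

Lemma continuous_realP (h : R -> R) :
  (forall t e, 0 < e -> exists2 r, 0 < r & forall s, `|t - s| < r -> `|h t - h s| < e) ->
  continuous h.
Proof.
move=> hh t; apply/cvgrPdist_lt => e e_gt0.
have [r r_gt0 rh] := hh t e e_gt0.
by apply/nbhs_ballP; exists r => // s /=; rewrite ball_normr => /rh.
Qed.

Section Points.
Variable d : nat.
Local Notation pt := 'rV[R]_d.

Definition close (r : R) (x y : pt) := forall i, `|x 0 i - y 0 i| < r.

Lemma continuous_ptP (g : pt -> R) : continuous g <->
  (forall x e, 0 < e -> exists2 r, 0 < r & forall y, close r x y -> `|g x - g y| < e).
Proof.
have FF (x : pt) : Filter (nbhs x) by exact: nbhs_filter.
split=> [gc x e e_gt0|gg x].
  have /(@cvgrPdist_lt R R pt (nbhs x) _ g (g x))/(_ e e_gt0) := gc x.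
  move=> /nbhs_ballP[r /= r_gt0 rg].
  exists r => // y xy; apply: rg; split=> // i j; rewrite (ord1 i).
  by have := xy j.
apply/(@cvgrPdist_lt R R pt (nbhs x) _ g (g x)) => e e_gt0.
have [r r_gt0 rg] := gg x e e_gt0.
apply/nbhs_ballP; exists r => // y /= [_ xy]; apply: rg => i.
exact: xy.
Qed.

Definition in_box (B : R) (x : pt) := forall i, - B <= x 0 i <= B.

Lemma compact_box (B : R) : compact (in_box B).
Proof.
have := @rV_compact R d (fun=> `[- B, B]%classic) (fun=> @segment_compact R _ _).
by rewrite (_ : [set v | _] = in_box B).
Qed.

(** Heine-Cantor by near coverings, the radius being the parameter that tends to 0. Only [x] is
    confined to the box; [y] may leave it. *)
Lemma uniform_modulus (g : pt -> R) (B e : R) : continuous g -> 0 < e ->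
  exists2 r, 0 < r & forall x y, in_box B x -> close r x y -> `|g x - g y| < e.
Proof.
move=> /continuous_ptP gc e_gt0.
have /compact_near_coveringP cK := @compact_box B.
have := cK R (0^'+) (fun r x => forall y, close r x y -> `|g x - g y| < e) _.
case=> [x _|r /= r_gt0 rP].
  have [r r_gt0 rg] := gc x (e / 2) (divr_gt0 e_gt0 (ltr0n _ 2)).
  exists ([set y | close (r / 2) x y], [set s | 0 < s < r / 2]).
    split => /=.
      apply/nbhs_ballP; exists (r / 2); first by rewrite /= divr_gt0.
      by move=> y [_ xy] i; exact: xy.
    exists (r / 2) => /=; first by rewrite divr_gt0.
    move=> s; rewrite /= sub0r normrN => s_lt s_gt0.
    by rewrite s_gt0 -(gtr0_norm s_gt0).
  move=> [y s] /= [xy /andP[s_gt0 s_lt]] z yz.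
  rewrite (_ : g y - g z = (g x - g z) - (g x - g y)); last by ring.
  rewrite (le_lt_trans (ler_normB _ _))// [e]splitr ltrD// rg// => i.
    rewrite (_ : x 0 i - z 0 i = (x 0 i - y 0 i) + (y 0 i - z 0 i)); last by ring.
    rewrite (le_lt_trans (ler_normD _ _))// [r]splitr ltrD ?xy//.
    exact: lt_trans (yz i) s_lt.
  by rewrite (lt_le_trans (xy i))//; lra.
exists (r / 2); first by rewrite divr_gt0.
move=> x y xB; apply: (rP (r / 2)) => //=; last by rewrite divr_gt0.
rewrite sub0r normrN gtr0_norm ?divr_gt0// ltr_pdivrMr// ltr_pMr// ltr1n//.
Qed.

Lemma bounded_on_box (g : pt -> R) (B : R) : continuous g ->
  exists C, forall x, in_box B x -> `|g x| <= C.
Proof.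
move=> gc.
have /compact_bounded[M [_ Mg]] : compact (g @` in_box B).
  apply: continuous_compact (@compact_box B).
  exact: continuous_subspaceT.
by exists (M + 1) => x xB; apply: Mg; [rewrite ltrDl|exists x].
Qed.

End Points.
End TorusIntegral.

(** * Averages over one period *)

Section CircleAverage.
Local Open Scope classical_set_scope.
Variable R : realType.
Implicit Type h : R -> R.

Definition circle_avg h : R :=
  (2 * pi)^-1 * Rintegral (@lebesgue_measure R) `[0, 2 * pi]%classic h.

Lemma twopi_gt0 : 0 < 2 * pi :> R.
Proof. by rewrite mulr_gt0 ?pi_gt0. Qed.
Local Hint Resolve twopi_gt0 : core.

Let period_measurable :
  @measurable _ (measurableTypeR R) `[0, 2 * pi]%classic.
Proof. exact: measurable_itv. Qed.

Lemma continuous_integrable h : continuous h ->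
  (@lebesgue_measure R).-integrable `[0, 2 * pi]%classic (EFin \o h).
Proof.
move=> hc; apply: continuous_compact_integrable; first exact: segment_compact.
exact: continuous_subspaceT.
Qed.

Lemma circle_avgD h1 h2 : continuous h1 -> continuous h2 ->
  circle_avg (fun t => h1 t + h2 t) = circle_avg h1 + circle_avg h2.
Proof.
move=> h1c h2c.
by rewrite /circle_avg (RintegralD period_measurable (continuous_integrable h1c)
  (continuous_integrable h2c)) mulrDr.
Qed.

Lemma circle_avgZ c h : continuous h ->
  circle_avg (fun t => c * h t) = c * circle_avg h.
Proof.
move=> hc.
by rewrite /circle_avg (RintegralZl _ period_measurable (continuous_integrable hc)) mulrCA.
Qed.

Lemma circle_avg_cst c : circle_avg (fun=> c) = c.
Proof.
rewrite /circle_avg Rintegral_cst//= lebesgue_measure_itv/= lte_fin twopi_gt0.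
by rewrite /= subr0 mulrC mulfK// gt_eqF.
Qed.

Lemma le_circle_avg h1 h2 : continuous h1 -> continuous h2 ->
  (forall t, 0 <= t <= 2 * pi -> h1 t <= h2 t) -> circle_avg h1 <= circle_avg h2.
Proof.
move=> h1c h2c le12; rewrite ler_wpM2l ?invr_ge0 ?(ltW twopi_gt0)//.
apply: (le_Rintegral period_measurable (continuous_integrable h1c)
  (continuous_integrable h2c)) => t /=.
by rewrite in_itv /=; exact: le12.
Qed.

Lemma eq_circle_avg h1 h2 : (forall t, 0 <= t <= 2 * pi -> h1 t = h2 t) ->
  circle_avg h1 = circle_avg h2.
Proof.
move=> e12; congr (_ * _); apply: eq_Rintegral => t; rewrite inE /= in_itv /=.
exact: e12.
Qed.

Lemma cos_periodz (k : int) (r : R) : cos (r + k%:~R * (2 * pi)) = cos r.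
Proof.
have P (n : nat) s : cos (s + n%:R * (2 * pi)) = cos s :> R.
  by rewrite -[in RHS](periodicn (@cosD2pi R) n s) !mulr_natl.
case: (intP k) => [|n|n]; first by rewrite mul0r addr0.
  exact: P.
by rewrite mulrNz mulNr -(P n.+1) addrNK.
Qed.

Lemma sin_periodz (k : int) (r : R) : sin (r + k%:~R * (2 * pi)) = sin r.
Proof. by rewrite -!cosBpihalf addrAC cos_periodz. Qed.

Lemma circle_avg_cos (k : int) (r : R) :
  circle_avg (fun t => cos (k%:~R * t + r)) = if k == 0 then cos r else 0.
Proof.
have [->|k0] := eqVneq k 0.
  rewrite -[RHS]circle_avg_cst; apply: eq_circle_avg => t _.
  by rewrite mul0r add0r.
have k0R : k%:~R != 0 :> R by rewrite intr_eq0.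
rewrite /circle_avg /Rintegral.
pose F t : R := k%:~R^-1 * sin (k%:~R * t + r).
have dF (x : R) : is_derive x 1 F (cos (k%:~R * x + r)).
  have dl : is_derive x 1 (fun t : R => k%:~R * t + r) k%:~R.
    apply: is_derive_eq; rewrite /GRing.scale /=; by rewrite mulr1 addr0.
  have ds := @is_derive1_comp _ sin _ x _ _ (is_derive_sin _) dl.
  apply: is_derive_eq; rewrite /GRing.scale /=.
  by rewrite mulrCA mulVf// mulr1.
have cF : continuous F.
  move=> x; apply: differentiable_continuous.
  by apply/derivable1_diffP; case: (dF x).
have cc : continuous (fun t : R => cos (k%:~R * t + r)).
  move=> x; apply: (@continuous_comp _ _ _ (fun t : R => k%:~R * t + r) cos).
    apply: cvgD; last exact: cvg_cst.
    by apply: cvgM; [exact: cvg_cst|exact: cvg_id].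
  exact: continuous_cos.
rewrite (@continuous_FTC2 _ (fun t => cos (k%:~R * t + r)) F)//=.
  by rewrite /F mulr0 add0r (addrC (k%:~R * _)) sin_periodz subrr mulr0.
- exact: continuous_subspaceT.
- split=> [x _||]; first by case: (dF x).
  + exact/cvg_at_right_filter/cF.
  + exact/cvg_at_left_filter/cF.
- move=> x _; rewrite derive1E; by case: (dF x).
Qed.

End CircleAverage.

Section IteratedIntegral.
Local Open Scope classical_set_scope.
Variables (R : realType) (d : nat).
Local Notation pt := 'rV[R]_d.
Implicit Types (g : pt -> R) (x y : pt).

Lemma upd_same x i t : upd x i t 0 i = t.
Proof. by rewrite mxE eqxx. Qed.

Lemma close_upd r x y i t : 0 < r -> close r x y -> close r (upd x i t) (upd y i t).
Proof. by move=> r_gt0 xy j; rewrite !mxE; case: ifP; rewrite ?subrr ?normr0. Qed.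

Lemma close_upd_coord r x i s t : 0 < r -> `|s - t| < r -> close r (upd x i s) (upd x i t).
Proof. by move=> r_gt0 st j; rewrite !mxE; case: ifP; rewrite ?subrr ?normr0. Qed.

Lemma continuous_upd g x i : continuous g -> continuous (fun t => g (upd x i t)).
Proof.
move=> /continuous_ptP gc; apply: continuous_realP => t e e_gt0.
have [r r_gt0 rg] := gc (upd x i t) e e_gt0.
by exists r => // s st; apply: rg; exact: close_upd_coord.
Qed.

Lemma in_box_exists x : exists B, in_box B x.
Proof.
exists (\sum_i `|x 0 i|) => i; rewrite -ler_norml (bigD1 i)//= lerDl.
exact: sumr_ge0.
Qed.

Lemma continuous_circle_avg g i : continuous g ->
  continuous (fun x => circle_avg (fun t => g (upd x i t))).
Proof.
move=> gc; apply/continuous_ptP => x e e_gt0.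
have [B xB] := in_box_exists x.
(* The box must still hold [x] after a coordinate has been replaced by a point of [0, 2 pi]. Since
   [y] may lie outside, both comparisons below take the point in the box as the base of the
   modulus. *)
have [r r_gt0 rg] := uniform_modulus (Num.max B (2 * pi)) gc (divr_gt0 e_gt0 (ltr0n _ 2)).
exists r => // y xy.
have le_e (u z : pt) : in_box B u \/ in_box B z -> close r u z ->
    circle_avg (fun t => g (upd u i t)) <=
    circle_avg (fun t => g (upd z i t)) + e / 2.
  move=> uzB uz; rewrite -[X in _ <= _ + X]circle_avg_cst.
  have ec : continuous (fun _ : R => e / 2) by move=> ?; exact: cvg_cst.
  have zc := continuous_upd (x := z) (i := i) gc.
  rewrite -circle_avgD//; apply: le_circle_avg.
  - exact: continuous_upd.
  - by move=> t; apply: cvgD; [exact: zc|exact: ec].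
  move=> t /andP[t_ge0 t_le]; rewrite -lerBlDl (le_trans (ler_norm _))//.
  have uB w : in_box B w -> in_box (Num.max B (2 * pi)) (upd w i t).
    move=> wB j; rewrite mxE -ler_norml le_max; case: ifP => _.
      by rewrite ger0_norm// t_le orbT.
    by rewrite ler_norml wB.
  case: uzB => [uB'|zB].
    by apply/ltW/rg; [exact: uB|exact: close_upd].
  rewrite distrC; apply/ltW/rg; first exact: uB.
  by apply: close_upd => // j; rewrite distrC; exact: uz.
have yx : close r y x by move=> j; rewrite distrC.
have h1 := le_e x y (or_introl xB) xy.
have h2 := le_e y x (or_intror xB) yx.
by rewrite ltr_norml; apply/andP; split; lra.
Qed.

Lemma continuous_iter_int s g : continuous g -> continuous (iter_int s g).
Proof.
by move=> gc; elim: s => [//|i s IHs]; exact: continuous_circle_avg.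
Qed.

Lemma iter_intD s g1 g2 x : continuous g1 -> continuous g2 ->
  iter_int s (fun y => g1 y + g2 y) x = iter_int s g1 x + iter_int s g2 x.
Proof.
move=> g1c g2c; elim: s x => [//|i s IHs] x.
rewrite /= -/(circle_avg _); under eq_circle_avg do rewrite IHs.
by rewrite circle_avgD//; apply: continuous_upd; exact: continuous_iter_int.
Qed.

Lemma iter_intZ s c g x : continuous g ->
  iter_int s (fun y => c * g y) x = c * iter_int s g x.
Proof.
move=> gc; elim: s x => [//|i s IHs] x.
rewrite /= -/(circle_avg _); under eq_circle_avg do rewrite IHs.
by rewrite circle_avgZ//; apply: continuous_upd; exact: continuous_iter_int.
Qed.

Lemma iter_int_cst s c x : iter_int s (fun=> c) x = c.
Proof.
elim: s x => [//|i s IHs] x.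
rewrite /= -/(circle_avg _); under eq_circle_avg do rewrite IHs.
exact: circle_avg_cst.
Qed.

Lemma eq_iter_int s g1 g2 x : g1 =1 g2 -> iter_int s g1 x = iter_int s g2 x.
Proof. by move=> /funext ->. Qed.

Lemma le_iter_int s g1 g2 x : continuous g1 -> continuous g2 ->
  (forall y, g1 y <= g2 y) -> iter_int s g1 x <= iter_int s g2 x.
Proof.
move=> g1c g2c le12; elim: s x => [//|i s IHs] x /=.
by apply: le_circle_avg => [||t _]; last exact: IHs;
  apply: continuous_upd; exact: continuous_iter_int.
Qed.

Lemma kdot_upd (k : freq d) x i t : kdot k (upd x i t) =
  (k i)%:~R * t + \sum_(j < d | j != i) (k j)%:~R * x 0 j.
Proof.
rewrite /kdot (bigD1 i)//= upd_same; congr (_ + _).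
by apply: eq_bigr => j /negbTE ji; rewrite mxE ji.
Qed.

(** The coordinates not being integrated enter [circle_avg_cos] as a phase. The extra [r] also
    covers the sine, as a shift by pi / 2. *)
Lemma iter_int_cos s (k : freq d) r x :
  iter_int s (fun y => cos (kdot k y + r)) x =
  if all (fun i => k i == 0) s then cos (kdot k x + r) else 0.
Proof.
elim: s x => [//|i s IHs] x; rewrite /= -/(circle_avg _).
rewrite (_ : (fun t => _) = fun t => if all (fun i => k i == 0) s then
  cos ((k i)%:~R * t + (\sum_(j < d | j != i) (k j)%:~R * x 0 j + r)) else 0);
  last by apply/funext => t; rewrite IHs kdot_upd addrA.
case: (all _ s); last by rewrite circle_avg_cst andbF.
rewrite circle_avg_cos andbT; case: eqVneq => // ki.
by congr (cos (_ + _)); rewrite [RHS](bigD1 i)//= ki mul0r add0r.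
Qed.

End IteratedIntegral.

Section TorusInt.
Local Open Scope classical_set_scope.
Variables (R : realType) (d : nat).
Local Notation pt := 'rV[R]_d.
Implicit Types (g : pt -> R).

Lemma torus_intD g1 g2 : continuous g1 -> continuous g2 ->
  torus_int (fun y => g1 y + g2 y) = torus_int g1 + torus_int g2.
Proof. exact: iter_intD. Qed.

Lemma torus_intZ c g : continuous g -> torus_int (fun y => c * g y) = c * torus_int g.
Proof. exact: iter_intZ. Qed.

Lemma torus_int_cst c : torus_int (fun _ : pt => c) = c.
Proof. exact: iter_int_cst. Qed.

Lemma eq_torus_int g1 g2 : g1 =1 g2 -> torus_int g1 = torus_int g2.
Proof. exact: eq_iter_int. Qed.

Lemma le_torus_int g1 g2 : continuous g1 -> continuous g2 ->
  (forall y, g1 y <= g2 y) -> torus_int g1 <= torus_int g2.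
Proof. exact: le_iter_int. Qed.

Lemma torus_int_cos (k : freq d) r :
  torus_int (fun y : pt => cos (kdot k y + r)) =
  if k == 0 then cos r else 0.
Proof.
rewrite /torus_int iter_int_cos.
have -> : all (fun i => k i == 0) (enum 'I_d) = (k == 0).
  apply/allP/eqP => [k0|-> i _]; last by rewrite ffunE.
  by apply/ffunP => i; rewrite ffunE; apply/eqP/k0; rewrite mem_enum.
case: eqP => // _; rewrite /kdot big1 ?add0r// => i _.
by rewrite mxE mulr0.
Qed.

Lemma continuous_ptD g1 g2 : continuous g1 -> continuous g2 ->
  continuous (fun x => g1 x + g2 x).
Proof.
move=> /continuous_ptP g1c /continuous_ptP g2c; apply/continuous_ptP => x e e_gt0.
have e2 : 0 < e / 2 by rewrite divr_gt0.
have [r1 r1_gt0 h1] := g1c x _ e2; have [r2 r2_gt0 h2] := g2c x _ e2.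
exists (Num.min r1 r2); first by rewrite lt_min r1_gt0.
move=> y xy; rewrite (_ : _ - _ = (g1 x - g1 y) + (g2 x - g2 y)); last by ring.
rewrite (le_lt_trans (ler_normD _ _))// [e]splitr ltrD// ?h1 ?h2// => i;
by have := xy i; rewrite lt_min => /andP[].
Qed.

Lemma continuous_pt_comp (h : R -> R) g : continuous h -> continuous g ->
  continuous (fun x => h (g x)).
Proof.
move=> hc /continuous_ptP gc; apply/continuous_ptP => x e e_gt0.
have /cvgrPdist_lt/(_ e e_gt0)/nbhs_ballP[r /= r_gt0 rh] := hc (g x).
have [s s_gt0 sg] := gc x r r_gt0.
by exists s => // y xy; apply: rh; exact: sg.
Qed.

Lemma continuous_ptZ c g : continuous g -> continuous (fun x => c * g x).
Proof.
move=> gc; apply: (@continuous_pt_comp (fun t => c * t)) => // t.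
by apply: cvgM; [exact: cvg_cst|exact: cvg_id].
Qed.

Lemma continuous_pt_cst c : continuous (fun _ : pt => c : R).
Proof.
by apply/continuous_ptP => x e e_gt0; exists 1 => // y _; rewrite subrr normr0.
Qed.

(** Polarization: squares are compositions with a real function, so products need no epsilon
    argument of their own. *)
Lemma continuous_ptM g1 g2 : continuous g1 -> continuous g2 ->
  continuous (fun x => g1 x * g2 x).
Proof.
move=> g1c g2c.
have -> : (fun x => g1 x * g2 x) = (fun x => 4^-1 * (g1 x + g2 x) ^+ 2 +
   - 4^-1 * (g1 x + -1 * g2 x) ^+ 2) by apply/funext => x; field.
have sqrc : continuous (fun t : R => t ^+ 2) by move=> t; exact: exprn_continuous.
apply: continuous_ptD; apply: continuous_ptZ; apply: (continuous_pt_comp sqrc).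
  exact: continuous_ptD.
by apply: continuous_ptD => //; exact: continuous_ptZ.
Qed.

Lemma continuous_pt_sum (I : Type) (s : seq I) (P : pred I) (G : I -> pt -> R) :
  (forall i, continuous (G i)) -> continuous (fun x => \sum_(i <- s | P i) G i x).
Proof.
move=> Gc; elim: s => [|i s IHs].
  rewrite (_ : (fun x => _) = (fun=> 0)); first exact: continuous_pt_cst.
  by apply/funext => x; rewrite big_nil.
rewrite (_ : (fun x => _) = (fun x => (if P i then 1 else 0) * G i x +
   \sum_(i <- s | P i) G i x)).
  by apply: continuous_ptD => //; exact: continuous_ptZ.
by apply/funext => x; rewrite big_cons; case: ifP; rewrite ?mul1r ?mul0r ?add0r.
Qed.

Lemma torus_int_sum (I : Type) (s : seq I) (P : pred I) (G : I -> pt -> R) :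
  (forall i, continuous (G i)) ->
  torus_int (fun x => \sum_(i <- s | P i) G i x) = \sum_(i <- s | P i) torus_int (G i).
Proof.
move=> Gc; elim: s => [|i s IHs].
  rewrite big_nil -[RHS]torus_int_cst; apply: eq_torus_int => x.
  by rewrite big_nil.
rewrite big_cons -IHs; case: ifP => Pi.
  rewrite -torus_intD//; last exact: continuous_pt_sum.
  by apply: eq_torus_int => x; rewrite big_cons Pi.
by apply: eq_torus_int => x; rewrite big_cons Pi.
Qed.

Lemma continuous_kdot (k : freq d) r : continuous (fun x : pt => kdot k x + r).
Proof.
apply: continuous_ptD; last exact: continuous_pt_cst.
apply: continuous_pt_sum => i; apply: continuous_ptZ.
exact: coord_continuous.
Qed.

Lemma continuous_cos_kdot (k : freq d) r : continuous (fun x : pt => cos (kdot k x + r)).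
Proof. by apply: continuous_pt_comp; [exact: continuous_cos|exact: continuous_kdot]. Qed.

End TorusInt.

(** * Fourier inversion *)

Section Translates.
Local Open Scope classical_set_scope.
Variables (R : realType) (d n : nat).
Hypothesis n_gt0 : (0 < n)%N.

Local Notation cube := {ffun 'I_d -> 'I_n}.

Definition cube_freq (j : cube) : freq d := [ffun i => (j i)%:Z].

Lemma cube_freq_inj : injective cube_freq.
Proof.
move=> j l /ffunP jl; apply/ffunP => i; apply/val_inj.
by have := jl i; rewrite !ffunE => -[].
Qed.

(** The cube [0,n)^d moved so that [l] goes to 0. Averaging the plain sums over these moved cubes
    gives the Fejer mean, without handling its product weights. *)
Definition translates (l : cube) : seq (freq d) :=
  [seq cube_freq j - cube_freq l | j : cube].

Lemma translates_uniq l : uniq (translates l).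
Proof.
by rewrite map_inj_uniq ?enum_uniq// => j j' /addIr/cube_freq_inj.
Qed.

Lemma sum_cube_coord (i : 'I_d) (F : 'I_n -> R) :
  n%:R * \sum_(l : cube) F (l i) = (n ^ d)%:R * \sum_y F y.
Proof.
pose g (j : 'I_d) y := if j == i then F y else 1.
have -> : \sum_(l : cube) F (l i) = \sum_(l : cube) \prod_j g j (l j).
  apply: eq_bigr => l _; rewrite (bigD1 i)//= {1}/g eqxx big1 ?mulr1// => j ji.
  by rewrite /g (negbTE ji).
rewrite -(bigA_distr_bigA g) (bigD1 i)//= {1}/g eqxx.
have -> : \prod_(j < d | j != i) \sum_(y < n) g j y = n%:R ^+ d.-1.
  rewrite (eq_bigr (fun=> n%:R)) => [|j ji].
    by rewrite prodr_const cardC1 card_ord.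
  by rewrite /g (negbTE ji) sumr_const card_ord.
by rewrite mulrCA -exprS prednK ?natrX 1?mulrC// (leq_trans _ (ltn_ord i)).
Qed.

Lemma sum_small_ord (c : nat) : (\sum_(y < n) (y < c) <= c)%N.
Proof.
suff -> : (\sum_(y < n) (y < c) = minn n c)%N by rewrite geq_minr.
by elim: (n) => [|p IHp]; rewrite ?big_ord0 ?min0n// big_ord_recr/= IHp; lia.
Qed.

Lemma shifted_out (k : int) :
  \sum_(y < n) (~~ (0 <= y%:Z + k < n%:Z))%R%:R <= `|k|%N%:R :> R.
Proof.
rewrite -natr_sum ler_nat; have [k_ge0|k_lt0] := lerP 0 k.
  apply: leq_trans (sum_small_ord `|k|%N); rewrite (reindex_inj rev_ord_inj)/=.
  by apply: leq_sum => y _; have := ltn_ord y; lia.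
apply: leq_trans (sum_small_ord `|k|%N).
by apply: leq_sum => y _; have := ltn_ord y; lia.
Qed.

(** The left side is 1 minus the Fejer weight of [k]. A frequency is missed only if some l_i + k_i
    leaves [0,n), which happens for at most |k_i| of the n values of l_i. *)
Lemma sum_translates_out (k : freq d) :
  ((n ^ d)%:R)^-1 * \sum_(l : cube) (k \notin translates l)%:R <=
  (\sum_i `|k i|%N)%:R / n%:R :> R.
Proof.
have n0 : n%:R != 0 :> R by rewrite pnatr_eq0 -lt0n.
have nd_gt0 : 0 < (n ^ d)%:R :> R by rewrite ltr0n expn_gt0 n_gt0.
rewrite ler_pdivrMl// mulrA ler_pdivlMr ?ltr0n//.
pose out i (y : 'I_n) := ~~ (0 <= y%:Z + k i < n%:Z).
apply: (@le_trans _ _ (\sum_i n%:R * \sum_(l : cube) (out i (l i))%:R)).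
  rewrite mulrC -mulr_sumr ler_wpM2l// exchange_big/=; apply: ler_sum => l _.
  rewrite -natr_sum ler_nat; case: (boolP (k \in _)) => //= kl.
  rewrite lt0n sum_nat_eq0 negb_forall; apply: contraR kl => /existsPn out0.
  have inl i : 0 <= (l i)%:Z + k i < n%:Z.
    by have := out0 i; rewrite negbK eqb0 negbK.
  apply/mapP; have lt_n i : (absz ((l i)%:Z + k i)%R < n)%N by have := inl i; lia.
  exists [ffun i => Ordinal (lt_n i)]; first by rewrite mem_enum.
  apply/ffunP => i; rewrite !ffunE /=.
  by have /andP[inl0 _] := inl i; rewrite gez0_abs// addrAC subrr add0r.
rewrite (eq_bigr (fun i => (n ^ d)%:R * \sum_y (out i y)%:R)) => [|i _]; last first.
  exact: (sum_cube_coord i (fun y => (out i y)%:R)).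
rewrite -mulr_sumr natr_sum ler_wpM2l//; apply: ler_sum => i _.
exact: shifted_out.
Qed.

End Translates.

(** * Oscillation of periodic functions *)

Section Periodic.
Local Open Scope classical_set_scope.
Variables (R : realType) (d : nat).
Local Notation pt := 'rV[R]_d.
Implicit Types (a b : pt -> R) (x y : pt).

Definition periodic a := forall x i, a (upd x i (x 0 i + 2 * pi)) = a x.

Lemma periodic_upd a x i (m : int) : periodic a ->
  a (upd x i (x 0 i + m%:~R * (2 * pi))) = a x.
Proof.
move=> ap.
have upd2 y t s : upd (upd y i t) i s = upd y i s :> pt.
  by apply/rowP => j; rewrite !mxE; case: eqP.
have P (n : nat) y : a (upd y i (y 0 i + n%:R * (2 * pi))) = a y.
  elim: n => [|n IHn].
    by rewrite mul0r addr0; congr a; apply/rowP => j; rewrite mxE; case: eqP => // ->.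
  rewrite -[RHS]IHn -[RHS](ap _ i) upd2 upd_same; congr (a (upd _ _ _)).
  by rewrite -natr1; ring.
case: (intP m) => [|n|n]; [exact: (P 0%N)|exact: P|].
rewrite -[LHS](P n.+1) upd2 upd_same -[RHS](P 0%N); congr (a (upd _ _ _)).
by rewrite mulrNz; ring.
Qed.

Lemma periodic_shift a x (m : 'I_d -> int) : periodic a ->
  a (\row_i (x 0 i + (m i)%:~R * (2 * pi))) = a x.
Proof.
move=> ap.
have P (s : seq 'I_d) : uniq s ->
    a (\row_i (x 0 i + (if i \in s then m i else 0)%:~R * (2 * pi))) = a x.
  elim: s => [_|j s IHs /= /andP[js us]].
    by congr a; apply/rowP => i; rewrite mxE mul0r addr0.
  rewrite -[RHS](IHs us) -[RHS](periodic_upd _ j (m j) ap); congr a.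
  apply/rowP => i; rewrite !mxE in_cons; case: eqVneq => //= ->.
  by rewrite (negbTE js) mul0r addr0.
rewrite -[RHS](P _ (enum_uniq 'I_d)); congr a; apply/rowP => i.
by rewrite !mxE mem_enum.
Qed.

(* The modulus of continuity of a periodic function, expressed through the only
   trigonometric moment of the kernel that has to be computed. *)
Lemma periodic_oscillation a x (e : R) : continuous a -> periodic a -> 0 < e ->
  exists2 C, 0 <= C & forall y,
    `|a x - a y| <= e + C * \sum_i (1 - cos (y 0 i - x 0 i)).
Proof.
move=> ac ap e_gt0.
have [B0 xB0] := in_box_exists x.
have [C1 aC1] := bounded_on_box (B0 + pi) ac.
have /continuous_ptP/(_ x e e_gt0)[r r_gt0 rg] := ac.
pose rho := Num.min r 1.
have rho_gt0 : 0 < rho by rewrite lt_min r_gt0 ltr01.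
have rho_pi : rho <= pi.
  by have := pi_ge2 R; rewrite ge_min => pi2; apply/orP; right; lra.
have cos_rho : cos rho < 1.
  rewrite -[ltRHS](@cos0 R) ltr_cos ?in_itv/= ?lexx ?pi_ge0 ?rho_pi ?ltW//.
have C1_ge0 : 0 <= C1.
  apply: le_trans (aC1 x _) => // i; have := xB0 i; have := @pi_ge0 R; lra.
have c_gt0 : 0 < 1 - cos rho by rewrite subr_gt0.
have cos1 t : 0 <= 1 - cos t :> R by rewrite subr_ge0 cos_le1.
(* Away from [x] the difference is at most 2 C1, while the sum of the 1 - cos is at least 1 - cos
   rho. *)
exists (2 * C1 / (1 - cos rho)); first by rewrite divr_ge0 ?mulr_ge0// ltW.
move=> y.
(* [z] is [y] moved by whole periods to within pi of [x] in every coordinate, where 1 - cos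
   increases with the distance. *)
pose u i := (y 0 i - x 0 i) / (2 * pi) + 2^-1.
pose z := \row_i (y 0 i + (- Num.floor (u i))%:~R * (2 * pi)).
have az : a z = a y by apply: periodic_shift.
have zx i : `|z 0 i - x 0 i| <= pi.
  have -> : z 0 i - x 0 i = (u i - (Num.floor (u i))%:~R - 2^-1) * (2 * pi).
    rewrite mxE mulrNz; move: (Num.floor _) => q; rewrite /u.
    by move: (lt0r_neq0 (pi_gt0 R)); move: pi => p p0; field.
  have /andP[f1 f2] := floor_itv (u i).
  rewrite normrM (gtr0_norm (twopi_gt0 R)) mulrA ler_piMl ?pi_ge0//.
  move: f2; rewrite intrD => f2; rewrite -ler_pdivlMr// ler_norml; lra.
have cosz i : cos (z 0 i - x 0 i) = cos (y 0 i - x 0 i).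
  by rewrite mxE addrAC cos_periodz.
have zB : in_box (B0 + pi) z.
  move=> i; have := zx i; have := xB0 i; rewrite ler_norml; lra.
have xB : in_box (B0 + pi) x.
  by move=> i; have := xB0 i; have := @pi_ge0 R; lra.
rewrite -az; have [zr|] := pselect (close rho x z).
  rewrite -[leLHS]addr0 lerD//.
    by rewrite ltW// rg// => i; rewrite (lt_le_trans (zr i))// ge_min lexx.
  by rewrite mulr_ge0 ?divr_ge0 ?mulr_ge0 ?(ltW c_gt0)// sumr_ge0.
move=> /existsNP[i /negP]; rewrite -leNgt distrC => rho_le.
have : 1 - cos rho <= \sum_i (1 - cos (y 0 i - x 0 i)).
  rewrite (bigD1 i)//= -[leLHS]addr0 lerD// ?sumr_ge0//.
  rewrite lerD2l lerN2 -cosz -cos_norm; case: ltgtP rho_le => // [lt|->] _ //.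
  by rewrite ltW// ltr_cos ?in_itv/= ?normr_ge0 ?zx ?rho_pi ?ltW.
rewrite -(ler_pM2l (_ : 0 < (1 - cos rho)^-1)) ?invr_gt0// mulVf ?gt_eqF// => h1.
apply: (@le_trans _ _ (2 * C1)).
  by rewrite (le_trans (ler_normB _ _))// mulr_natl mulr2n lerD ?aC1.
by rewrite -mulrA; nra.
Qed.

End Periodic.

Section Kdot.
Local Open Scope classical_set_scope.
Variables (R : realType) (d : nat).
Local Notation pt := 'rV[R]_d.

Lemma kdotD (k l : freq d) (x : pt) : kdot (k + l) x = kdot k x + kdot l x.
Proof.
by rewrite /kdot -big_split; apply: eq_bigr => i _; rewrite ffunE intrD mulrDl.
Qed.

Lemma kdotN (k : freq d) (x : pt) : kdot (- k) x = - kdot k x.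
Proof.
by rewrite /kdot -sumrN; apply: eq_bigr => i _; rewrite ffunE mulrNz mulNr.
Qed.

Lemma kdot0 (x : pt) : kdot 0 x = 0.
Proof. by rewrite /kdot big1// => i _; rewrite ffunE mul0r. Qed.

Definition unit_freq (i : 'I_d) : freq d := [ffun j => (j == i)%:Z].

Lemma kdot_unit (i : 'I_d) (x : pt) : kdot (unit_freq i) x = x 0 i.
Proof.
rewrite /kdot (bigD1 i)//= big1 ?addr0 => [|j /negbTE ji].
  by rewrite ffunE eqxx mul1r.
by rewrite ffunE ji mul0r.
Qed.

Lemma torus_int_cosB (k : freq d) (x : pt) :
  torus_int (fun y : pt => cos (kdot k y - kdot k x)) = (k == 0)%:R.
Proof. by rewrite torus_int_cos; case: eqP => // ->; rewrite kdot0 oppr0 cos0. Qed.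

End Kdot.

(** * The Fejer kernel *)

Section FejerMean.
Local Open Scope classical_set_scope.
Variables (R : realType) (d n : nat).
Hypothesis n_gt0 : (0 < n)%N.
Local Notation pt := 'rV[R]_d.
Local Notation cube := {ffun 'I_d -> 'I_n}.
Variable x : pt.

(** The d-dimensional Fejer kernel centred at [x], without the factor n^-d. It is the squared
    modulus of the sum of e^{i(j,y-x)} over the cube, hence nonnegative. *)
Definition fejer (y : pt) : R :=
  \sum_(l : cube) \sum_(k <- translates l) cos (kdot k y - kdot k x).

Let z (y : pt) (j : cube) : R := kdot (cube_freq j) y - kdot (cube_freq j) x.

Lemma sum_translates (l : cube) (F : freq d -> R) :
  \sum_(k <- translates l) F k = \sum_(j : cube) F (cube_freq j - cube_freq l).
Proof. by rewrite big_map big_enum. Qed.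

Lemma kdot_translate (y : pt) (j l : cube) :
  kdot (cube_freq j - cube_freq l) y - kdot (cube_freq j - cube_freq l) x =
  z y j - z y l.
Proof. by rewrite !kdotD !kdotN /z; ring. Qed.

Lemma fejer_ge0 y : 0 <= fejer y.
Proof.
rewrite (_ : fejer y = (\sum_j cos (z y j)) ^+ 2 + (\sum_j sin (z y j)) ^+ 2).
  by rewrite addr_ge0 ?sqr_ge0.
rewrite !expr2 !mulr_sumr -big_split/=; apply: eq_bigr => l _.
rewrite sum_translates !mulr_suml -big_split/=; apply: eq_bigr => j _.
by rewrite kdot_translate cosB.
Qed.

(** Exchanging [j] and [l] changes the sign of j - l. This is what removes the imaginary part [b]
    from the Fejer mean. *)
Lemma sum_sin_translates y :
  \sum_(l : cube) \sum_(k <- translates l) sin (kdot k y - kdot k x) = 0.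
Proof.
set S := LHS; suff : S = - S by lra.
rewrite /S -sumrN; under eq_bigr do rewrite sum_translates.
rewrite exchange_big/=; apply: eq_bigr => l _; rewrite sum_translates -sumrN.
by apply: eq_bigr => j _; rewrite !kdot_translate -opprB sinN.
Qed.

Lemma continuous_fejer : continuous fejer.
Proof.
apply: continuous_pt_sum => l; apply: continuous_pt_sum => k.
exact: continuous_cos_kdot.
Qed.

Lemma sum_translates_eq (l : cube) (k : freq d) :
  \sum_(k' <- translates l) (k' == k)%:R = (k \in translates l)%:R :> R.
Proof.
rewrite -count_uniq_mem ?translates_uniq// -sum1_count natr_sum [RHS]big_mkcond/=.
by apply: eq_bigr => k' _; case: eqP.
Qed.

Lemma zero_translate (l : cube) : 0 \in translates l.
Proof. by apply/mapP; exists l; rewrite ?mem_enum ?subrr. Qed.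

Lemma torus_int_fejer : torus_int fejer = (n ^ d)%:R.
Proof.
rewrite torus_int_sum => [|l]; last first.
  by apply: continuous_pt_sum => k; exact: continuous_cos_kdot.
rewrite (eq_bigr (fun=> 1)) => [|l _].
  by rewrite sumr_const card_ffun !card_ord.
rewrite torus_int_sum => [|k]; last exact: continuous_cos_kdot.
under eq_bigr do rewrite torus_int_cosB.
by rewrite sum_translates_eq zero_translate.
Qed.

(** The product formula moves each frequency by plus or minus the i-th unit vector, so the integral
    counts the translates that contain these two vectors; each is missed by a fraction at most 1/n.
    Hence 1 - cos integrates to at most n^d / n against the kernel, which is its concentration at
    [x]. *)
Lemma torus_int_fejer_cos (i : 'I_d) : (n ^ d)%:R * (1 - n%:R^-1) <=
  torus_int (fun y => fejer y * cos (y 0 i - x 0 i)).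
Proof.
have E y : fejer y * cos (y 0 i - x 0 i) =
   \sum_(l : cube) (\sum_(k <- translates l)
     (2^-1 * cos (kdot (k + unit_freq i) y - kdot (k + unit_freq i) x) +
      2^-1 * cos (kdot (k - unit_freq i) y - kdot (k - unit_freq i) x))).
  rewrite /fejer mulr_suml; apply: eq_bigr => l _.
  rewrite mulr_suml; apply: eq_bigr => k _.
  rewrite !kdotD !kdotN !kdot_unit; set u := kdot k y; set v := kdot k x.
  rewrite (_ : u + _ - _ = (u - v) + (y 0 i - x 0 i)); last by ring.
  rewrite (_ : u - _ - _ = (u - v) - (y 0 i - x 0 i)); last by ring.
  move: (u - v) (y 0 i - x 0 i) => w t; rewrite cosD cosB; lra.
have c1 k : continuous (fun y : pt =>
    2^-1 * cos (kdot (k + unit_freq i) y - kdot (k + unit_freq i) x)).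
  by apply: continuous_ptZ; exact: continuous_cos_kdot.
have c2 k : continuous (fun y : pt =>
    2^-1 * cos (kdot (k - unit_freq i) y - kdot (k - unit_freq i) x)).
  by apply: continuous_ptZ; exact: continuous_cos_kdot.
have c12 k := continuous_ptD (c1 k) (c2 k).
rewrite (eq_torus_int E) torus_int_sum => [|l]; last exact: continuous_pt_sum.
have I k : torus_int (fun y : pt =>
    2^-1 * cos (kdot (k + unit_freq i) y - kdot (k + unit_freq i) x) +
    2^-1 * cos (kdot (k - unit_freq i) y - kdot (k - unit_freq i) x)) =
    2^-1 * (k == - unit_freq i)%:R + 2^-1 * (k == unit_freq i)%:R.
  rewrite torus_intD// !torus_intZ; try exact: continuous_cos_kdot.
  by rewrite !torus_int_cosB addr_eq0 subr_eq0.
under eq_bigr do rewrite torus_int_sum//; under eq_bigr => l _.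
  under eq_bigr do rewrite I.
  rewrite big_split/= -!mulr_sumr !sum_translates_eq.
  over.
rewrite big_split/= -!mulr_sumr.
have P (k : freq d) : (\sum_j `|k j|%N)%N = 1%N ->
    (n ^ d)%:R * (1 - n%:R^-1) <= \sum_(l : cube) (k \in translates l)%:R :> R.
  move=> k1; have := @sum_translates_out R d n n_gt0 k; rewrite k1 div1r.
  rewrite ler_pdivrMl ?ltr0n ?expn_gt0 ?n_gt0// => out.
  rewrite (_ : \sum_l _ = (n ^ d)%:R - \sum_(l : cube) (k \notin translates l)%:R).
    by rewrite mulrBr mulr1 lerB.
  rewrite (_ : (n ^ d)%:R = \sum_(l : cube) 1); last first.
    by rewrite sumr_const card_ffun !card_ord.
  by rewrite -sumrB; apply: eq_bigr => l _; case: (_ \in _); rewrite ?subr0 ?subrr.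
have u1 : (\sum_j `|unit_freq i j|%N)%N = 1%N.
  rewrite (bigD1 i)//= big1 ?ffunE ?eqxx// => j /negbTE ji.
  by rewrite ffunE ji.
have := P _ u1; have : (\sum_j `|(- unit_freq i) j|%N)%N = 1%N.
  by rewrite -[RHS]u1; apply: eq_bigr => j _; rewrite ffunE abszN.
by move=> /P; lra.
Qed.

Variables a b : pt -> R.
Hypothesis a_cont : continuous a.
Hypothesis b_cont : continuous b.

(** Real and imaginary part of the Fourier coefficient of a + ib; [harmonic] is the real part of
    that coefficient times e^{i(k,x)}. *)
Definition cos_coef (k : freq d) : R :=
  torus_int (fun y : pt => a y * cos (kdot k y) + b y * sin (kdot k y)).
Definition sin_coef (k : freq d) : R :=
  torus_int (fun y : pt => b y * cos (kdot k y) - a y * sin (kdot k y)).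
Definition harmonic (k : freq d) : R :=
  cos_coef k * cos (kdot k x) - sin_coef k * sin (kdot k x).

Lemma continuous_cosk (k : freq d) : continuous (fun y : pt => cos (kdot k y)).
Proof.
rewrite (_ : (fun y => _) = fun y => cos (kdot k y + 0)).
  exact: continuous_cos_kdot.
by apply/funext => y; rewrite addr0.
Qed.

Lemma continuous_sink (k : freq d) : continuous (fun y : pt => sin (kdot k y)).
Proof.
rewrite (_ : (fun y => _) = fun y => cos (kdot k y - pi / 2)).
  exact: continuous_cos_kdot.
by apply/funext => y; rewrite cosBpihalf.
Qed.

Lemma continuous_sin_kdot (k : freq d) r : continuous (fun y : pt => sin (kdot k y + r)).
Proof.
rewrite (_ : (fun y => _) = fun y => cos (kdot k y + (r - pi / 2))).
  exact: continuous_cos_kdot.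
by apply/funext => y; rewrite addrA cosBpihalf.
Qed.

Lemma harmonicE k : harmonic k = torus_int (fun y : pt =>
  a y * cos (kdot k y - kdot k x) + b y * sin (kdot k y - kdot k x)).
Proof.
have ac := continuous_ptM a_cont (@continuous_cosk k).
have as_ := continuous_ptM a_cont (@continuous_sink k).
have bc := continuous_ptM b_cont (@continuous_cosk k).
have bs := continuous_ptM b_cont (@continuous_sink k).
have c1 := continuous_ptD ac bs.
have c2 : continuous (fun y => b y * cos (kdot k y) - a y * sin (kdot k y)).
  rewrite (_ : (fun y => _) = (fun y => b y * cos (kdot k y) +
    -1 * (a y * sin (kdot k y)))); last by apply/funext => y; rewrite mulN1r.
  by apply: continuous_ptD => //; exact: continuous_ptZ.
rewrite /harmonic mulrC [sin_coef k * _]mulrC -mulNr -!torus_intZ// -torus_intD.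
- by apply: eq_torus_int => y; rewrite cosB sinB; ring.
- exact: continuous_ptZ.
- exact: continuous_ptZ.
Qed.

Lemma fejer_mean : \sum_(l : cube) \sum_(k <- translates l) harmonic k =
  torus_int (fun y => a y * fejer y).
Proof.
have c k : continuous (fun y : pt =>
  a y * cos (kdot k y - kdot k x) + b y * sin (kdot k y - kdot k x)).
  apply: continuous_ptD; apply: continuous_ptM => //.
    exact: continuous_cos_kdot.
  exact: continuous_sin_kdot.
under eq_bigr => l _.
  under eq_bigr do rewrite harmonicE.
  rewrite -torus_int_sum//; over.
rewrite -torus_int_sum => [|l]; last exact: continuous_pt_sum.
apply: eq_torus_int => y.
under eq_bigr do rewrite big_split/= -!mulr_sumr.
by rewrite big_split/= -!mulr_sumr sum_sin_translates mulr0 addr0.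
Qed.

(** The oscillation bound is integrated against the nonnegative kernel: [e] yields e n^d, and each 1
    - cos at most n^d / n. *)
Lemma fejer_error (e C : R) : 0 <= C ->
  (forall y, `|a x - a y| <= e + C * \sum_i (1 - cos (y 0 i - x 0 i))) ->
  `|a x - (n ^ d)%:R^-1 * \sum_(l : cube) \sum_(k <- translates l) harmonic k| <=
  e + C * (d%:R / n%:R).
Proof.
move=> C_ge0 osc.
have nd_gt0 : 0 < (n ^ d)%:R :> R by rewrite ltr0n expn_gt0 n_gt0.
have Fc := continuous_fejer.
have cosc (i : 'I_d) : continuous (fun y : pt => fejer y * cos (y 0 i - x 0 i)).
  apply: continuous_ptM => //.
  rewrite (_ : (fun y : pt => _) = (fun y : pt => cos (kdot (unit_freq i) y - x 0 i))).
    exact: continuous_cos_kdot.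
  by apply/funext => y; rewrite kdot_unit.
pose bnd y := (e + C * d%:R) * fejer y + (- C) * \sum_i (fejer y * cos (y 0 i - x 0 i)).
have bndc : continuous bnd.
  apply: continuous_ptD; apply: continuous_ptZ => //; exact: continuous_pt_sum.
have osc_bnd y : `|a x - a y| * fejer y <= bnd y.
  have := ler_wpM2r (fejer_ge0 y) (osc y); move/le_trans; apply.
  rewrite /bnd sumrB sumr_const card_ord -mulr_sumr.
  by rewrite le_eqVlt; apply/orP; left; apply/eqP; ring.
have int_bnd : torus_int bnd <= (n ^ d)%:R * (e + C * (d%:R / n%:R)).
  rewrite torus_intD; try apply: continuous_ptZ => //; last exact: continuous_pt_sum.
  rewrite !torus_intZ//; last exact: continuous_pt_sum.
  rewrite torus_int_fejer torus_int_sum//.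
  have : \sum_(i < d) (n ^ d)%:R * (1 - n%:R^-1) <=
     \sum_(i < d) torus_int (fun y : pt => fejer y * cos (y 0 i - x 0 i)).
    by apply: ler_sum => i _; exact: torus_int_fejer_cos.
  rewrite sumr_const card_ord -mulr_natr => /(ler_wpM2l C_ge0).
  lra.
have ca : continuous (fun y => a y * fejer y) by exact: continuous_ptM.
have cax : continuous (fun y => a x * fejer y) by exact: continuous_ptZ.
have cna : continuous (fun y => -1 * (a y * fejer y)) by exact: continuous_ptZ.
have cnax : continuous (fun y => -1 * (a x * fejer y)) by exact: continuous_ptZ.
have up : torus_int (fun y => a x * fejer y + -1 * (a y * fejer y)) <= torus_int bnd.
  apply: le_torus_int => //; first exact: continuous_ptD.
  move=> y; apply: le_trans (osc_bnd y).
  rewrite mulN1r -mulrBl ler_wpM2r ?fejer_ge0// ler_norm//.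
have dn : torus_int (fun y => a y * fejer y + -1 * (a x * fejer y)) <= torus_int bnd.
  apply: le_torus_int => //; first exact: continuous_ptD.
  move=> y; apply: le_trans (osc_bnd y).
  by rewrite mulN1r -mulrBl ler_wpM2r ?fejer_ge0// distrC ler_norm.
move: up dn; rewrite (torus_intD cax cna) (torus_intD ca cnax).
rewrite (torus_intZ (-1) ca) (torus_intZ (-1) cax) (torus_intZ _ Fc).
rewrite torus_int_fejer -fejer_mean.
set S := \sum_l _ => up dn.
rewrite -(ler_pM2l nd_gt0) -{1}(gtr0_norm nd_gt0) -normrM mulrBr mulrA.
rewrite mulfV ?gt_eqF// mul1r ler_norml; apply/andP; split; lra.
Qed.

End FejerMean.

(** * Inversion from a bound on the tail of the coefficients *)

Section Inversion.
Local Open Scope classical_set_scope.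
Variables (R : realType) (d : nat).
Local Notation pt := 'rV[R]_d.
Variables (a b : pt -> R) (x : pt).
Hypothesis a_cont : continuous a.
Hypothesis b_cont : continuous b.
Hypothesis a_per : periodic a.

Definition coef_abs (k : freq d) : R :=
  Num.sqrt (cos_coef a b k ^+ 2 + sin_coef a b k ^+ 2).

Lemma harmonic_le k : `|harmonic x a b k| <= coef_abs k.
Proof.
rewrite -[leLHS]sqrtr_sqr ler_sqrt ?addr_ge0 ?sqr_ge0// -[leRHS]mulr1.
rewrite -(cos2Dsin2 (kdot k x)) /harmonic.
have := sqr_ge0 (cos_coef a b k * sin (kdot k x) + sin_coef a b k * cos (kdot k x)).
lra.
Qed.

(** For finite n, the Fejer mean differs from the sum over [L] by frequencies outside [L], at most
    [tau] in every translate, and by frequencies of [L] that a translate misses, at most Q / n on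
    average. The mean itself is close to [a x], so no convergence of series is involved. *)
Lemma fourier_inversion (L : seq (freq d)) (tau : R) : uniq L ->
  (forall s : seq (freq d), uniq s -> \sum_(k <- s | k \notin L) coef_abs k <= tau) ->
  `|a x - \sum_(k <- L) harmonic x a b k| <= tau.
Proof.
move=> uL tail.
have h_ge0 k : 0 <= coef_abs k by rewrite sqrtr_ge0.
pose Q := \sum_(k <- L) coef_abs k * (\sum_i `|k i|%N)%:R.
have Q_ge0 : 0 <= Q by apply: sumr_ge0 => k _; rewrite mulr_ge0.
have rearr (n : nat) : (0 < n)%N ->
    `|(n ^ d)%:R^-1 * (\sum_(l : {ffun 'I_d -> 'I_n}) \sum_(k <- translates l)
       harmonic x a b k) - \sum_(k <- L) harmonic x a b k| <= tau + Q / n%:R.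
  move=> n_gt0; set S := \sum_(k <- L) _.
  have nd_gt0 : 0 < (n ^ d)%:R :> R by rewrite ltr0n expn_gt0 n_gt0.
  have per_l (l : {ffun 'I_d -> 'I_n}) : `|\sum_(k <- translates l) harmonic x a b k - S| <=
      tau + \sum_(k <- L) coef_abs k * (k \notin translates l)%:R.
    have -> : S = \sum_(k <- L | k \in translates l) harmonic x a b k +
        \sum_(k <- L | k \notin translates l) harmonic x a b k.
      by rewrite /S (bigID (mem (translates l))).
    have -> : \sum_(k <- translates l) harmonic x a b k =
        \sum_(k <- L | k \in translates l) harmonic x a b k +
        \sum_(k <- translates l | k \notin L) harmonic x a b k.
      rewrite (bigID (mem L))/=; congr (_ + _).
      rewrite -[LHS]big_filter -[RHS]big_filter; apply: perm_big.
      apply: uniq_perm; rewrite ?filter_uniq ?translates_uniq//.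
      by move=> k; rewrite !mem_filter andbC.
    rewrite opprD addrACA subrr add0r.
    apply: le_trans (ler_normB _ _) _; apply: lerD.
      apply: le_trans (ler_norm_sum _ _ _) _.
      apply: le_trans (tail _ (translates_uniq l)).
      by apply: ler_sum => k _; exact: harmonic_le.
    apply: le_trans (ler_norm_sum _ _ _) _; rewrite big_mkcond/=.
    apply: ler_sum => k _; case: ifP => _; rewrite ?mulr0// mulr1.
    exact: harmonic_le.
  rewrite -(ler_pM2l nd_gt0) -{1}(gtr0_norm nd_gt0) -normrM mulrBr mulrA.
  rewrite mulfV ?gt_eqF// mul1r.
  rewrite [X in _ - X](_ : _ = \sum_(l : {ffun 'I_d -> 'I_n}) S); last first.
    by rewrite sumr_const card_ffun !card_ord mulr_natl.
  rewrite -sumrB; apply: le_trans (ler_norm_sum _ _ _) _.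
  apply: le_trans (ler_sum _ (fun l _ => per_l l)) _.
  rewrite big_split/= sumr_const card_ffun !card_ord mulrDr [_ * tau]mulr_natl lerD2l.
  rewrite exchange_big/= /Q mulr_suml mulr_sumr; apply: ler_sum => k _.
  rewrite -mulr_sumr -mulrA mulrCA ler_wpM2l//.
  by rewrite -ler_pdivrMl//; exact: sum_translates_out.
apply/ler_addgt0Pr => e e_gt0.
have e2 : 0 < e / 2 by rewrite divr_gt0.
have [C C_ge0 osc] := periodic_oscillation x a_cont a_per e2.
(* The kernel error C d / n and the missed part Q / n together stay below e / 2; the other half is
   the oscillation bound. *)
pose n := (Num.trunc ((C * d%:R + Q) / (e / 2))).+1.
have n_big : (C * d%:R + Q) / n%:R <= e / 2.
  rewrite ler_pdivrMr ?ltr0n// [leRHS]mulrC -ler_pdivrMr// ltW//.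
  exact: truncnS_gt.
have := rearr n isT; have := @fejer_error R d n isT x a b a_cont b_cont _ _ C_ge0 osc.
set S := \sum_(k <- L) _; set M := _^-1 * _ => h1 h2.
rewrite (_ : a x - S = (a x - M) + (M - S)); last by ring.
apply: le_trans (ler_normD _ _) _; apply: le_trans (lerD h1 h2) _.
by move: n_big; rewrite mulrDl -mulrA; lra.
Qed.

End Inversion.

(** * Dyadic blocks *)

Section ComplexParts.
Local Open Scope classical_set_scope.
Variable R : realType.
Implicit Types z w : R[i].

Lemma creD z w : cre (z + w) = cre z + cre w. Proof. by case: z w => [? ?] []. Qed.
Lemma cimD z w : cim (z + w) = cim z + cim w. Proof. by case: z w => [? ?] []. Qed.
Lemma creN z : cre (- z) = - cre z. Proof. by case: z. Qed.
Lemma cimN z : cim (- z) = - cim z. Proof. by case: z. Qed.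
Lemma creM z w : cre (z * w) = cre z * cre w - cim z * cim w.
Proof. by case: z w => [? ?] []. Qed.
Lemma cimM z w : cim (z * w) = cre z * cim w + cim z * cre w.
Proof. by case: z w => [? ?] []. Qed.

Lemma cre_sum (I : Type) (s : seq I) (P : pred I) (F : I -> R[i]) :
  cre (\sum_(i <- s | P i) F i) = \sum_(i <- s | P i) cre (F i).
Proof. by apply: (big_morph _ creD). Qed.

Lemma cim_sum (I : Type) (s : seq I) (P : pred I) (F : I -> R[i]) :
  cim (\sum_(i <- s | P i) F i) = \sum_(i <- s | P i) cim (F i).
Proof. by apply: (big_morph _ cimD). Qed.

Lemma cabs0 : cabs (0 : R[i]) = 0.
Proof. by rewrite /cabs /cabs2 /= expr0n /= addr0 sqrtr0. Qed.

Lemma cabs_ge0 z : 0 <= cabs z. Proof. exact: sqrtr_ge0. Qed.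

Lemma cabs2_ge0 z : 0 <= cabs2 z. Proof. by rewrite addr_ge0 ?sqr_ge0. Qed.

Lemma cabs2M z w : cabs2 (z * w) = cabs2 z * cabs2 w.
Proof. by rewrite /cabs2 creM cimM; ring. Qed.

End ComplexParts.

Section Levels.
Local Open Scope classical_set_scope.
Variable d : nat.

Definition bit_length (n : nat) : nat := if n == 0%N then 0%N else (trunc_log 2 n).+1.

(** The dyadic blocks partition the naturals by the number of binary digits; [(2 ^ 0)./2] being 0,
    the block of index 0 is {0}. *)
Lemma bit_lengthP (s n : nat) :
  ((2 ^ s)./2 <= n)%N && (n < 2 ^ s)%N = (s == bit_length n).
Proof.
rewrite /bit_length; case: s => [|s].
  by case: n => //= n; rewrite ltnS ltn0.
rewrite expnS mul2n doubleK; case: n => [|n] /=.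
  by rewrite leqn0 expn_eq0.
rewrite -mul2n -expnS eqSS; apply/andP/eqP => [[le1 le2]|->].
  by symmetry; apply: trunc_log_eq => //; rewrite le1.
by rewrite trunc_logP// trunc_log_ltn.
Qed.

Lemma ltn_bit_length n : (n < 2 ^ bit_length n)%N.
Proof. by have := bit_lengthP (bit_length n) n; rewrite eqxx => /andP[]. Qed.

(** The norm ||s||_1 of the only block that contains [k], so f_j collects the frequencies of level
    j. *)
Definition level (k : freq d) : nat := (\sum_i bit_length `|k i|)%N.

Lemma in_rhoE (s : {ffun 'I_d -> nat}) (k : freq d) :
  in_rho s k = [forall i, s i == bit_length `|k i|].
Proof. by apply: eq_forallb => i; exact: bit_lengthP. Qed.

Lemma bit_length_le_level (k : freq d) i : (bit_length `|k i| <= level k)%N.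
Proof. by rewrite /level (bigD1 i)//= leq_addr. Qed.

Lemma ltn_level (k : freq d) i : (`|k i| < 2 ^ level k)%N.
Proof.
apply: leq_trans (ltn_bit_length _) _.
by rewrite leq_exp2l// bit_length_le_level.
Qed.

(** Places the frequencies of level at most J in the hyperbolic cross Gamma(2^J). *)
Lemma prod_max_level (k : freq d) : (\prod_(i < d) maxn `|k i| 1 <= 2 ^ level k)%N.
Proof.
rewrite /level expn_sum; apply: leq_prod => i _.
by rewrite geq_max expn_gt0 andbT ltnW// ltn_bit_length.
Qed.

Definition box_freqs (N : nat) : seq (freq d) := [seq box_freq t | t : box d N].

Lemma box_freq_inj N : injective (@box_freq d N).
Proof.
move=> t u /ffunP tu; apply/ffunP => i; apply/val_inj.
by have := tu i; rewrite !ffunE => /addIr[].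
Qed.

Lemma box_freqs_uniq N : uniq (box_freqs N).
Proof. by rewrite map_inj_uniq ?enum_uniq//; exact: box_freq_inj. Qed.

Lemma mem_box_freqs N k : (k \in box_freqs N) = [forall i, `|k i| <= N]%N.
Proof.
apply/mapP/forallP => [[t _ ->] i|kN].
  rewrite ffunE; move: (nat_of_ord (t i)) (ltn_ord (t i)) => u; lia.
have lt_n i : (absz (k i + N%:Z)%R < N.*2.+1)%N by have := kN i; lia.
exists [ffun i => Ordinal (lt_n i)]; first by rewrite mem_enum.
apply/ffunP => i; rewrite !ffunE /=.
have k_ge : 0 <= k i + N%:Z by have := kN i; lia.
by rewrite gez0_abs// addrK.
Qed.

Lemma level_mem_box (k : freq d) J : (level k <= J)%N -> k \in box_freqs (2 ^ J).
Proof.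
move=> kJ; rewrite mem_box_freqs; apply/forallP => i.
by rewrite ltnW// (leq_trans (ltn_level k i))// leq_exp2l.
Qed.

End Levels.

Section FourierBlocks.
Local Open Scope classical_set_scope.
Variables (R : realType) (d : nat).
Local Notation pt := 'rV[R]_d.
Variable f : pt -> R[i].

Lemma coef_fjE (j : nat) (k : freq d) :
  coef_fj f j k = if level k == j then fcoef f k else 0.
Proof.
rewrite /coef_fj; case: eqP => [kj|kj].
  have lt_j i : (bit_length `|k i| < j.+1)%N by rewrite ltnS -kj bit_length_le_level.
  pose s0 : {ffun 'I_d -> 'I_j.+1} := [ffun i => Ordinal (lt_j i)].
  rewrite (bigD1 s0) /=; last first.
    by apply/eqP; rewrite -[RHS]kj; apply: eq_bigr => i _; rewrite ffunE.
  rewrite in_rhoE ifT; last by apply/forallP => i; rewrite !ffunE.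
  rewrite big1 ?addr0// => s /andP[_ /eqP ss0]; rewrite in_rhoE ifF//.
  apply: contra_notF ss0 => /forallP ks; apply/ffunP => i; apply/val_inj.
  by have /eqP := ks i; rewrite !ffunE.
rewrite big1// => s /eqP sj; rewrite in_rhoE ifF//.
apply: contra_notF kj => /forallP ks; rewrite -sj; apply: eq_bigr => i _.
by have /eqP := ks i; rewrite ffunE => ->.
Qed.

Lemma normA_fjE j : normA_fj f j =
  \sum_(k <- box_freqs d (2 ^ j) | level k == j) cabs (fcoef f k).
Proof.
rewrite [RHS]big_mkcond [RHS]big_map [RHS]big_enum; apply: eq_bigr => t _ /=.
by rewrite coef_fjE; case: ifP; rewrite ?cabs0.
Qed.

Lemma normA_fj_ge0 j : 0 <= normA_fj f j.
Proof. by apply: sumr_ge0 => t _; exact: cabs_ge0. Qed.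

Lemma sum_level_le (s : seq (freq d)) j : uniq s ->
  \sum_(k <- s | level k == j) cabs (fcoef f k) <= normA_fj f j.
Proof.
move=> us; rewrite normA_fjE [leRHS](bigID (mem s))/=.
rewrite -[leLHS]addr0; apply: lerD; last by apply: sumr_ge0 => k _; exact: cabs_ge0.
rewrite -[leLHS]big_filter -[leRHS]big_filter le_eqVlt; apply/orP; left; apply/eqP.
apply: perm_big; apply: uniq_perm; rewrite ?filter_uniq ?box_freqs_uniq// => k.
rewrite !mem_filter; case: (eqVneq (level k) j) => //= kj.
by rewrite level_mem_box ?kj// andbT.
Qed.

Hypothesis re_cont : continuous (fun x : pt => cre (f x)).
Hypothesis im_cont : continuous (fun x : pt => cim (f x)).
Hypothesis f_per : forall (x : pt) (i : 'I_d), f (upd x i (x 0 i + 2 * pi)) = f x.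

Let a (x : pt) := cre (f x).
Let b (x : pt) := cim (f x).

Lemma cre_fcoef k : cre (fcoef f k) = cos_coef a b k.
Proof.
by apply: eq_torus_int => x; rewrite creM /echar /cconj /cre /cim /= mulrN opprK.
Qed.

Lemma cim_fcoef k : cim (fcoef f k) = sin_coef a b k.
Proof.
apply: eq_torus_int => x; rewrite cimM /echar /cconj /cre /cim /a /b /cre /cim /=.
ring.
Qed.

Lemma cabs_fcoef k : cabs (fcoef f k) = coef_abs a b k.
Proof. by rewrite /cabs /cabs2 cre_fcoef cim_fcoef. Qed.

Definition low_freqs (J : nat) : seq (freq d) :=
  [seq k <- box_freqs d (2 ^ J) | (level k <= J)%N].

Definition partial_sum (J : nat) (x : pt) : R[i] :=
  \sum_(k <- low_freqs J) fcoef f k * echar k x.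

Lemma mem_low_freqs J k : (k \in low_freqs J) = (level k <= J)%N.
Proof.
by rewrite mem_filter; case: leqP => //= /level_mem_box ->.
Qed.

Lemma tail_le (J : nat) (tau : R) (s : seq (freq d)) :
  (forall J', \sum_(J.+1 <= j < J') normA_fj f j <= tau) -> uniq s ->
  \sum_(k <- s | k \notin low_freqs J) cabs (fcoef f k) <= tau.
Proof.
move=> tail us; pose J' := (\max_(k <- s) level k).+1.
apply: le_trans (tail J').
apply: (@le_trans _ _ (\sum_(J.+1 <= j < J') \sum_(k <- s | level k == j) cabs (fcoef f k))).
  under [leRHS]eq_bigr => j _ do rewrite big_mkcond/=.
  rewrite [leRHS]exchange_big/= big_mkcond/= big_seq [leRHS]big_seq; apply: ler_sum => k ks.
  have F_ge0 j : 0 <= if level k == j then cabs (fcoef f k) else 0.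
    by case: ifP => _ //; exact: cabs_ge0.
  rewrite mem_low_freqs -ltnNge; case: ifPn => [Jk|_]; last exact: sumr_ge0.
  rewrite (bigD1_seq (level k)) ?iota_uniq//=; last first.
    by rewrite mem_index_iota Jk /J' ltnS leq_bigmax_seq.
  by rewrite eqxx lerDl; exact: sumr_ge0.
by apply: ler_sum => j _; exact: sum_level_le.
Qed.

Lemma partial_sum_error (J : nat) (tau : R) (x : pt) :
  (forall J', \sum_(J.+1 <= j < J') normA_fj f j <= tau) ->
  cabs2 (f x - partial_sum J x) <= 2 * tau ^+ 2.
Proof.
move=> tail.
have uL : uniq (low_freqs J) by rewrite filter_uniq ?box_freqs_uniq.
have ap : periodic a by move=> y i; rewrite /a f_per.
have bp : periodic b by move=> y i; rewrite /b f_per.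
have nac : continuous (fun y => -1 * a y) by exact: continuous_ptZ.
have tau_ge0 : 0 <= tau by have := tail 0%N; rewrite big_geq.
have ta := tail_le tail.
have bnd u : `|u| <= tau -> u ^+ 2 <= tau ^+ 2.
  by move=> h; rewrite -real_normK ?num_real// lerXn2r ?nnegrE.
rewrite /cabs2 creD cimD creN cimN mulr_natl mulr2n; apply: lerD; apply: bnd.
  rewrite /partial_sum cre_sum -/(a x).
  rewrite (eq_bigr (harmonic x a b)) => [|k _].
    apply: fourier_inversion => // s us; apply: le_trans (ta s us).
    by apply: ler_sum => k _; rewrite cabs_fcoef.
  by rewrite creM cre_fcoef cim_fcoef.
(* The imaginary part of [f] is the real part of -i f = b - i a, whose coefficients have the same
   moduli; inversion is applied to the pair (b, -a). *)
have cc k : cos_coef b (fun y => -1 * a y) k = sin_coef a b k.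
  by apply: eq_torus_int => y; ring.
have acc k : cos_coef a b k = - sin_coef b (fun y => -1 * a y) k.
  have c2 : continuous (fun y : pt => -1 * a y * cos (kdot k y) - b y * sin (kdot k y)).
    rewrite (_ : (fun y => _) = (fun y => -1 * (a y * cos (kdot k y) +
      b y * sin (kdot k y)))); last by apply/funext => y; ring.
    apply: continuous_ptZ; apply: continuous_ptD; apply: continuous_ptM => //.
      exact: continuous_cosk.
    exact: continuous_sink.
  rewrite -[RHS]mulN1r -torus_intZ//; apply: eq_torus_int => y; rewrite /=; ring.
rewrite /partial_sum cim_sum -/(b x).
rewrite (eq_bigr (harmonic x b (fun y => -1 * a y))) => [|k _].
  apply: fourier_inversion => // s us; apply: le_trans (ta s us).
  apply: ler_sum => k _; rewrite cabs_fcoef /coef_abs cc acc sqrrN addrC.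
  exact: lexx.
by rewrite cimM cre_fcoef cim_fcoef /harmonic cc acc; rewrite /echar /cim /cre /=; ring.
Qed.

End FourierBlocks.

(** * Sparse trigonometric polynomials *)

(** Weighted Cauchy-Schwarz. When [E i] bounds the i-th summand it acts as a squared triangle
    inequality: a_i^2 <= E_i^2 for all i leads to the square of the sum of the E_i. *)
Lemma sqr_sum_le_weighted (R : realType) (I : Type) (s : seq I) (P : pred I) (a E : I -> R) :
  (forall i, 0 < E i) ->
  (\sum_(i <- s | P i) a i) ^+ 2 <=
  (\sum_(i <- s | P i) E i) * \sum_(i <- s | P i) a i ^+ 2 / E i.
Proof.
move=> E_gt0; elim: s => [|i s IHs]; first by rewrite !big_nil mul0r expr0n.
rewrite !big_cons; case: ifP => // _.
move: IHs; set S := \sum_(j <- s | P j) a j; set e := \sum_(j <- s | P j) E j.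
set X := \sum_(j <- s | P j) _ => IHs.
have e_ge0 : 0 <= e by apply: sumr_ge0 => j _; exact: ltW.
have X_ge0 : 0 <= X by apply: sumr_ge0 => j _; rewrite divr_ge0 ?sqr_ge0// ltW.
have Ei := E_gt0 i; set c := a i; set r := E i.
have -> : (r + e) * (c ^+ 2 / r + X) = c ^+ 2 + r * X + e * (c ^+ 2 / r) + e * X.
  by field; rewrite gt_eqF.
have [q q_ge0 qE] : exists2 q, 0 <= q & c ^+ 2 = r * q.
  exists (c ^+ 2 / r); first by rewrite divr_ge0 ?sqr_ge0// ltW.
  by rewrite mulrC divfK// gt_eqF.
have qr : c ^+ 2 / r = q by rewrite qE mulrC mulKf// gt_eqF.
rewrite qr sqrrD.
suff : (2 * (c * S)) <= r * X + e * q by rewrite mulr_natl; lra.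
have le2 : (c * S) ^+ 2 <= (r * X) * (e * q).
  rewrite exprMn qE; have : r * q * S ^+ 2 <= r * q * (e * X).
    by rewrite ler_wpM2l// mulr_ge0// ltW.
  by move/le_trans; apply; rewrite le_eqVlt; apply/orP; left; apply/eqP; ring.
have rX : 0 <= r * X by rewrite mulr_ge0// ltW.
have eq : 0 <= e * q by rewrite mulr_ge0.
have sum_ge0 : 0 <= r * X + e * q by rewrite addr_ge0.
apply: le_trans (ler_norm _) _.
rewrite -(ler_pXn2r (isT : (0 < 2)%N)) ?nnegrE// real_normK ?num_real// exprMn.
by have := sqr_ge0 (r * X - e * q); lra.
Qed.

Section TrigPoly.
Local Open Scope classical_set_scope.
Variables (R : realType) (d M : nat).
Local Notation pt := 'rV[R]_d.
Local Notation freqs := (box d M).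
Implicit Types c : freqs -> R[i].

Definition trig_poly c (x : pt) : R[i] := \sum_t c t * echar (box_freq t) x.

Definition l2_coef c : R := \sum_t cabs2 (c t).

(** As a combination of cosines with phase at frequency differences, the square can be averaged term
    by term, over the torus and over the grid alike. *)
Lemma cabs2_trig_poly c x : cabs2 (trig_poly c x) =
  \sum_t \sum_u
   ((cre (c t) * cre (c u) + cim (c t) * cim (c u)) *
      cos (kdot (box_freq t - box_freq u) x + 0) +
    (cre (c t) * cim (c u) - cim (c t) * cre (c u)) *
      cos (kdot (box_freq t - box_freq u) x - pi / 2)).
Proof.
rewrite /cabs2 /trig_poly cre_sum cim_sum !expr2 !mulr_suml -big_split/=.
apply: eq_bigr => t _; rewrite !mulr_sumr -big_split/=; apply: eq_bigr => u _.
rewrite !creM !cimM addr0 cosBpihalf kdotD kdotN cosB sinB /echar.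
rewrite ![cre (cos _ +i* sin _)%C]/cre ![cim (cos _ +i* sin _)%C]/cim /=.
ring.
Qed.

Lemma continuous_cabs2_trig_poly c : continuous (fun x : pt => cabs2 (trig_poly c x)).
Proof.
rewrite (funext (@cabs2_trig_poly c)).
apply: continuous_pt_sum => t; apply: continuous_pt_sum => u.
by apply: continuous_ptD; apply: continuous_ptZ; exact: continuous_cos_kdot.
Qed.

Lemma box_freqB_eq0 (t u : freqs) : (box_freq t - box_freq u == 0) = (t == u).
Proof. by rewrite subr_eq0 (inj_eq (@box_freq_inj d M)). Qed.

Lemma diagonal_sum c :
  \sum_t \sum_u ((cre (c t) * cre (c u) + cim (c t) * cim (c u)) * (t == u)%:R) =
  l2_coef c.
Proof.
apply: eq_bigr => t _; rewrite (bigD1 t)//= eqxx mulr1 big1 ?addr0 => [|u].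
  by rewrite /cabs2 !expr2.
by rewrite eq_sym => /negbTE ->; rewrite mulr0.
Qed.

Lemma torus_parseval c : torus_int (fun x => cabs2 (trig_poly c x)) = l2_coef c.
Proof.
rewrite (eq_torus_int (@cabs2_trig_poly c)).
have c1 (C : R) k r : continuous (fun x : pt => C * cos (kdot k x + r)).
  by apply: continuous_ptZ; exact: continuous_cos_kdot.
rewrite torus_int_sum => [|t]; last first.
  by apply: continuous_pt_sum => u; apply: continuous_ptD; exact: c1.
rewrite -[RHS]diagonal_sum; apply: eq_bigr => t _.
rewrite torus_int_sum => [|u]; last by apply: continuous_ptD; exact: c1.
apply: eq_bigr => u _; rewrite (torus_intD (@c1 _ _ _) (@c1 _ _ _)).
rewrite !torus_intZ; try exact: continuous_cos_kdot.
rewrite !torus_int_cos box_freqB_eq0 cosN cos_pihalf cos0.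
by case: ifP => _; rewrite ?mulr0 ?addr0.
Qed.

Local Notation P := M.*2.+1.
Local Notation grid := {ffun 'I_d -> 'I_P}.

(** With 2M + 1 points per side there is no aliasing: two frequencies of the box differ by at most
    2M in each coordinate. *)
Definition grid_pt (y : grid) : pt := \row_i (2 * pi * (y i)%:R / P%:R).

Lemma grid_pt_in_torus y : in_torus (grid_pt y).
Proof.
move=> i; rewrite mxE; have p0 := @pi_gt0 R.
rewrite divr_ge0 ?mulr_ge0 ?ler0n ?(ltW p0)//= ltr_pdivrMr ?ltr0n//.
by rewrite ltr_pM2l ?mulr_gt0// ltr_nat.
Qed.

Definition cis (t : R) : R[i] := (cos t +i* sin t)%C.

Lemma cisD s t : cis (s + t) = cis s * cis t.
Proof. by rewrite /cis cosD sinD; congr (_ +i* _)%C; rewrite addrC. Qed.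

Lemma cis0 : cis 0 = 1.
Proof. by rewrite /cis cos0 sin0. Qed.

Lemma cis_sum (I : Type) (s : seq I) (Q : pred I) (F : I -> R) :
  cis (\sum_(i <- s | Q i) F i) = \prod_(i <- s | Q i) cis (F i).
Proof. exact: (big_morph _ cisD cis0). Qed.

Lemma cisMn t n : cis (t * n%:R) = cis t ^+ n.
Proof.
elim: n => [|n IHn]; first by rewrite mulr0 cis0.
by rewrite -natr1 mulrDr mulr1 cisD IHn exprSr.
Qed.

Lemma cos_neq1 (t : R) : 0 < `|t| < 2 * pi -> cos t != 1.
Proof.
move=> /andP[t_gt0 t_lt]; rewrite -cos_norm.
have : 0 < sin (`|t| / 2) by apply: sin_gt0_pi; apply/andP; split; lra.
have -> : `|t| = (`|t| / 2) *+ 2 by rewrite -mulr_natr divfK.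
rewrite -mulr_natr mulfK// mulr_natr cos_mulr2n cos2sin2 => s_gt0.
by rewrite lt_eqF//; nra.
Qed.

(** A geometric sum of a P-th root of unity, which differs from 1 when 0 < |k| < P. *)
Lemma root_sum (k : int) : (`|k| < P)%N ->
  \sum_(r < P) cis (k%:~R * (2 * pi * r%:R / P%:R)) = (if k == 0 then P%:R else 0).
Proof.
move=> kP; have P0 : P%:R != 0 :> R by rewrite pnatr_eq0.
pose z := cis (k%:~R * (2 * pi) / P%:R).
have E (r : 'I_P) : cis (k%:~R * (2 * pi * r%:R / P%:R)) = z ^+ r.
  by rewrite -cisMn; congr cis; move: P%:R P0 pi => q q0 p; field.
rewrite (eq_bigr _ (fun r _ => E r)).
have [k0|k0] := eqVneq k 0.
  rewrite (eq_bigr (fun=> 1)) => [|r _]; first by rewrite sumr_const card_ord.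
  by rewrite /z k0 !mul0r cis0 expr1n.
have zP : z ^+ P = 1.
  rewrite -cisMn divfK// /cis.
  by rewrite -[k%:~R * _]add0r cos_periodz sin_periodz cos0 sin0.
have z1 : z != 1.
  have cz : cos (k%:~R * (2 * pi) / P%:R) != 1 :> R.
    apply: cos_neq1; rewrite !normrM [`|P%:R^-1|]gtr0_norm ?invr_gt0 ?ltr0n//.
    rewrite [`|2|]gtr0_norm// [`|pi|]gtr0_norm ?pi_gt0// -intr_norm.
    have p0 := twopi_gt0 R.
    rewrite !mulr_gt0 ?invr_gt0 ?ltr0n ?pi_gt0 ?ltr0z ?normr_gt0 ?absz_gt0//=.
    by rewrite ltr_pdivrMr ?ltr0n// mulrC ltr_pM2l// -abszE ltr_nat.
  by apply: contra_neq cz => z1; have : cre z = cre 1 by rewrite z1.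
have : (z - 1) * \sum_(r < P) z ^+ r = 0 by rewrite -subrX1 zP subrr.
by move/eqP; rewrite mulf_eq0 subr_eq0 (negbTE z1) => /eqP.
Qed.

Lemma grid_sum_cis (k : freq d) : (forall i, `|k i| < P)%N ->
  \sum_(y : grid) cis (kdot k (grid_pt y)) = if k == 0 then (P ^ d)%:R else 0.
Proof.
move=> kP.
have E (y : grid) : cis (kdot k (grid_pt y)) =
    \prod_i cis ((k i)%:~R * (2 * pi * (y i)%:R / P%:R)).
  by rewrite /kdot cis_sum; apply: eq_bigr => i _; rewrite mxE.
rewrite (eq_bigr _ (fun y _ => E y)).
rewrite -(bigA_distr_bigA (fun i (r : 'I_P) => cis ((k i)%:~R * (2 * pi * r%:R / P%:R)))).
rewrite (eq_bigr _ (fun i _ => root_sum (kP i))).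
case: eqP => [->|/eqP k0].
  rewrite (eq_bigr (fun=> P%:R)) => [|i _]; last by rewrite ffunE eqxx.
  by rewrite prodr_const card_ord natrX.
have [i ki] : exists i, k i != 0.
  apply/existsP; apply: contraNT k0; rewrite negb_exists => /forallP k0.
  by apply/eqP/ffunP => i; rewrite ffunE; apply/eqP; have := k0 i; rewrite negbK.
by rewrite (bigD1 i)//= (negbTE ki) mul0r.
Qed.

Lemma grid_mean_cos (k : freq d) : (forall i, `|k i| < P)%N ->
  \sum_(y : grid) #|grid|%:R^-1 * cos (kdot k (grid_pt y)) = (k == 0)%:R :> R.
Proof.
move=> kP; have := congr1 (@cre R) (grid_sum_cis kP).
rewrite cre_sum -mulr_sumr card_ffun !card_ord => ->.
have -> : cre (if k == 0 then (P ^ d)%:R else 0) = if k == 0 then (P ^ d)%:R else 0 :> R.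
  by case: ifP => // _; elim: (P ^ d)%N => [//|n IHn]; rewrite -!natr1 creD IHn.
by case: ifP => _; rewrite ?mulr0// mulVf// pnatr_eq0 expn_eq0.
Qed.

Lemma grid_mean_sin (k : freq d) : (forall i, `|k i| < P)%N ->
  \sum_(y : grid) #|grid|%:R^-1 * sin (kdot k (grid_pt y)) = 0 :> R.
Proof.
move=> kP; have := congr1 (@cim R) (grid_sum_cis kP).
rewrite cim_sum -mulr_sumr => ->.
have -> : cim (if k == 0 then (P ^ d)%:R else 0) = 0 :> R.
  by case: ifP => // _; elim: (P ^ d)%N => [//|n IHn]; rewrite -!natr1 cimD IHn addr0.
by rewrite mulr0.
Qed.

Lemma box_freqB_lt (t u : freqs) i : (absz ((box_freq t - box_freq u)%R i) < P)%N.
Proof.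
rewrite !ffunE; move: (nat_of_ord (t i)) (ltn_ord (t i)) => a.
move: (nat_of_ord (u i)) (ltn_ord (u i)) => b; lia.
Qed.

(** The value agrees with [torus_parseval]: on box polynomials the uniform grid measure gives the
    L_2 norm, so sampling becomes a finite problem. *)
Lemma grid_parseval c :
  \sum_(y : grid) #|grid|%:R^-1 * cabs2 (trig_poly c (grid_pt y)) = l2_coef c.
Proof.
under eq_bigr do rewrite cabs2_trig_poly mulr_sumr.
rewrite exchange_big/= -[RHS]diagonal_sum; apply: eq_bigr => t _.
under eq_bigr do rewrite mulr_sumr.
rewrite exchange_big/=; apply: eq_bigr => u _.
under eq_bigr do rewrite addr0 cosBpihalf mulrDr !(mulrCA #|_|%:R^-1).
rewrite big_split/= -[X in X + _]mulr_sumr -[X in _ + X]mulr_sumr.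
rewrite grid_mean_cos ?grid_mean_sin; try exact: box_freqB_lt.
by rewrite mulr0 addr0 box_freqB_eq0.
Qed.

End TrigPoly.

(** * Lower frame bound and Maurey approximation for sparse polynomials *)

Section SparseSampling.
Local Open Scope classical_set_scope.
Variables (R : realType) (d M : nat).
Local Notation pt := 'rV[R]_d.
Local Notation freqs := (box d M).
Local Notation grid := {ffun 'I_d -> 'I_M.*2.+1}.
Implicit Types c : freqs -> R[i].

Lemma cre_trig_poly c x : cre (trig_poly c x) =
  \sum_t (cre (c t) * cos (kdot (box_freq t) x) + - cim (c t) * sin (kdot (box_freq t) x)).
Proof.
by rewrite cre_sum; apply: eq_bigr => t _; rewrite creM mulNr.
Qed.

Lemma cim_trig_poly c x : cim (trig_poly c x) =
  \sum_t (cim (c t) * cos (kdot (box_freq t) x) + cre (c t) * sin (kdot (box_freq t) x)).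
Proof.
by rewrite cim_sum; apply: eq_bigr => t _; rewrite cimM addrC.
Qed.

(** Sign ([true] is plus), cosine ([true]) or sine, and frequency. *)
Definition atom_index := (bool * bool * freqs)%type.

Definition atom (s : atom_index) (y : grid) : R :=
  (if s.1.1 then 1 else -1) *
  (if s.1.2 then cos else sin) (kdot (box_freq s.2) (grid_pt R y)).

Lemma card_atom_index : #|{: atom_index}| = (4 * M.*2.+1 ^ d)%N.
Proof. by rewrite !card_prod card_bool card_ffun !card_ord. Qed.

Lemma norm_atom s y : `|atom s y| <= 1.
Proof.
by case: s => [[[] []] t]; rewrite /atom normrM ?normrN normr1 mul1r ?cos_max ?sin_max.
Qed.

(** Positive and negative part of each coefficient are the weights of its two signed atoms; they add
    up to the absolute value. *)
Lemma atom_hull (p q : freqs -> R) (W := \sum_t (`|p t| + `|q t|)) : 0 < W ->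
  exists w : atom_index -> R, [/\ forall s, 0 <= w s, \sum_s w s = 1 &
    forall y, \sum_s w s * atom s y =
      W^-1 * \sum_t (p t * cos (kdot (box_freq t) (grid_pt R y)) +
                     q t * sin (kdot (box_freq t) (grid_pt R y)))].
Proof.
move=> W_gt0.
pose w (s : atom_index) := W^-1 * Num.max 0
  ((if s.1.1 then 1 else -1) * (if s.1.2 then p s.2 else q s.2)).
have abs_max (r : R) : Num.max 0 r + Num.max 0 (- r) = `|r|.
  by case: (ler0P r) => h; case: (ltP 0 (- r)) => h2; lra.
have sub_max (r : R) : Num.max 0 r - Num.max 0 (- r) = r.
  by case: (ltP 0 r) => h; case: (ltP 0 (- r)) => h2; lra.
have sumE (F : atom_index -> R) : \sum_s F s = \sum_t
    (F (true, true, t) + F (false, true, t) + (F (true, false, t) + F (false, false, t))).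
  transitivity (\sum_(bb : bool * bool) \sum_t F (bb, t)).
    by rewrite pair_big; apply: eq_bigr => -[].
  rewrite exchange_big; apply: eq_bigr => t _.
  transitivity (\sum_(b1 : bool) \sum_(b2 : bool) F (b1, b2, t)).
    by rewrite pair_big; apply: eq_bigr => -[].
  by rewrite !big_bool/=; ring.
exists w; split=> [s||y].
- by rewrite mulr_ge0 ?invr_ge0 ?(ltW W_gt0)// le_max lexx.
- rewrite sumE /w /=; under eq_bigr do rewrite !mul1r !mulN1r -!mulrDr !abs_max.
  by rewrite -mulr_sumr mulVf// gt_eqF.
rewrite sumE mulr_sumr; apply: eq_bigr => t _; rewrite /w /atom /= !mul1r !mulN1r.
rewrite -{3}(sub_max (p t)) -{3}(sub_max (q t)).
move: (Num.max 0 (p t)) (Num.max 0 (- p t)) (Num.max 0 (q t)) (Num.max 0 (- q t)) => ? ? ? ?.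
by ring.
Qed.

Lemma l1_l2_sparse (S : {set freqs}) c : (forall t, t \notin S -> c t = 0) ->
  (\sum_t (`|cre (c t)| + `|cim (c t)|)) ^+ 2 <= 2 * #|S|%:R * l2_coef c.
Proof.
move=> cS.
have -> : \sum_t (`|cre (c t)| + `|cim (c t)|) = \sum_(t in S) (`|cre (c t)| + `|cim (c t)|).
  rewrite [RHS]big_mkcond/=; apply: eq_bigr => t _; case: ifPn => // /cS ->.
  by rewrite /cre /cim /= normr0 addr0.
have := @sqr_sum_le_weighted R _ (index_enum freqs) (mem S)
  (fun t => `|cre (c t)| + `|cim (c t)|) (fun=> 1) (fun=> ltr01).
move=> /le_trans; apply.
rewrite sumr_const -[leRHS]mulrA [leRHS]mulrCA ler_wpM2l//.
rewrite /l2_coef mulr_sumr big_mkcond/=; apply: ler_sum => t _; case: ifP => _; last first.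
  by rewrite mulr_ge0// cabs2_ge0.
rewrite divr1 /cabs2 -[cre _ ^+ 2]real_normK ?num_real// -[cim _ ^+ 2]real_normK ?num_real//.
by have := sqr_ge0 (`|cre (c t)| - `|cim (c t)|); lra.
Qed.

(** Real and imaginary part of the polynomial are hull elements scaled by the same W, with W^2 <= 2
    v ||c||_2^2. By the last hypothesis the two additive errors take at most half of ||c||_2^2;
    moving it to the left doubles 43 to 86. *)
Theorem sparse_sampling (m t kap v : nat) (eta : R) :
  (0 < m)%N -> (0 < kap)%N -> 4 * expR (- (kap%:R / 2048)) <= eta ->
  (forall i, (i < t)%N ->
     t%:R * ((4 * M.*2.+1 ^ d) ^ (4 ^ i * kap))%:R * expR (- (m%:R * (4 ^+ i * eta))) <= 1) ->
  8 * v%:R * (4^-1 ^+ t + 6 * t%:R * eta) <= 1 ->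
  exists xi : m.-tuple grid, forall (S : {set freqs}) c, (#|S| <= v)%N ->
    (forall t, t \notin S -> c t = 0) ->
    l2_coef c <= 86 * (m%:R^-1 * \sum_(y <- xi) cabs2 (trig_poly c (grid_pt R y))).
Proof.
move=> m_gt0 kap_gt0 eta_kap eta_m v_small.
have grid_gt0 : (0 < #|grid|)%N by rewrite card_ffun !card_ord expn_gt0.
have eta_gt0 : 0 < eta by apply: lt_le_trans eta_kap; rewrite mulr_gt0 ?expR_gt0.
have eta_m' i : (i < t)%N -> t%:R * (#|{: atom_index}| ^ (4 ^ i * kap))%:R *
   expR (- (m%:R * (4 ^+ i * eta))) <= 1.
  by move=> /eta_m; rewrite card_atom_index.
have [xi xiP] := convex_hull_sampling grid_gt0 norm_atom m_gt0 kap_gt0 eta_kap eta_m'.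
exists xi => S c Sv cS.
set del := 4^-1 ^+ t + 6 * t%:R * eta in v_small.
have del_ge0 : 0 <= del by rewrite addr_ge0 ?exprn_ge0// !mulr_ge0// ltW.
pose trg (p q : freqs -> R) (y : grid) :=
  \sum_t (p t * cos (kdot (box_freq t) (grid_pt R y)) +
          q t * sin (kdot (box_freq t) (grid_pt R y))).
have part (p q : freqs -> R) : let W := \sum_t (`|p t| + `|q t|) in
   \sum_(y : grid) #|grid|%:R^-1 * trg p q y ^+ 2 <=
   43 * (m%:R^-1 * \sum_(y <- xi) trg p q y ^+ 2) + W ^+ 2 * del.
  move=> W; have W_ge0 : 0 <= W by apply: sumr_ge0 => s _; rewrite addr_ge0.
  have [W0|W_neq0] := eqVneq W 0.
    have pq0 s : p s = 0 /\ q s = 0.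
      have /eqP := W0; rewrite psumr_eq0 => [/allP/(_ s (mem_index_enum _))|u _].
        by rewrite paddr_eq0// !normr_eq0 => /andP[/eqP -> /eqP ->].
      by rewrite addr_ge0.
    have trg0 y : trg p q y = 0.
      by apply: big1 => s _; case: (pq0 s) => -> ->; rewrite !mul0r addr0.
    rewrite W0 expr0n mul0r addr0 big1 => [|y _]; last first.
      by rewrite trg0 expr0n mulr0.
    by rewrite !mulr_ge0 ?invr_ge0// sumr_ge0// => y _; rewrite sqr_ge0.
  have W_gt0 : 0 < W by rewrite lt_def W_neq0.
  have [w [w_ge0 w_sum1 wE]] := atom_hull W_gt0.
  have := xiP w w_ge0 w_sum1.
  under eq_bigr do rewrite wE -/(trg p q _) exprMn mulrCA.
  under [X in _ <= 43 * (_ * X) + _ + _]eq_bigr do rewrite wE -/(trg p q _) exprMn.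
  rewrite -!mulr_sumr -(ler_pM2l (_ : 0 < W ^+ 2)) ?exprn_gt0//.
  have WW : W ^+ 2 * W^-1 ^+ 2 = 1 by rewrite -exprMn mulfV ?expr1n.
  have WK z : W ^+ 2 * (W^-1 ^+ 2 * z) = z by rewrite mulrA WW mul1r.
  rewrite -/W WK => /le_trans; apply.
  rewrite le_eqVlt; apply/orP; left; apply/eqP.
  rewrite -[in RHS](WK (\sum_(y <- xi) _)) /del; ring.
have p1 := part (fun s => cre (c s)) (fun s => - cim (c s)).
have p2 := part (fun s => cim (c s)) (fun s => cre (c s)).
have l1 := l1_l2_sparse cS.
set W := \sum_s _ in l1.
have W1 : \sum_s (`|cre (c s)| + `|- cim (c s)|) = W by apply: eq_bigr => s _; rewrite normrN.
have W2 : \sum_s (`|cim (c s)| + `|cre (c s)|) = W by apply: eq_bigr => s _; rewrite addrC.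
rewrite /= W1 in p1; rewrite /= W2 in p2.
have muE : l2_coef c =
    \sum_(y : grid) #|grid|%:R^-1 * trg (fun s => cre (c s)) (fun s => - cim (c s)) y ^+ 2 +
    \sum_(y : grid) #|grid|%:R^-1 * trg (fun s => cim (c s)) (fun s => cre (c s)) y ^+ 2.
  rewrite -grid_parseval -big_split/=; apply: eq_bigr => y _.
  by rewrite /cabs2 cre_trig_poly cim_trig_poly mulrDr.
have QE : m%:R^-1 * \sum_(y <- xi) cabs2 (trig_poly c (grid_pt R y)) =
    m%:R^-1 * \sum_(y <- xi) trg (fun s => cre (c s)) (fun s => - cim (c s)) y ^+ 2 +
    m%:R^-1 * \sum_(y <- xi) trg (fun s => cim (c s)) (fun s => cre (c s)) y ^+ 2.
  rewrite -mulrDr -big_split/=; congr (_ * _); apply: eq_bigr => y _.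
  by rewrite /cabs2 cre_trig_poly cim_trig_poly.
have l2_ge0 : 0 <= l2_coef c by apply: sumr_ge0 => s _; exact: cabs2_ge0.
have Wdel : 2 * (W ^+ 2 * del) <= 2^-1 * l2_coef c.
  apply: (@le_trans _ _ (2 * (2 * v%:R * l2_coef c * del))).
    rewrite ler_pM2l// ler_wpM2r// (le_trans l1)// ler_wpM2r// ler_wpM2l//.
    by rewrite ler_nat.
  have := ler_wpM2r l2_ge0 v_small; lra.
by rewrite QE; move: p1 p2 Wdel muE; lra.
Qed.

Lemma cabs_gt0 (z : R[i]) : z != 0 -> 0 < cabs z.
Proof.
case: z => x y z0; rewrite sqrtr_gt0 lt_def cabs2_ge0 andbT /cabs2 /cre /cim /=.
rewrite paddr_eq0 ?sqr_ge0// !sqrf_eq0; apply: contra_neqN z0 => /andP[/eqP -> /eqP ->].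
by [].
Qed.

Lemma sqr_cabs (z : R[i]) : cabs z ^+ 2 = cabs2 z.
Proof. by rewrite sqr_sqrtr ?cabs2_ge0. Qed.

Lemma cabs2_echar (k : freq d) (x : pt) : cabs2 (echar k x) = 1.
Proof. by rewrite /cabs2 /cre /cim /= cos2Dsin2. Qed.

Lemma cabs2_trig_poly_le c x : cabs2 (trig_poly c x) <= (\sum_t cabs (c t)) ^+ 2.
Proof.
(* Weights must be positive: vanishing coefficients get the dummy weight 1 and are left out of the
   sums by [restr]. *)
pose E t := if c t == 0 then 1 else cabs (c t).
have E_gt0 t : 0 < E t by rewrite /E; case: eqVneq => // /cabs_gt0.
have restr (F : freqs -> R) : (forall t, c t = 0 -> F t = 0) ->
    \sum_t F t = \sum_(t | c t != 0) F t.
  by move=> F0; rewrite [RHS]big_mkcond/=; apply: eq_bigr => t _; case: eqVneq => // /F0.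
have CS (F : freqs -> R) : (\sum_(t | c t != 0) F t) ^+ 2 <=
    (\sum_t cabs (c t)) * \sum_(t | c t != 0) F t ^+ 2 / E t.
  rewrite (restr (fun t => cabs (c t))) => [|t ->]; last exact: cabs0.
  rewrite [X in _ <= X * _](eq_bigr E) => [|t /negbTE c0]; last by rewrite /E c0.
  exact: sqr_sum_le_weighted.
rewrite /cabs2 /trig_poly cre_sum cim_sum.
rewrite (restr (fun t => cre _)) => [|t ->]; last by rewrite mul0r.
rewrite (restr (fun t => cim _)) => [|t ->]; last by rewrite mul0r.
apply: le_trans (lerD (CS _) (CS _)) _.
have B_ge0 : 0 <= \sum_t cabs (c t) by apply: sumr_ge0 => t _; exact: cabs_ge0.
rewrite -mulrDr -big_split/= expr2 ler_wpM2l//.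
rewrite (restr (fun t => cabs (c t))) => [|t ->]; last exact: cabs0.
apply: ler_sum => t c0; rewrite -mulrDl ler_pdivrMr//.
by rewrite -/(cabs2 _) cabs2M cabs2_echar mulr1 /E (negbTE c0) -sqr_cabs expr2.
Qed.

(* The L2 distance and the empirical distance are both averages over grid points,
   so a single Maurey average is good for both. *)
Lemma sparse_approximation (om : grid -> R) c (N : nat) :
  (forall y, 0 <= om y) -> \sum_y om y <= 2 ->
  exists g : freqs -> R[i], exists S : {set freqs},
    [/\ (#|S| <= N)%N, forall t, t \notin S -> g t = 0,
        forall t, t \in S -> c t != 0 &
        \sum_y om y * cabs2 (trig_poly (fun t => c t - g t) (grid_pt R y)) <=
        4 * (\sum_t cabs (c t)) ^+ 2 / N.+1%:R].
Proof.
move=> om_ge0 om_sum; pose B := \sum_t cabs (c t); rewrite -/B.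
have B_ge0 : 0 <= B by apply: sumr_ge0 => t _; exact: cabs_ge0.
(* A block may receive no term at all; then g = 0, and [N.+1] keeps the bound meaningful. *)
have [->|N_gt0] := posnP N.
  exists (fun=> 0), finset.set0; split=> //; [by rewrite cards0|by move=> t; rewrite inE|].
  apply: (@le_trans _ _ (\sum_y om y * B ^+ 2)).
    apply: ler_sum => y _; rewrite ler_wpM2l//.
    rewrite (_ : trig_poly _ = trig_poly c) ?cabs2_trig_poly_le//.
    by congr trig_poly; apply/funext => t; rewrite subr0.
  rewrite -mulr_suml divr1 ler_wpM2r ?sqr_ge0//; lra.
have [B0|B_neq0] := eqVneq B 0.
  have c0 t : c t = 0.
    apply/eqP; apply: contraTT isT => /cabs_gt0; move: B0 => /eqP.
    rewrite psumr_eq0 => [/allP/(_ t (mem_index_enum _))/eqP ->|u _]; last exact: cabs_ge0.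
    by rewrite ltxx.
  exists (fun=> 0), finset.set0; split=> //; [by rewrite cards0|by move=> t; rewrite inE|].
  rewrite B0 expr0n mulr0 mul0r big1// => y _.
  rewrite (_ : trig_poly _ _ = 0) ?/cabs2 ?/cre ?/cim /= ?expr0n ?addr0 ?mulr0//.
  by rewrite /trig_poly big1// => t _; rewrite c0 subr0 mul0r.
have B_gt0 : 0 < B by rewrite lt_def B_neq0.
pose w t := cabs (c t) / B.
have w_ge0 t : 0 <= w t by rewrite divr_ge0 ?cabs_ge0.
have w_sum1 : \sum_t w t = 1 by rewrite -mulr_suml mulfV.
have [ph [phE ph_le1 ph0]] : exists ph : freqs -> R[i], [/\ forall t,
    cabs (c t) * cre (ph t) = cre (c t) /\ cabs (c t) * cim (ph t) = cim (c t),
    forall t, cabs2 (ph t) <= 1 & forall t, c t = 0 -> ph t = 0].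
  exists (fun t => (cre (c t) / cabs (c t) +i* (cim (c t) / cabs (c t)))%C).
  split=> t; [| |by move=> ->; rewrite /cre /cim /= !mul0r];
    (have [c0|/cabs_gt0 c0] := eqVneq (c t) 0).
  - by rewrite c0 cabs0 !mul0r.
  - by rewrite !(mulrC (cabs _)) /cre /cim /= !divfK// gt_eqF.
  - by rewrite c0 /cabs2 /cre /cim /= !mul0r expr0n addr0.
  rewrite /cabs2 /= !expr_div_n -mulrDl -[X in X / _]/(cabs2 (c t)) -sqr_cabs.
  by rewrite divff// expf_neq0// gt_eqF.
(* [maurey_l2] is for real functions, so the points are doubled: [true] carries the real part,
   [false] the imaginary part. *)
pose psi t (z : grid * bool) : R :=
  let e := ph t * echar (box_freq t) (grid_pt R z.1) in if z.2 then cre e else cim e.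
pose om2 (z : grid * bool) := om z.1.
have sum2 (F : grid * bool -> R) : \sum_z F z = \sum_y (F (y, true) + F (y, false)).
  transitivity (\sum_y \sum_(bb : bool) F (y, bb)).
    by rewrite pair_big; apply: eq_bigr => -[].
  by apply: eq_bigr => y _; rewrite big_bool.
have psi_b t : \sum_z om2 z * psi t z ^+ 2 <= 2.
  apply: le_trans om_sum; rewrite sum2; apply: ler_sum => y _.
  rewrite /om2 /psi /= -mulrDr ler_piMr//.
  by rewrite -[leLHS]/(cabs2 (ph t * echar (box_freq t) (grid_pt R y))) cabs2M cabs2_echar mulr1.
have [s le_s] := maurey_l2 w_ge0 w_sum1 (fun z => om_ge0 z.1) N psi_b.
have N0 : N%:R != 0 :> R by rewrite pnatr_eq0 -lt0n.
pose cnt t : R := \sum_(u <- s) (u == t)%:R.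
(* B / N times the sum of the drawn phases, repeated draws counting with multiplicity. *)
pose g t : R[i] := (B / N%:R * (cnt t * cre (ph t)) +i* (B / N%:R * (cnt t * cim (ph t))))%C.
have pick (F : freqs -> R) : \sum_t cnt t * F t = \sum_(u <- s) F u.
  under eq_bigr do rewrite /cnt mulr_suml.
  rewrite exchange_big; apply: eq_bigr => u _ /=.
  rewrite (bigD1 u)//= eqxx mul1r big1 ?addr0// => t.
  by rewrite eq_sym => /negbTE ->; rewrite mul0r.
exists g, [set t in s | c t != 0]%SET; split=> [|t|t|].
- rewrite -[leqRHS](size_tuple s); apply: leq_trans (card_size s).
  by apply/subset_leq_card/fintype.subsetP => t; rewrite inE => /andP[].
- rewrite inE negb_and negbK => /orP[ts|/eqP c0].
    rewrite /g (_ : cnt t = 0) ?mul0r ?mulr0// /cnt big_seq big1// => u us.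
    by case: eqVneq => // ut; rewrite -ut us in ts.
  by rewrite /g ph0// /cre /cim /= !mulr0.
- by rewrite inE => /andP[].
have key y : om y * cabs2 (trig_poly (fun t => c t - g t) (grid_pt R y)) =
   (B / N%:R) ^+ 2 * (om2 (y, true) * (N%:R * (\sum_t w t * psi t (y, true)) -
       \sum_(t <- s) psi t (y, true)) ^+ 2 +
     om2 (y, false) * (N%:R * (\sum_t w t * psi t (y, false)) -
       \sum_(t <- s) psi t (y, false)) ^+ 2).
  rewrite /om2 /= -mulrDr mulrCA [(B / _) ^+ 2 * _]mulrDr -!exprMn.
  rewrite /cabs2 /trig_poly cre_sum cim_sum.
  congr (_ * (_ ^+ 2 + _ ^+ 2)).
    rewrite mulrBr mulrA divfK// -pick !mulr_sumr -sumrB; apply: eq_bigr => t _.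
    rewrite /psi /= !creM creD creN cimD cimN {1 2}/g [cre (_ +i* _)%C]/cre [cim (_ +i* _)%C]/cim /=.
    have [<- <-] := phE t; by rewrite /w; field; rewrite N0.
  rewrite mulrBr mulrA divfK// -pick !mulr_sumr -sumrB; apply: eq_bigr => t _.
  rewrite /psi /= !cimM creD creN cimD cimN {1 2}/g [cre (_ +i* _)%C]/cre [cim (_ +i* _)%C]/cim /=.
  have [<- <-] := phE t; by rewrite /w; field; rewrite N0.
rewrite (eq_bigr _ (fun y _ => key y)) -mulr_sumr.
move: le_s; rewrite sum2 => le_s.
apply: le_trans (ler_wpM2l (sqr_ge0 _) le_s) _.
have N_pos : 0 < N%:R :> R by rewrite ltr0n.
have -> : (B / N%:R) ^+ 2 * (N%:R * 2) = 2 * B ^+ 2 / N%:R by field.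
rewrite ler_pdivrMr// mulrAC ler_pdivlMr ?ltr0n//.
(* As N >= 1 here, 2 B^2 / N <= 4 B^2 / (N + 1). *)
have N1 : N.+1%:R <= 2 * N%:R :> R by rewrite -natrM ler_nat; lia.
have := ler_wpM2l (mulr_ge0 (ler0n R 2) (sqr_ge0 B)) N1; lra.
Qed.

End SparseSampling.

(** * Counting frequencies by dyadic level *)

Section CountLevels.
Local Open Scope nat_scope.
Variables (d M : nat).

Lemma card_bit_length (s : nat) :
  (\sum_(r < M.*2.+1) (bit_length (absz (r%:Z - M%:Z)%R) == s) <= 2 ^ s)%N.
Proof.
pose A := [pred r : 'I_M.*2.+1 | bit_length (absz (r%:Z - M%:Z)%R) == s].
have -> : (\sum_(r < M.*2.+1) (bit_length (absz (r%:Z - M%:Z)%R) == s))%N = #|A|.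
  by rewrite -sum1_card [RHS]big_mkcond; apply: eq_bigr => r _; rewrite inE; case: eqP.
rewrite -[leqRHS]card_ord.
have half2 : (2 ^ s)./2.*2 = 2 ^ s \/ 2 ^ s = 1.
  by case: (s) => [|s']; [right|left; rewrite expnS mul2n doubleK].
have s_gt0 : (0 < 2 ^ s)%N by rewrite expn_gt0.
(* Positive frequencies fill the upper half of [0, 2^s); negative ones are moved down by 2^(s-1)
   into the lower half. For s = 0 only the frequency 0 occurs. *)
pose F (r : 'I_M.*2.+1) : nat :=
  if (M < r)%N then (r - M)%N else (M - r - (2 ^ s)./2)%N.
have bnd r : A r -> ((2 ^ s)./2 <= (absz (r%:Z - M%:Z)%R))%N && ((absz (r%:Z - M%:Z)%R) < 2 ^ s)%N.
  by rewrite inE eq_sym -bit_lengthP.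
have F_lt r : A r -> (F r < 2 ^ s)%N.
  by move=> /bnd/andP[b1 b2]; rewrite /F; case: ifP => _; lia.
pose G (r : 'I_M.*2.+1) : 'I_(2 ^ s) := insubd (Ordinal s_gt0) (F r).
have GE r : A r -> G r = F r :> nat by move=> Ar; rewrite val_insubd F_lt.
have G_inj : {in A &, injective G}.
  move=> r r' Ar Ar' /(congr1 val) /=; rewrite !GE// /F => FF.
  have /andP[a1 a2] := bnd _ Ar; have /andP[b1 b2] := bnd _ Ar'.
  by apply/val_inj => /=; move: FF; case: ltnP => c1; case: ltnP => c2; lia.
by rewrite -(card_in_imset G_inj); apply: max_card.
Qed.

(** The first coordinate is determined by the others, each of which has j + 1 possible values. *)
Lemma card_compositions (j : nat) : (0 < d)%N ->
  (#|[set s : {ffun 'I_d -> 'I_j.+1} | \sum_i (s i : nat) == j]| <= j.+1 ^ d.-1)%N.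
Proof.
case: d => // d' _ /=.
pose G (s : {ffun 'I_d'.+1 -> 'I_j.+1}) : {ffun 'I_d' -> 'I_j.+1} :=
  [ffun i => s (lift ord0 i)].
rewrite -[leqRHS](_ : #|{ffun 'I_d' -> 'I_j.+1}| = _); last by rewrite card_ffun !card_ord.
rewrite -(card_in_imset (f := G)); first exact: max_card.
move=> s s'; rewrite !inE => /eqP sj /eqP s'j /ffunP ss'.
have eq_lift i : s (lift ord0 i) = s' (lift ord0 i) by have := ss' i; rewrite !ffunE.
apply/ffunP => i; case: (unliftP ord0 i) => [i' ->|->]; first exact: eq_lift.
apply/val_inj => /=; move: sj; rewrite -[in RHS]s'j !big_ord_recl /=.
rewrite (eq_bigr (fun i => s' (lift ord0 i) : nat)) => [|i' _]; last by rewrite eq_lift.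
exact: addIn.
Qed.

(** A block of type s has at most 2^(s_i) values in coordinate i, so at most 2^j frequencies; the
    types are counted by [card_compositions]. *)
Lemma card_level_eq (j : nat) : (0 < d)%N ->
  (\sum_(t : box d M) (level (box_freq t) == j) <= 2 ^ j * j.+1 ^ d.-1)%N.
Proof.
move=> d_gt0.
pose b (r : 'I_M.*2.+1) := bit_length (absz (r%:Z - M%:Z)%R).
have levelE (t : box d M) : level (box_freq t) = (\sum_i b (t i))%N.
  by apply: eq_bigr => i _; rewrite ffunE.
pose C := [set s : {ffun 'I_d -> 'I_j.+1} | (\sum_i (s i : nat))%N == j].
apply: (@leq_trans (\sum_(s in C) \prod_i \sum_(r < M.*2.+1) (b r == s i))%N); last first.
  apply: (@leq_trans (\sum_(s in C) 2 ^ j)%N); last first.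
    by rewrite sum_nat_const mulnC leq_mul2l card_compositions ?orbT.
  apply: leq_sum => s; rewrite inE => /eqP sj; rewrite -[in leqRHS]sj expn_sum.
  by apply: leq_prod => i _; exact: card_bit_length.
under [leqRHS]eq_bigr => s _ do rewrite bigA_distr_bigA.
rewrite exchange_big/=; apply: leq_sum => t _.
have [tj|//] := eqVneq (level (box_freq t)) j.
have lt_j i : (b (t i) < j.+1)%N.
  by rewrite ltnS -tj levelE (bigD1 i)//= leq_addr.
pose s0 : {ffun 'I_d -> 'I_j.+1} := [ffun i => Ordinal (lt_j i)].
rewrite (bigD1 s0) /=; last first.
  by rewrite inE -[X in _ == X]tj levelE; apply/eqP/eq_bigr => i _; rewrite ffunE.
by rewrite big1 ?leq_addr// => i _; rewrite ffunE eqxx.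
Qed.

Lemma card_level_lt (p : nat) : (0 < d)%N ->
  (#|[set t : box d M | level (box_freq t) < p]| <= 2 ^ p * p ^ d.-1)%N.
Proof.
move=> d_gt0.
apply: (@leq_trans (\sum_(j < p) 2 ^ j * j.+1 ^ d.-1)%N); last first.
  apply: (@leq_trans (\sum_(j < p) 2 ^ j * p ^ d.-1)%N).
    apply: leq_sum => j _; rewrite leq_mul2l; apply/orP; right.
    by case: (d.-1) => [|e]; rewrite ?expn0// leq_exp2r.
  rewrite -big_distrl leq_mul2r; apply/orP; right.
  suff : (\sum_(j < p) 2 ^ j < 2 ^ p)%N by exact: ltnW.
  by elim: p => [|p IHp]; rewrite ?big_ord0// big_ord_recr expnS mul2n -addnn ltn_add2r.
apply: leq_trans (leq_sum _ (fun (j : 'I_p) _ => card_level_eq j d_gt0)).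
rewrite exchange_big/= -sum1_card big_mkcond/=; apply: leq_sum => t _.
rewrite inE; case: ltnP => // lt_p.
by rewrite (bigD1 (Ordinal lt_p))//= eqxx leq_addr.
Qed.

End CountLevels.

(** * Least squares *)

(** [Xv] asks for exactly [v] frequencies, while an approximant may use fewer. *)
Lemma superset_of_card (T : finType) (A B : {set T}) (n : nat) :
  A \subset B -> (#|A| <= n <= #|B|)%N ->
  exists C : {set T}, [/\ A \subset C, C \subset B & #|C| = n].
Proof.
move=> AB /andP[An nB]; pose D := [set x in take (n - #|A|) (enum (B :\: A))].
have DB : D \subset B :\: A.
  by apply/fintype.subsetP => x; rewrite inE => /mem_take; rewrite mem_enum.
have cD : #|D| = (n - #|A|)%N.
  rewrite cardsE (card_uniqP _) ?take_uniq ?enum_uniq// size_take -cardE cardsD.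
  rewrite (finset.setIidPr AB); case: ltnP => //; move: nB An.
  move: #|B| #|A| => b a; lia.
exists (A :|: D); split; first exact: finset.subsetUl.
  by rewrite finset.subUset AB (fintype.subset_trans DB)// finset.subsetDl.
rewrite cardsU (_ : A :&: D = finset.set0) ?cards0 ?subn0 ?cD ?subnKC//.
apply/eqP; rewrite -finset.subset0; apply/fintype.subsetP => x.
rewrite inE => /andP[xA xD].
by have /fintype.subsetP/(_ _ xD) := DB; rewrite inE xA.
Qed.

Section CabsBounds.
Variable R : realType.
Implicit Types z w : R[i].

Lemma cabs2D_le z w : cabs2 (z + w) <= 2 * cabs2 z + 2 * cabs2 w.
Proof.
rewrite /cabs2 creD cimD.
by have := sqr_ge0 (cre z - cre w); have := sqr_ge0 (cim z - cim w); lra.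
Qed.

Lemma cabs2N z : cabs2 (- z) = cabs2 z.
Proof. by rewrite /cabs2 creN cimN !sqrrN. Qed.

Lemma cabs2_sum_le (I : Type) (s : seq I) (P : pred I) (F : I -> R[i]) (E : I -> R) :
  (forall i, 0 < E i) ->
  cabs2 (\sum_(i <- s | P i) F i) <=
  (\sum_(i <- s | P i) E i) * \sum_(i <- s | P i) cabs2 (F i) / E i.
Proof.
move=> E_gt0; rewrite /cabs2 cre_sum cim_sum.
under [X in _ <= _ * X]eq_bigr do rewrite mulrDl.
by rewrite big_split/= mulrDr lerD// sqr_sum_le_weighted.
Qed.

End CabsBounds.

Section LeastSquares.
Variables (R : realType) (d J : nat).
Local Notation M := (2 ^ J)%N.
Local Notation pt := 'rV[R]_d.
Local Notation freqs := (box d M).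
Local Notation grid := {ffun 'I_d -> 'I_M.*2.+1}.
Variables (m v : nat) (xi : m.-tuple grid).
Hypothesis m_gt0 : (0 < m)%N.

Definition grid_emp (F : grid -> R) : R := m%:R^-1 * \sum_(y <- xi) F y.

Hypothesis xi_sparse : forall (S : {set freqs}) (c : freqs -> R[i]), (#|S| <= v)%N ->
  (forall t, t \notin S -> c t = 0) ->
  l2_coef c <= 86 * grid_emp (fun y => cabs2 (trig_poly c (grid_pt R y))).

Let xipt (j : 'I_m) : pt := grid_pt R (tnth xi j).

Lemma emp_errE (f u : pt -> R[i]) : emp_err xipt f u =
  grid_emp (fun y => cabs2 (f (grid_pt R y) - u (grid_pt R y))).
Proof. by rewrite /emp_err /grid_emp big_tuple. Qed.

Lemma grid_emp_le (F G : grid -> R) : (forall y, F y <= G y) -> grid_emp F <= grid_emp G.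
Proof. by move=> FG; rewrite ler_wpM2l ?invr_ge0// ler_sum. Qed.

Lemma grid_emp_lin (a b : R) (F G : grid -> R) :
  grid_emp (fun y => a * F y + b * G y) = a * grid_emp F + b * grid_emp G.
Proof. by rewrite /grid_emp big_split/= -!mulr_sumr; ring. Qed.

Lemma grid_emp_cst (a : R) : grid_emp (fun=> a) = a.
Proof.
rewrite /grid_emp big_const_seq count_predT size_tuple iter_addr_0 -[a *+ m]mulr_natl.
by rewrite mulrA mulVf ?mul1r// pnatr_eq0 -lt0n.
Qed.

(** The uniform part is the L_2 norm by Parseval, the empirical part the least squares functional;
    an error bound for the sum controls both. *)
Let om (y : grid) : R := #|{: grid}|%:R^-1 + m%:R^-1 * \sum_(z <- xi) (z == y)%:R.

Let om_ge0 y : 0 <= om y.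
Proof. by rewrite addr_ge0 ?mulr_ge0 ?invr_ge0// sumr_ge0. Qed.

Let omE (F : grid -> R) :
  \sum_y om y * F y = \sum_y #|{: grid}|%:R^-1 * F y + grid_emp F.
Proof.
under eq_bigr do rewrite mulrDl.
rewrite big_split/=; congr (_ + _); rewrite /grid_emp.
under eq_bigr do rewrite -mulrA mulr_suml.
rewrite -mulr_sumr exchange_big; congr (_ * _); apply: eq_bigr => y _ /=.
rewrite (bigD1 y)//= eqxx mul1r big1 ?addr0// => x /negbTE.
by rewrite eq_sym => ->; rewrite mul0r.
Qed.

Let om_sum : \sum_y om y <= 2.
Proof.
have := omE (fun=> 1); under eq_bigr do rewrite mulr1.
move=> ->; rewrite grid_emp_cst; under eq_bigr do rewrite mulr1.
rewrite sumr_const -[X in X + _]mulr_natl divff// pnatr_eq0 card_ffun !card_ord.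
by rewrite expn_eq0.
Qed.

Variable f : pt -> R[i].
Hypothesis re_cont : continuous (fun x : pt => cre (f x)).
Hypothesis im_cont : continuous (fun x : pt => cim (f x)).
Hypothesis f_per : forall (x : pt) (i : 'I_d), f (upd x i (x 0 i + 2 * pi)) = f x.

Let lev (t : freqs) := level (box_freq t).
Let c (t : freqs) : R[i] := if (lev t <= J)%N then fcoef f (box_freq t) else 0.

Let partial_sumE x : partial_sum f J x = trig_poly c x.
Proof.
rewrite /partial_sum /low_freqs big_filter big_map big_enum_cond/= big_mkcond/=.
by apply: eq_bigr => t _; rewrite /c /lev; case: ifP; rewrite ?mul0r.
Qed.

Lemma trig_polyB (a b : freqs -> R[i]) x :
  trig_poly (fun t => a t - b t) x = trig_poly a x - trig_poly b x.
Proof. by rewrite /trig_poly -sumrB; apply: eq_bigr => t _; rewrite mulrBl. Qed.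

Variables (p : nat) (N : nat -> nat) (E : nat -> R) (tau : R).
Hypothesis E_gt0 : forall j, 0 < E j.
Hypothesis N_E : forall j, (p <= j)%N -> 4 * normA_fj f j ^+ 2 / (N j).+1%:R <= E j ^+ 2.
Hypothesis N_sum : (#|[set t : freqs | lev t < p]| + \sum_(p <= j < J.+1) N j <= v)%N.
Hypothesis tail : forall J', \sum_(J.+1 <= j < J') normA_fj f j <= tau.

Let Etot := \sum_(p <= j < J.+1) E j.

(** Levels below [p] are copied, and every level from [p] to [J] has its own Maurey average of [N j]
    terms. Cauchy-Schwarz with weights [E j] combines the squared block errors into [Etot ^+ 2]. *)
Lemma sparse_block_sum : exists g : freqs -> R[i], exists S : {set freqs},
  [/\ (#|S| <= v)%N, S \subset Gamma d M, forall t, t \notin S -> g t = 0 &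
    \sum_y om y * cabs2 (trig_poly (fun t => c t - g t) (grid_pt R y)) <= Etot ^+ 2].
Proof.
pose cj j t := if lev t == j then c t else 0.
have blk j := sparse_approximation (cj j) (N j) om_ge0 om_sum.
have [g gP] := choice blk; have {gP} [S gSP] := choice gP.
pose h t := if (lev t < p)%N then c t else if (lev t <= J)%N then g (lev t) t else 0.
pose T := [set t : freqs | (lev t < p)%N]%SET.
(* Each average uses only frequencies with nonzero coefficient in its block, so approximants of
   different levels have disjoint supports and [h] can be defined level by level. *)
have gz j t : lev t != j -> g j t = 0.
  have [_ g0 gc _] := gSP j; move=> tj; apply: g0; apply/negP => /gc.
  by rewrite /cj (negbTE tj) eqxx.
exists h.
(* The intersection keeps the set inside [Gamma] without comparing [p] to [J]. *)
exists (T :&: [set t | (lev t <= J)%N]%SET :|: \bigcup_(j < J.+1 | (p <= j)%N) S j); split.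
- apply: leq_trans N_sum; rewrite cardsU; apply: leq_trans (leq_subr _ _) _.
  apply: leq_add; first by apply/subset_leq_card/finset.subsetIl.
  rewrite big_geq_mkord/=; apply: (big_rec2 (fun (A : {set freqs}) n => #|A| <= n)%N).
    by rewrite cards0.
  move=> j n A _ An; rewrite cardsU; apply: leq_trans (leq_subr _ _) _.
  by apply: leq_add => //; have [] := gSP j.
- have lowG t : (lev t <= J)%N -> t \in Gamma d M.
    move=> tJ; rewrite inE; apply: leq_trans (prod_max_level _) _.
    by rewrite leq_exp2l.
  rewrite finset.subUset; apply/andP; split.
    by apply/fintype.subsetP => t; rewrite !inE => /andP[_ /lowG]; rewrite inE.
  apply/finset.bigcupsP => j pj; apply/fintype.subsetP => t tS.
  have [_ _ gc _] := gSP j; have := gc t tS; rewrite /cj.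
  by case: (eqVneq (lev t) j) => [tj _|_]; [rewrite lowG// tj -ltnS|rewrite eqxx].
- move=> t; rewrite !inE negb_or negb_and /h => /andP[].
  have [tp /= tJ _|tp _] := ltnP (lev t) p; first by rewrite /c (negbTE tJ).
  have [tJ tS|//] := leqP (lev t) J; have [_ g0 _ _] := gSP (lev t); apply: g0.
  apply: contra tS => tS; apply/finset.bigcupP.
  by exists (Ordinal (tJ : (lev t < J.+1)%N)).
have chE t : c t - h t = \sum_(p <= j < J.+1) (cj j t - g j t).
  have z j : j != lev t -> cj j t - g j t = 0.
    by move=> jt; rewrite gz ?/cj 1?eq_sym 1?(negbTE jt)// ?subrr// eq_sym.
  rewrite /h; case: ltnP => tp.
    rewrite subrr big_nat big1// => j /andP[pj _]; apply: z.
    by rewrite neq_ltn (leq_trans tp pj) orbT.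
  case: leqP => tJ.
    rewrite (bigD1_seq (lev t)) ?iota_uniq ?mem_index_iota ?tp//=.
    rewrite [X in _ = _ + X]big1 ?addr0; last by move=> j; exact: z.
    by rewrite /cj eqxx.
  rewrite subr0 {1}/c leqNgt tJ /= big_nat big1// => j /andP[_ jJ]; apply: z.
  by rewrite neq_ltn (leq_trans jJ tJ).
have trigE x : trig_poly (fun t => c t - h t) x =
    \sum_(p <= j < J.+1) trig_poly (fun t => cj j t - g j t) x.
  rewrite /trig_poly exchange_big/=; apply: eq_bigr => t _.
  by rewrite chE mulr_suml.
apply: (@le_trans _ _ (Etot * \sum_(p <= j < J.+1)
   (\sum_y om y * cabs2 (trig_poly (fun t => cj j t - g j t) (grid_pt R y))) / E j)).
  under [X in _ <= Etot * X]eq_bigr do rewrite mulr_suml.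
  rewrite exchange_big mulr_sumr/=; apply: ler_sum => y _.
  rewrite (eq_bigr (fun j => om y * (cabs2 (trig_poly (fun t => cj j t - g j t)
     (grid_pt R y)) / E j))) => [|j _]; last by rewrite mulrA.
  by rewrite -mulr_sumr mulrCA ler_wpM2l// trigE cabs2_sum_le.
rewrite expr2 ler_wpM2l ?sumr_ge0// => [j _|]; first exact: ltW.
apply: ler_sum_nat => j /andP[pj _]; rewrite ler_pdivrMr// -expr2 (le_trans _ (N_E pj))//.
have [_ _ _ /le_trans] := gSP j; apply; rewrite ler_wpM2r ?invr_ge0// ler_wpM2l//.
rewrite lerXn2r ?nnegrE ?normA_fj_ge0 ?sumr_ge0// => [t _|]; first exact: cabs_ge0.
have := @sum_level_le R d f (box_freqs d M) j (box_freqs_uniq _ _).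
rewrite big_map big_enum_cond big_mkcond/=; apply: le_trans; apply: ler_sum => t _.
rewrite /cj /lev; case: ifP => _; last by rewrite cabs0.
by rewrite /c; case: ifP => _ //; rewrite cabs0 cabs_ge0.
Qed.

(** The minimizer [u] and the approximant [g] use the same [v] frequencies, so their difference [e]
    is v-sparse and its norm is seen by the samples. By minimality its mean square over the samples
    is at most 4 times that of f - g, hence ||e||_2^2 is at most 344 times the latter. *)
Theorem least_squares_error : (v <= #|Gamma d M|)%N ->
  exists2 L, Xv M v L & forall u, LS_set xipt L f u ->
    l2norm (fun x => f x - u x) <= 75 * (Etot + tau).
Proof.
move=> v_le; have [g [S [Sv SG g0 gE]]] := sparse_block_sum.
have [S' [SS' S'G S'v]] := superset_of_card SG (introT andP (conj Sv v_le)).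
have tau_ge0 : 0 <= tau by have := tail 0%N; rewrite big_geq.
have Etot_ge0 : 0 <= Etot by apply: sumr_ge0 => j _; exact: ltW.
exists (span_of S'); first by exists S'; split.
have spanE (a : freqs -> R[i]) x : \sum_(t in S') a t * echar (box_freq t) x =
    trig_poly (fun t => if t \in S' then a t else 0) x.
  by rewrite /trig_poly big_mkcond/=; apply: eq_bigr => t _; case: ifP; rewrite ?mul0r.
have g0' t : t \notin S' -> g t = 0.
  by move=> tS; apply: g0; apply: contra tS; apply/fintype.subsetP.
have g_span : span_of S' (trig_poly g).
  exists g => x; rewrite spanE; congr trig_poly; apply/funext => t.
  by case: ifPn => // /g0'.
move=> u [[a uE] u_min].
pose b t := if t \in S' then a t else 0.
have {}uE x : u x = trig_poly b x by rewrite uE spanE.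
pose e t := b t - g t.
have e_l2 : l2_coef e <= 86 * grid_emp (fun y => cabs2 (trig_poly e (grid_pt R y))).
  apply: (@xi_sparse S'); first by rewrite S'v.
  by move=> t tS; rewrite /e /b (negbTE tS) g0'// subrr.
have psE x : cabs2 (f x - trig_poly c x) <= 2 * tau ^+ 2.
  by rewrite -partial_sumE; exact: partial_sum_error.
have mu_ge0 (F : grid -> R) : (forall y, 0 <= F y) -> 0 <= \sum_y #|{: grid}|%:R^-1 * F y.
  by move=> F0; rewrite sumr_ge0// => y _; rewrite mulr_ge0 ?invr_ge0.
have emp_ge0 (F : grid -> R) : (forall y, 0 <= F y) -> 0 <= grid_emp F.
  by move=> F0; rewrite mulr_ge0 ?invr_ge0// sumr_ge0.
have cg_l2 : l2_coef (fun t => c t - g t) <= Etot ^+ 2.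
  apply: le_trans gE; rewrite omE grid_parseval lerDl; apply: emp_ge0 => y.
  exact: cabs2_ge0.
have cg_emp : grid_emp (fun y => cabs2 (trig_poly (fun t => c t - g t) (grid_pt R y))) <= Etot ^+ 2.
  apply: le_trans gE; rewrite omE lerDr; apply: mu_ge0 => y; exact: cabs2_ge0.
have fg_emp : emp_err xipt f (trig_poly g) <= 4 * tau ^+ 2 + 2 * Etot ^+ 2.
  rewrite emp_errE; apply: (@le_trans _ _ (grid_emp (fun y => 2 * (2 * tau ^+ 2) +
     2 * cabs2 (trig_poly (fun t => c t - g t) (grid_pt R y))))).
    apply: grid_emp_le => y; rewrite trig_polyB.
    set x := grid_pt R y.
    rewrite (_ : f x - _ = (f x - trig_poly c x) + (trig_poly c x - trig_poly g x)); last by ring.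
    apply: le_trans (cabs2D_le _ _) _; rewrite lerD2r ler_pM2l//.
  rewrite (grid_emp_lin 2 2 (fun=> 2 * tau ^+ 2)) grid_emp_cst; lra.
have e_emp : grid_emp (fun y => cabs2 (trig_poly e (grid_pt R y))) <=
    2 * emp_err xipt f u + 2 * emp_err xipt f (trig_poly g).
  rewrite !emp_errE -grid_emp_lin; apply: grid_emp_le => y; rewrite trig_polyB.
  set x := grid_pt R y; rewrite -uE.
  rewrite (_ : u x - _ = - (f x - u x) + (f x - trig_poly g x)); last by ring.
  by apply: le_trans (cabs2D_le _ _) _; rewrite cabs2N.
have u_le := u_min _ g_span.
have {}e_l2 : l2_coef e <= 1376 * tau ^+ 2 + 688 * Etot ^+ 2 by lra.
have cu_l2 : l2_coef (fun t => c t - b t) <= 2 * l2_coef (fun t => c t - g t) + 2 * l2_coef e.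
  rewrite /l2_coef !mulr_sumr -big_split/=; apply: ler_sum => t _.
  rewrite (_ : c t - b t = (c t - g t) + - e t); last by rewrite /e; ring.
  by apply: le_trans (cabs2D_le _ _) _; rewrite cabs2N.
(* The squares below add up to 2756 Etot^2 + 5508 tau^2, and both coefficients are below 75^2 =
   5625. *)
rewrite /l2norm -(ler_sqr) ?nnegrE ?sqrtr_ge0 ?mulr_ge0 ?addr_ge0//.
have cabs2_cont : continuous (fun x : pt => cabs2 (f x - u x)).
  have -> : (fun x => cabs2 (f x - u x)) = (fun x : pt =>
      (cre (f x) + -1 * cre (trig_poly b x)) * (cre (f x) + -1 * cre (trig_poly b x)) +
      (cim (f x) + -1 * cim (trig_poly b x)) * (cim (f x) + -1 * cim (trig_poly b x))).
    apply/funext => x; rewrite uE /cabs2 creD cimD creN cimN; ring.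
  have tc : continuous (fun x : pt => cre (trig_poly b x)).
    rewrite (funext (cre_trig_poly b)); apply: continuous_pt_sum => t.
    by apply: continuous_ptD; apply: continuous_ptZ; [exact: continuous_cosk|exact: continuous_sink].
  have ts : continuous (fun x : pt => cim (trig_poly b x)).
    rewrite (funext (cim_trig_poly b)); apply: continuous_pt_sum => t.
    by apply: continuous_ptD; apply: continuous_ptZ; [exact: continuous_cosk|exact: continuous_sink].
  have c1 : continuous (fun x : pt => cre (f x) + -1 * cre (trig_poly b x)).
    by apply: continuous_ptD => //; exact: continuous_ptZ.
  have c2 : continuous (fun x : pt => cim (f x) + -1 * cim (trig_poly b x)).
    by apply: continuous_ptD => //; exact: continuous_ptZ.
  by apply: continuous_ptD; exact: continuous_ptM.
have int_ge0 : 0 <= torus_int (fun x : pt => cabs2 (f x - u x)).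
  rewrite -(@torus_int_cst R d 0); apply: le_torus_int => //; first exact: continuous_pt_cst.
  by move=> x; exact: cabs2_ge0.
rewrite sqr_sqrtr//.
have tbc := @continuous_cabs2_trig_poly R d M (fun t => c t - b t).
apply: (@le_trans _ _ (torus_int (fun x => 4 * tau ^+ 2 +
    2 * cabs2 (trig_poly (fun t => c t - b t) x)))).
  apply: le_torus_int => //.
    by apply: continuous_ptD; [exact: continuous_pt_cst|exact: continuous_ptZ].
  move=> x; rewrite trig_polyB uE.
  rewrite (_ : f x - _ = (f x - trig_poly c x) + (trig_poly c x - trig_poly b x)); last by ring.
  apply: le_trans (cabs2D_le _ _) _; rewrite lerD2r; have := psE x; lra.
rewrite torus_intD; [|exact: continuous_pt_cst|exact: continuous_ptZ].
rewrite torus_int_cst torus_intZ// torus_parseval exprMn.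
have := mulr_ge0 Etot_ge0 tau_ge0; have := sqr_ge0 Etot; have := sqr_ge0 tau.
by rewrite sqrrD; lra.
Qed.

End LeastSquares.

(** * Choice of the constants *)

Section Asymptotics.
Variable R : realType.

(** The exponent may have either sign, hence comparability in both directions; for negative [g] the
    roles of [x] and [y] are exchanged. *)
Lemma powR_ratio (x y K g : R) : 0 < x -> 0 < y -> 1 <= K -> x <= K * y -> y <= K * x ->
  x `^ g <= K `^ `|g| * y `^ g.
Proof.
have pos u w h : 0 < u -> 0 < w -> 1 <= K -> u <= K * w -> 0 <= h ->
    u `^ h <= K `^ h * w `^ h.
  move=> u_gt0 w_gt0 K1 uw h_ge0; have K_gt0 := lt_le_trans ltr01 K1.
  rewrite -powRM ?(ltW w_gt0) ?(ltW K_gt0)//.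
  by apply: (ge0_ler_powR h_ge0) uw; rewrite nnegrE ?mulr_ge0 ?ltW.
move=> x_gt0 y_gt0 K1 xy yx.
have [g_ge0|g_lt0] := lerP 0 g; first by rewrite ger0_norm// pos.
rewrite ltr0_norm//.
have g_gt0 : 0 <= - g by lra.
have := pos _ _ _ y_gt0 x_gt0 K1 yx g_gt0.
have K_gt0 := lt_le_trans ltr01 K1.
rewrite -[x `^ g]invrK -[y `^ g]invrK -(powRN x g) -(powRN y g) => h.
have px : 0 < x `^ (- g) by exact: powR_gt0.
have py : 0 < y `^ (- g) by exact: powR_gt0.
by rewrite ler_pdivlMr// mulrC ler_pdivrMr.
Qed.

(** With r = e^(-2 lam), one factor e^(-lam i) absorbs the power through e^x >= x^(N+1) / (N+1)!,
    and the other is summed as a geometric series. *)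
Lemma poly_geometric_bound (r B : R) : 0 < r < 1 -> 0 <= B ->
  exists2 K, 0 <= K & forall n, \sum_(i < n) r ^+ i * (2 * i.+1%:R) `^ B <= K.
Proof.
move=> /andP[r_gt0 r_lt1] B_ge0; pose N := Num.trunc B.
pose lam := - ln r / 2.
have lam_gt0 : 0 < lam by rewrite /lam; have := ln_lt0 (introT andP (conj r_gt0 r_lt1)); lra.
have rE : r = expR (- lam) * expR (- lam).
  by rewrite -expRD -{1}(lnK (_ : r \in Num.pos)) ?posrE//; congr expR; rewrite /lam; lra.
pose s := expR (- lam).
have s_gt0 : 0 < s by exact: expR_gt0.
have s_lt1 : s < 1 by rewrite /s expR_lt1; lra.
pose C := 2 ^+ N.+1 * (N.+1)`!%:R / lam ^+ N.+1 * expR lam.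
have C_ge0 : 0 <= C by rewrite !mulr_ge0 ?invr_ge0 ?exprn_ge0 ?expR_ge0 ?(ltW lam_gt0).
have term (i : nat) : r ^+ i * (2 * i.+1%:R) `^ B <= C * s ^+ i.
  have base_ge1 : 1 <= 2 * i.+1%:R :> R.
    by rewrite -natrM ler1n.
  have : (2 * i.+1%:R) `^ B <= (2 * i.+1%:R : R) ^+ N.+1.
    rewrite -powR_mulrn ?(le_trans ler01)// ler_powR// ltW//; exact: truncnS_gt.
  have xpos : 0 <= lam * i.+1%:R by rewrite mulr_ge0// ltW.
  have fact_gt : 0 < (N.+1)`!%:R :> R by rewrite ltr0n fact_gt0.
  have := expR_ge1Dxn N xpos => ex.
  have {}ex : (lam * i.+1%:R) ^+ N.+1 <= (N.+1)`!%:R * expR (lam * i.+1%:R).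
    by rewrite [leRHS]mulrC -ler_pdivrMr//; lra.
  have eE : expR (lam * i.+1%:R) * s ^+ i = expR lam.
    by rewrite /s -expRM_natr -expRD; congr expR; rewrite -natr1; lra.
  rewrite {1}rE -/s [(s * s) ^+ i]exprMn => le1.
  have lamN : 0 < lam ^+ N.+1 by rewrite exprn_gt0.
  have si : 0 <= s ^+ i by rewrite exprn_ge0 ?ltW.
  apply: (@le_trans _ _ (s ^+ i * s ^+ i * (2 * i.+1%:R) ^+ N.+1)).
    by rewrite ler_wpM2l ?mulr_ge0.
  rewrite [leRHS]mulrC -mulrA ler_wpM2l// /C -eE.
  rewrite exprMn in ex; rewrite exprMn.
  have {}ex : i.+1%:R ^+ N.+1 <= (N.+1)`!%:R * expR (lam * i.+1%:R) / lam ^+ N.+1.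
    by rewrite ler_pdivlMr// mulrC.
  apply: (@le_trans _ _ (s ^+ i * (2 ^+ N.+1 *
      ((N.+1)`!%:R * expR (lam * i.+1%:R) / lam ^+ N.+1)))).
    by rewrite ler_wpM2l// ler_wpM2l// exprn_ge0.
  by rewrite le_eqVlt; apply/orP; left; apply/eqP; ring.
exists (C / (1 - s)); first by rewrite divr_ge0//; lra.
move=> n; apply: (@le_trans _ _ (\sum_(i < n) C * s ^+ i)); first exact: ler_sum.
rewrite -mulr_sumr ler_wpM2l// -[leRHS]mul1r ler_pdivlMr; last by lra.
have := subrX1 s n; have : 0 <= s ^+ n by rewrite exprn_ge0 ?ltW.
by move=> h1 h2; rewrite mulrC -opprB mulNr -h2; lra.
Qed.

Lemma ln2_bounds : 2^-1 <= ln (2 : R) <= 1.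
Proof.
have p2 : (2 : R) \in Num.pos by rewrite posrE.
apply/andP; split; rewrite -ler_expR lnK//.
  have := expR_ge1Dx (- 2^-1 : R); rewrite expRN => h.
  rewrite -[leRHS]invrK -[leLHS]invrK lef_pV2 ?posrE ?invr_gt0 ?expR_gt0//.
  by apply: le_trans h; lra.
by apply: le_trans (expR_ge1Dx 1).
Qed.

End Asymptotics.

Section BlockParameter.
Variables d v : nat.
Hypothesis v_ge2 : (2 <= v)%N.

(** The largest admissible n: n = 1 is admissible since v >= 2, and n <= v bounds the search. *)
Lemma block_parameter : exists n : nat, [/\ (0 < n)%N, (2 ^ n * n ^ d.-1 <= v)%N &
  (v < 2 ^ n.+1 * n.+1 ^ d.-1)%N].
Proof.
pose P n := (2 ^ n * n ^ d.-1 <= v)%N && (0 < n)%N.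
have exP : exists n, P n by exists 1%N; rewrite /P exp1n muln1 v_ge2.
have ubP n : P n -> (n <= v)%N.
  case/andP=> le_v n_gt0; apply: leq_trans le_v.
  apply: leq_trans (ltnW (ltn_expl n (isT : (1 < 2)%N))) _.
  by rewrite leq_pmulr// expn_gt0 n_gt0.
case: (ex_maxnP exP ubP) => n /andP[le_v n_gt0] n_max; exists n; split=> //.
rewrite ltnNge; apply/negP => le_v'; have := n_max n.+1; rewrite /P le_v' => /(_ isT).
by rewrite ltnn.
Qed.

End BlockParameter.

(** * Numerical parameters of the sampling theorem *)

Section SamplingNumerics.
Variable R : realType.

Lemma expRn_ge2 (n : nat) : 2 ^+ n <= expR n%:R :> R.
Proof.
by rewrite -[n%:R]mul1r expRM_natr lerXn2r ?nnegrE ?expR_ge0// (le_trans _ (expR_ge1Dx 1)).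
Qed.

(** [t] makes 8 v 4^-t at most 1/2 and [eta] makes 48 v t eta equal to 1/2, the two halves of the
    last claim. [kap] turns kap / 2048 into 5 t. The net condition is t + kap e ln v <= m eta; with
    t <= 5 ln (2 v) it leads to 480 (5 + 50 * 1024 e), where 480 = 96 * 5. *)
Lemma sampling_parameters (v m e T : nat) (t := (trunc_log 2 v).+3) (kap := (10 * 1024 * t)%N)
    (eta : R := (96 * v%:R * t%:R)^-1) :
  (2 <= v)%N -> (T <= v ^ e)%N ->
  480 * (5 + 50 * 1024 * e%:R) * v%:R * (ln (2 * v%:R)) ^+ 4 <= m%:R :> R ->
  [/\ (0 < m)%N, 4 * expR (- (kap%:R / 2048)) <= eta,
    forall i, (i < t)%N -> t%:R * (T ^ (4 ^ i * kap))%:R *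
       expR (- (m%:R * (4 ^+ i * eta))) <= 1 &
    8 * v%:R * (4^-1 ^+ t + 6 * t%:R * eta) <= 1].
Proof.
move=> v_ge2 T_le m_ge.
have kapE : kap%:R = 10 * 1024 * t%:R :> R by rewrite /kap !natrM.
have tE : t = (trunc_log 2 v).+3 by [].
clearbody kap; clearbody t.
have t_pos : (0 < t)%N by rewrite tE.
have v_gt0 : (0 < v)%N by apply: leq_trans v_ge2.
have vR : 2 <= v%:R :> R by rewrite ler_nat.
have [ln2_ge ln2_le] := andP (ln2_bounds R).
pose L : R := ln (2 * v%:R).
have LE : L = ln 2 + ln v%:R by rewrite /L lnM// posrE ltr0n.
have lnv_ge : ln 2 <= ln v%:R :> R by rewrite ler_ln// posrE ltr0n.
have L_ge1 : 1 <= L by rewrite LE; lra.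
have [l_le l_gt] := andP (trunc_log_bounds (isT : (1 < 2)%N) v_gt0).
have t_le : t%:R <= 5 * L.
  have : (trunc_log 2 v)%:R * ln 2 <= ln v%:R :> R.
    rewrite mulr_natl -lnXn// ler_ln ?posrE ?exprn_gt0 ?ltr0n//.
    by rewrite -natrX ler_nat.
  have := ler_wpM2l (ler0n R (trunc_log 2 v)) ln2_ge.
  rewrite tE -addn3 natrD; lra.
have t_gt0 : 0 < t%:R :> R by rewrite ltr0n tE.
have eta_gt0 : 0 < eta by rewrite invr_gt0 !mulr_gt0// ltr0n.
have T_exp (k : nat) : (T ^ k)%:R <= expR (k%:R * (e%:R * ln v%:R)) :> R.
  apply: (@le_trans _ _ ((v%:R ^+ e) ^+ k)).
    by rewrite -!natrX ler_nat; case: k => [|k]; rewrite ?expn0// leq_exp2r.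
  by rewrite expRM_natl expRM_natl lnK ?posrE ?ltr0n.
have t_exp : t%:R <= expR t%:R :> R.
  by apply: le_trans (expR_ge1Dx _); lra.
have L0 : 0 <= L by lra.
have m_ge' : t%:R + kap%:R * (e%:R * ln v%:R) <= m%:R * eta :> R.
  rewrite /eta ler_pdivlMr ?mulr_gt0 ?ltr0n//.
  apply: le_trans m_ge; rewrite -/L.
  have e_ge0 : 0 <= e%:R :> R by [].
  have tlnv : t%:R * ln v%:R <= 5 * L * L.
    by apply: ler_pM => //; [lra|rewrite LE; lra].
  have s1 : t%:R + kap%:R * (e%:R * ln v%:R) <= (5 + 50 * 1024 * e%:R) * L ^+ 2 :> R.
    rewrite kapE.
    have h1 : t%:R <= 5 * L ^+ 2 by rewrite expr2; nra.
    have h2 := ler_wpM2l e_ge0 tlnv.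
    move: h1 h2; move: (t%:R : R) (e%:R : R) (ln v%:R : R) => x y z h1 h2.
    move: h1 h2; rewrite !expr2; clear; lra.
  have s2 : (t%:R + kap%:R * (e%:R * ln v%:R)) * t%:R <=
      (5 + 50 * 1024 * e%:R) * L ^+ 2 * (5 * L) :> R.
    have lnv0 : 0 <= ln v%:R :> R by lra.
    apply: ler_pM => //; first by rewrite addr_ge0// !mulr_ge0.
  have v0 : 0 <= v%:R :> R by [].
  have s3 := ler_wpM2l v0 s2.
  have c0 : 0 <= 480 * (5 + 50 * 1024 * e%:R) * v%:R :> R.
    by apply: mulr_ge0 v0; apply: mulr_ge0; [exact: ler0n|lra].
  (* The estimate gives the third power of [L]; [L >= 1] passes to the fourth. *)
  have s4 : 480 * (5 + 50 * 1024 * e%:R) * v%:R * L ^+ 3 <=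
      480 * (5 + 50 * 1024 * e%:R) * v%:R * L ^+ 4.
    by apply: (ler_wpM2l c0); exact: ler_weXn2l.
  apply: le_trans s4; rewrite [L ^+ 3]exprS; lra.
split.
- rewrite -(ltr_nat R); apply: lt_le_trans m_ge.
  have e_ge0 : 0 <= e%:R :> R by [].
  have X_gt0 : 0 < 5 + 50 * 1024 * e%:R :> R by lra.
  apply: mulr_gt0; last by rewrite exprn_gt0// -/L; lra.
  apply: mulr_gt0; last by rewrite ltr0n.
  by apply: mulr_gt0 X_gt0; rewrite ltr0n.
- rewrite expRN ler_pdivrMr ?expR_gt0// /eta mulrC ler_pdivlMr ?mulr_gt0 ?ltr0n//.
  have -> : kap%:R / 2048 = (5 * t)%:R :> R by rewrite kapE natrM; field.
  apply: le_trans (expRn_ge2 _); rewrite -natrX -!natrM ler_nat.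
  have v_le : (v <= 2 ^ (t - 2))%N by rewrite tE ltnW.
  have t_ge4 : (4 <= t)%N by rewrite tE !ltnS trunc_log_gt0.
  have tt : (t <= 2 ^ t)%N by rewrite ltnW// ltn_expl.
  (* Uses 4 * 96 <= 2^9, v <= 2^(t - 2) and t <= 2^t. *)
  apply: (@leq_trans (2 ^ 9 * 2 ^ (t - 2) * 2 ^ t)%N).
    by rewrite mulnA; apply: leq_mul => //; rewrite mulnA; apply: leq_mul.
  have exp_le : (9 + (t - 2) + t <= 5 * t)%N by move: t_ge4; clear; lia.
  by rewrite -2!expnD; exact: leq_pexp2l.
- move=> i _.
  apply: (@le_trans _ _ (expR (4 ^+ i * t%:R) *
     expR ((4 ^ i * kap)%:R * (e%:R * ln v%:R)) * expR (- (m%:R * (4 ^+ i * eta))))).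
    rewrite ler_wpM2r ?expR_ge0// ler_pM//.
    apply: le_trans t_exp _; rewrite ler_expR ler_peMl// exprn_ege1// ler1n//.
  rewrite -!expRD expR_le1 natrM natrX.
  have := ler_wpM2l (exprn_ge0 i (ler0n R 4)) m_ge'; lra.
have -> : 8 * v%:R * (4^-1 ^+ t + 6 * t%:R * eta) = 8 * v%:R * 4^-1 ^+ t + 2^-1.
  rewrite /eta; field; rewrite !gt_eqF ?ltr0n// tE.
suff : 16 * v%:R * 4^-1 ^+ t <= 1 :> R by lra.
rewrite exprVn ler_pdivrMr ?exprn_gt0// mul1r -natrX -natrM ler_nat.
apply: (@leq_trans (16 * 2 ^ (trunc_log 2 v).+1)%N); first by rewrite leq_mul2l ltnW.
rewrite tE; have : (2 ^ (trunc_log 2 v).+1 <= 4 ^ (trunc_log 2 v).+1)%N by rewrite leq_exp2r.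
by move=> le4; rewrite (expnS 4 (_.+2)) (expnS 4 (_.+1)) mulnA; exact: leq_mul.
Qed.

End SamplingNumerics.

Section CardGamma.
Variables d M : nat.

Lemma card_Gamma_le : (#|Gamma d M| <= M.*2.+1 ^ d)%N.
Proof.
by apply: leq_trans (max_card _) _; rewrite card_ffun !card_ord.
Qed.

(** The frequencies 0, ..., v - 1 on the first axis suffice. Without [v] elements in [Gamma] the
    family [Xv] would be empty. *)
Lemma card_Gamma_ge (v : nat) : (0 < d)%N -> (0 < v <= M)%N -> (v <= #|Gamma d M|)%N.
Proof.
move=> d_gt0 /andP[v_gt0 vM]; pose i0 := Ordinal d_gt0.
have lt_M (r : 'I_v) : (M + r < M.*2.+1)%N by have := ltn_ord r; lia.
have lt_M0 : (M < M.*2.+1)%N by lia.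
pose F (r : 'I_v) : box d M := [ffun i => if i == i0 then Ordinal (lt_M r) else Ordinal lt_M0].
have F_inj : injective F.
  move=> r r' /ffunP/(_ i0); rewrite !ffunE eqxx => /(congr1 val) /= /addnI.
  exact: val_inj.
rewrite -[leqLHS]card_ord -(card_imset _ F_inj); apply: subset_leq_card.
apply/fintype.subsetP => t /imsetP[r _ ->]; rewrite inE (bigD1 i0)//= big1 ?muln1.
  by rewrite !ffunE eqxx /=; have := ltn_ord r; lia.
by move=> i /negbTE ii; rewrite !ffunE ii /=; lia.
Qed.

End CardGamma.

Section BoxSize.
Variables v A d : nat.
Hypothesis v_ge2 : (2 <= v)%N.
Hypothesis A_gt0 : (0 < A)%N.
Let J := (A * (trunc_log 2 v).+1)%N.

Lemma box_size_ge : (v <= 2 ^ J)%N.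
Proof.
have v_gt0 : (0 < v)%N by apply: leq_trans v_ge2.
have [_ l_gt] := andP (trunc_log_bounds (isT : (1 < 2)%N) v_gt0).
by apply: leq_trans (ltnW l_gt) _; rewrite leq_exp2l// leq_pmull.
Qed.

(** For v >= 2 the logarithm l is at least 1, so A (l + 1) + 2 <= (2 A + 4) l, with a factor
    independent of v. *)
Lemma box_size_le : ((2 ^ J).*2.+1 ^ d <= v ^ ((2 * A + 4) * d))%N.
Proof.
have v_gt0 : (0 < v)%N by apply: leq_trans v_ge2.
have [l_le _] := andP (trunc_log_bounds (isT : (1 < 2)%N) v_gt0).
have l_gt0 : (0 < trunc_log 2 v)%N by rewrite trunc_log_gt0.
rewrite expnM; case: d => // d'; rewrite leq_exp2r//.
apply: (@leq_trans (2 ^ (J + 2))%N).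
  by rewrite expnD; have : (0 < 2 ^ J)%N by [rewrite expn_gt0]; lia.
apply: (@leq_trans ((2 ^ trunc_log 2 v) ^ (2 * A + 4))%N); last by rewrite leq_exp2r// addn4.
by rewrite -expnM leq_exp2l// /J; nia.
Qed.

End BoxSize.

(** * Block budgets and the rate of approximation *)

Section Rate.
Variables (R : realType) (a beta : R).
Hypothesis a_gt0 : 0 < a.

Let q : R := 2 `^ (- a).
(** Half of the decay. In a block error B_j / sqrt N_j with N_j of order v q^i, one factor r^i of
    B_j cancels the square root of q^i; the other is kept in [D] and makes the errors summable. *)
Let r : R := Num.sqrt q.

Lemma decay_bounds : 0 < q < 1.
Proof.
rewrite powR_gt0//= /q /powR gt_eqF// expR_lt1 mulNr oppr_lt0 mulr_gt0//.
by rewrite ln_gt0// ltr1n.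
Qed.

Let q_gt0 : 0 < q. Proof. by have /andP[] := decay_bounds. Qed.
Let q_lt1 : q < 1. Proof. by have /andP[] := decay_bounds. Qed.
Let rr : r * r = q. Proof. by rewrite -expr2 sqr_sqrtr// ltW. Qed.
Let r_gt0 : 0 < r. Proof. by rewrite sqrtr_gt0. Qed.
Let r_lt1 : r < 1.
Proof. by rewrite -sqrtr1 ltr_sqrt. Qed.

Lemma powR_decay (j : nat) : 2 `^ (- a * j%:R) = q ^+ j.
Proof. by rewrite powRrM powR_mulrn// powR_ge0. Qed.

(** Of the A (l + 1) levels at least (l + 1) / a remain after removing p <= l + 1, and 2^(l+1) >
    v. *)
Lemma decay_le_inv (A v J p : nat) : 1 + a^-1 <= A%:R -> (0 < v)%N ->
  J = (A * (trunc_log 2 v).+1)%N -> (p <= trunc_log 2 v)%N ->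
  (p <= J)%N /\ q ^+ (J - p) <= v%:R^-1.
Proof.
move=> A_ge v_gt0 JE p_le; set l := trunc_log 2 v in JE p_le.
have ainv_gt0 : 0 < a^-1 by rewrite invr_gt0.
have A_gt0 : (0 < A)%N by rewrite -(ltr_nat R); lra.
have pJ : (p <= J)%N by rewrite JE (leq_trans p_le)// (leq_trans (leqnSn _))// leq_pmull.
split=> //; rewrite -powR_decay mulNr powRN lef_pV2 ?posrE ?powR_gt0 ?ltr0n//.
have [_ l_gt] := andP (trunc_log_bounds (isT : (1 < 2)%N) v_gt0).
apply: (@le_trans _ _ (2 `^ (l.+1)%:R)).
  by rewrite powR_mulrn// -natrX ler_nat ltnW.
apply: ler_powR; first by rewrite ler1n.
rewrite natrB// JE natrM.
have pl : p%:R <= l.+1%:R :> R by rewrite ler_nat (leq_trans p_le).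
have l_ge : 0 <= l.+1%:R :> R by [].
have h1 : (1 + a^-1) * l.+1%:R <= A%:R * l.+1%:R by rewrite ler_wpM2r.
have h2 : a^-1 * l.+1%:R <= A%:R * l.+1%:R - p%:R by rewrite mulrDl mul1r in h1; lra.
have := ler_wpM2l (ltW a_gt0) h2; rewrite mulrA divff ?mul1r// gt_eqF//.
Qed.

Let D (i : nat) : R := r ^+ i * (2 * i.+1%:R) `^ `|beta|.

Let D_gt0 i : 0 < D i.
Proof. by rewrite mulr_gt0 ?exprn_gt0 ?powR_gt0 ?mulr_gt0 ?ltr0n. Qed.

(** With i = j - (n - 1), [maxn j 1] and [n] agree up to the factor 2 (i + 1) in both directions;
    the 2 absorbs the offset and the maximum. *)
Lemma shifted_decay (n j : nat) : (0 < n)%N -> (n.-1 <= j)%N ->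
  q ^+ j * (maxn j 1)%:R `^ beta <=
  q ^+ n.-1 * n%:R `^ beta * (r ^+ (j - n.-1) * D (j - n.-1)).
Proof.
move=> n_gt0 pj; set i := (j - n.-1)%N; have jE : j = (n.-1 + i)%N by rewrite subnKC.
have max_gt0 : (0 < maxn j 1)%N by rewrite leq_max orbT.
have := @powR_ratio R (maxn j 1)%:R n%:R (2 * i.+1%:R) beta.
rewrite !ltr0n -!natrM !ler_nat ler1n => /(_ max_gt0 n_gt0 isT) h.
have {}h : (maxn j 1)%:R `^ beta <= (2 * i.+1)%:R `^ `|beta| * n%:R `^ beta.
  by apply: h; rewrite jE; clearbody i; move: n_gt0; clear; case: n => // k _ /=; nia.
rewrite {1}jE exprD -rr !exprMn.
have c_ge0 : 0 <= r ^+ n.-1 * r ^+ n.-1 * (r ^+ i * r ^+ i).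
  by rewrite !mulr_ge0 ?exprn_ge0 ?(ltW r_gt0).
apply: le_trans (ler_wpM2l c_ge0 h) _.
rewrite le_eqVlt /D natrM; apply/orP; left; apply/eqP; ring.
Qed.

(** The upper bound on v gives v < 2^d 2^n n^(d-1), hence q^n <= 2^(d a) n^((d-1) a) v^-a, and n is
    comparable to ln v. The factor 1/q pays for the start at level n - 1. *)
Lemma rate_bound (d v n : nat) (b : R) : (0 < d)%N -> (2 <= v)%N -> (0 < n)%N ->
  beta = (d%:R - 1) * b ->
  (2 ^ n * n ^ d.-1 <= v)%N -> (v < 2 ^ n.+1 * n.+1 ^ d.-1)%N ->
  q ^+ n.-1 * n%:R `^ beta / Num.sqrt v%:R <=
  q^-1 * (2 ^+ d) `^ a * (2 * d%:R) `^ `|(d%:R - 1) * (a + b)| *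
    (v%:R `^ (- a - 2^-1) * ln v%:R `^ ((d%:R - 1) * (a + b))).
Proof.
move=> d_gt0 v_ge2 n_gt0 betaE le_v lt_v.
set g := (d%:R - 1) * (a + b).
have v_gt0 : (0 < v)%N by apply: leq_trans v_ge2.
have v0 : 0 < v%:R :> R by rewrite ltr0n.
have n0 : 0 < n%:R :> R by rewrite ltr0n.
have [ln2_ge ln2_le] := andP (ln2_bounds R).
have lnv_ge : ln 2 <= ln v%:R :> R by rewrite ler_ln ?posrE ?ltr0n// ler_nat.
have lnv_gt0 : 0 < ln v%:R :> R by lra.
have n_le : n%:R <= 2 * ln v%:R :> R.
  have : n%:R * ln 2 <= ln v%:R :> R.
    rewrite mulr_natl -lnXn// ler_ln ?posrE ?exprn_gt0// -natrX ler_nat.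
    by apply: leq_trans le_v; rewrite leq_pmulr// expn_gt0 n_gt0.
  have := ler_wpM2l (ler0n R n) ln2_ge; lra.
have lnv_le : ln v%:R <= 2 * d%:R * n%:R :> R.
  have : (v <= 2 ^ (2 * d * n))%N.
    apply: leq_trans (ltnW lt_v) _.
    apply: (@leq_trans (2 ^ n.+1 * (2 ^ n) ^ d.-1)%N).
      rewrite leq_mul2l; apply/orP; right.
      by case: (d.-1) => [|e]; rewrite ?expn0// leq_exp2r// ltn_expl.
    rewrite -expnM -expnD leq_exp2l//; move: d_gt0 n_gt0.
    by case: (d) => // e _; case: (n) => // k _ /=; nia.
  rewrite -(ler_nat R) natrX => h; have : ln v%:R <= ln (2 ^+ (2 * d * n)) :> R.
    by rewrite ler_ln ?posrE ?exprn_gt0.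
  rewrite lnXn// -[ln 2 *+ _]mulr_natl !natrM => /le_trans; apply.
  by rewrite ler_piMr// !mulr_ge0.
have d_ge1 : 1 <= d%:R :> R by rewrite ler1n.
have ng : n%:R `^ g <= (2 * d%:R) `^ `|g| * ln v%:R `^ g.
  apply: powR_ratio => //; first by lra.
  by apply: le_trans n_le _; rewrite ler_pM2r//; lra.
have qn : q ^+ n <= (2 ^+ d) `^ a * n%:R `^ ((d%:R - 1) * a) * v%:R `^ (- a).
  have pow2n : 0 < 2 ^+ n :> R by rewrite exprn_gt0.
  rewrite -powR_decay (_ : - a * n%:R = - (n%:R * a)); last by ring.
  rewrite !powRN [2 `^ _]powRrM powR_mulrn//.
  have -> : n%:R `^ ((d%:R - 1) * a) = (n%:R ^+ d.-1) `^ a.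
    by rewrite powRrM -{1}(prednK d_gt0) -natr1 addrK powR_mulrn// ltW.
  rewrite -powRM ?exprn_ge0 ?(ltW n0)//.
  rewrite ler_pdivlMr ?powR_gt0// mulrC ler_pdivrMr ?powR_gt0//.
  rewrite -powRM ?mulr_ge0 ?exprn_ge0 ?ler0n//.
  apply: (ge0_ler_powR (ltW a_gt0)); rewrite ?nnegrE ?mulr_ge0 ?exprn_ge0 ?ler0n//.
  rewrite -!natrX -!natrM ler_nat; apply: leq_trans (ltnW lt_v) _.
  apply: (@leq_trans (2 ^ n.+1 * (2 * n) ^ d.-1)%N).
    rewrite leq_mul2l; apply/orP; right.
    by case: (d.-1) => [|e]; rewrite ?expn0// leq_exp2r//; move: n_gt0; clear; lia.
  rewrite expnMn; move: (n ^ d.-1)%N => y; rewrite -{2}(prednK d_gt0) !expnS.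
  by rewrite leq_eqVlt; apply/orP; left; apply/eqP; ring.
have -> : v%:R `^ (- a - 2^-1) = v%:R `^ (- a) / Num.sqrt v%:R.
  rewrite powRD; last by apply/implyP => _; rewrite gt_eqF.
  by rewrite (powRN _ 2^-1) powR12_sqrt ?ltW.
have -> : q ^+ n.-1 = q^-1 * q ^+ n.
  by rewrite -{2}(prednK n_gt0) exprS mulKf// gt_eqF.
have qi : 0 < q^-1 by rewrite invr_gt0.
have sq : 0 <= (Num.sqrt v%:R)^-1 :> R by rewrite invr_ge0 sqrtr_ge0.
have nb : n%:R `^ ((d%:R - 1) * a) * n%:R `^ beta = n%:R `^ g.
  rewrite betaE -powRD; first by rewrite -mulrDr.
  by apply/implyP => _; rewrite gt_eqF.
have h1 := ler_wpM2r (powR_ge0 n%:R beta) qn.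
have va : 0 <= v%:R `^ (- a) by exact: powR_ge0.
have c2 : 0 <= (2 ^+ d) `^ a :> R by exact: powR_ge0.
have h2 := ler_wpM2l (mulr_ge0 c2 va) ng.
have h3 : q ^+ n * n%:R `^ beta <=
   (2 ^+ d) `^ a * v%:R `^ (- a) * ((2 * d%:R) `^ `|g| * ln v%:R `^ g).
  apply: le_trans h2; rewrite -nb; apply: le_trans h1 _.
  by rewrite le_eqVlt; apply/orP; left; apply/eqP; ring.
have h4 := ler_wpM2r sq (ler_wpM2l (ltW qi) h3).
apply: le_trans (le_trans _ h4) _; rewrite le_eqVlt; apply/orP; left; apply/eqP; ring.
Qed.

Variable K : R.
Hypothesis K_ge0 : 0 <= K.
Hypothesis K_bound : forall n, \sum_(i < n) D i <= K.

Lemma sum_D_le (p lo hi : nat) : (p <= lo)%N -> \sum_(lo <= j < hi) D (j - p) <= K.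
Proof.
move=> p_lo; apply: (@le_trans _ _ (\sum_(p <= j < hi) D (j - p))).
  have [lo_hi|hi_lo] := leqP lo hi.
    by rewrite (big_cat_nat p_lo lo_hi)//= lerDr sumr_ge0// => j _; exact: ltW.
  by rewrite big_geq ?(ltnW hi_lo)// sumr_ge0// => j _; exact: ltW.
rewrite -{1}[p]add0n big_addn big_mkord.
by under eq_bigr do rewrite addnK.
Qed.

Section Blocks.
Variables (v n : nat) (B : nat -> R).
Hypothesis v_gt0 : (0 < v)%N.
Hypothesis n_gt0 : (0 < n)%N.
Let p := n.-1.
Let F : R := q ^+ p * n%:R `^ beta.
Hypothesis B_ge0 : forall j, 0 <= B j.
Hypothesis B_le : forall j, B j <= q ^+ j * (maxn j 1)%:R `^ beta.

Let F_gt0 : 0 < F. Proof. by rewrite mulr_gt0 ?exprn_gt0 ?powR_gt0 ?ltr0n. Qed.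
Let v0 : 0 < v%:R :> R. Proof. by rewrite ltr0n. Qed.
Let q1_gt0 : 0 < 1 - q. Proof. by rewrite subr_gt0. Qed.

Let B_D j : (p <= j)%N -> B j <= F * (r ^+ (j - p) * D (j - p)).
Proof. by move=> pj; apply: le_trans (B_le j) (shifted_decay n_gt0 pj). Qed.

(** Geometric shares of half the budget, normalized by 1 - q; the other half is left for the levels
    kept whole. *)
Definition block_size (j : nat) : nat := Num.trunc (v%:R / 2 * (1 - q) * q ^+ (j - p)).
Definition block_error (j : nat) : R := 4 * F * D (j - p) / Num.sqrt (v%:R * (1 - q)).

Lemma block_error_gt0 j : 0 < block_error j.
Proof.
rewrite divr_gt0//; last by rewrite sqrtr_gt0 mulr_gt0.
by apply: mulr_gt0 (D_gt0 _); rewrite mulr_gt0.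
Qed.

(** Dividing 4 B^2 by a share of v / 2 gives the constant 8, which 4^2 = 16 covers; the successor
    compensates for rounding the share down. *)
Lemma block_error_ok j : (p <= j)%N ->
  4 * B j ^+ 2 / (block_size j).+1%:R <= block_error j ^+ 2.
Proof.
move=> pj; set i := (j - p)%N.
have qi : 0 < q ^+ i by rewrite exprn_gt0.
have x_gt0 : 0 < v%:R / 2 * (1 - q) * q ^+ i by rewrite !mulr_gt0.
have N_gt : v%:R / 2 * (1 - q) * q ^+ i <= (block_size j).+1%:R.
  by rewrite ltW//; exact: truncnS_gt.
rewrite ler_pdivrMr ?ltr0n//.
apply: le_trans (_ : block_error j ^+ 2 * (v%:R / 2 * (1 - q) * q ^+ i) <= _); last first.
  by rewrite ler_wpM2l// sqr_ge0.
have FrD_ge0 : 0 <= F * (r ^+ i * D i) by rewrite !mulr_ge0 ?exprn_ge0// ltW.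
have B2 : B j ^+ 2 <= (F * (r ^+ i * D i)) ^+ 2.
  by rewrite lerXn2r ?nnegrE ?B_ge0// B_D.
rewrite /block_error -/i expr_div_n sqr_sqrtr; last by rewrite mulr_ge0 ?ltW.
have qrr : q ^+ i = r ^+ i * r ^+ i by rewrite -exprMn rr.
have -> : (4 * F * D i) ^+ 2 / (v%:R * (1 - q)) * (v%:R / 2 * (1 - q) * q ^+ i) =
    8 * (F * (r ^+ i * D i)) ^+ 2.
  rewrite qrr; move: (r ^+ i) (D i) => s t; field.
  by rewrite gt_eqF//= gt_eqF.
have := sqr_ge0 (F * (r ^+ i * D i)); lra.
Qed.

Lemma sum_block_size (J : nat) :
  (\sum_(p <= j < J.+1) block_size j)%:R <= v%:R / 2 :> R.
Proof.
have geom (s : nat) : \sum_(i < s) (1 - q) * q ^+ i <= 1.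
  rewrite -mulr_sumr -opprB mulNr -subrX1 opprB gerBl exprn_ge0// ltW//.
rewrite natr_sum; apply: (@le_trans _ _
    (\sum_(p <= j < J.+1) v%:R / 2 * (1 - q) * q ^+ (j - p))).
  apply: ler_sum => j _; rewrite truncn_le// !mulr_ge0 ?exprn_ge0// ltW//.
rewrite -{1}[p]add0n big_addn big_mkord.
under eq_bigr do rewrite addnK -mulrA.
rewrite -mulr_sumr ler_piMr ?geom// divr_ge0.
Qed.

Lemma sum_block_error (J : nat) :
  \sum_(p <= j < J.+1) block_error j <= 4 * F * K / Num.sqrt (v%:R * (1 - q)).
Proof.
rewrite /block_error -mulr_suml ler_wpM2r ?invr_ge0 ?sqrtr_ge0//.
by rewrite -mulr_sumr ler_wpM2l ?sum_D_le// mulr_ge0// ltW.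
Qed.

(** Beyond J the factor r^(j-p) is at most v^(-1/2), which takes the place of the square root gained
    by averaging in the earlier blocks. *)
Lemma sum_tail (J J' : nat) : (p <= J)%N -> q ^+ (J - p) <= v%:R^-1 ->
  \sum_(J.+1 <= j < J') B j <= F * K / Num.sqrt v%:R.
Proof.
move=> pJ qJ.
have rJ : r ^+ (J - p) <= (Num.sqrt v%:R)^-1.
  have s_ge0 : 0 <= (Num.sqrt v%:R)^-1 :> R by rewrite invr_ge0 sqrtr_ge0.
  rewrite -(ler_pXn2r (isT : (0 < 2)%N)) ?nnegrE ?exprn_ge0 ?(ltW r_gt0)//.
  by rewrite exprVn sqr_sqrtr ?ler0n// -exprM mulnC exprM expr2 rr.
apply: (@le_trans _ _ (\sum_(J.+1 <= j < J') F * ((Num.sqrt v%:R)^-1 * D (j - p)))).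
  apply: ler_sum_nat => j /andP[Jj _]; have pj : (p <= j)%N by rewrite (leq_trans pJ)// ltnW.
  apply: le_trans (B_D pj) _; rewrite ler_pM2l// ler_pM2r//.
  apply: le_trans rJ; rewrite ler_wiXn2l ?(ltW r_gt0) ?(ltW r_lt1)//.
  by rewrite leq_sub2r// ltnW.
rewrite -mulr_sumr -mulr_sumr -mulrA ler_pM2l// mulrC ler_wpM2r ?invr_ge0 ?sqrtr_ge0//.
by apply: sum_D_le; rewrite (leq_trans pJ).
Qed.

End Blocks.

End Rate.

(** * Assembly of the bound *)

Unset Implicit Arguments.

Theorem theorem5p4 (R : realType) (d : nat) (a : R) :
  (0 < d)%N -> 0 < a ->
  exists c c' : R, forall b : R, exists C' : R,
    forall v : nat, (2 <= v)%N ->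
      exists M : nat,
        (#|Gamma d M|%:R <= (v%:R : R) `^ c) /\
        forall m : nat, c' * v%:R * (ln (2 * v%:R)) ^+ 4 <= m%:R ->
          (@rho_ls R d m v M (@W_A R d a b) <=
            (C' * (v%:R `^ (- a - 2^-1)) *
             (ln (v%:R)) `^ ((d%:R - 1) * (a + b)))%:E)%E.
Proof.
(* [A] depends on [a] alone: J = A (log2 v + 1) ends the blocks where their decay reaches 1 / v, and
   neither [e] nor the sampling constant sees [b]. *)
move=> d_gt0 a_gt0; pose A := (Num.trunc a^-1).+2; pose e := ((2 * A + 4) * d)%N.
have A_ge : 1 + a^-1 <= A%:R.
  by rewrite /A -natr1 addrC lerD2r ltW//; exact: truncnS_gt.
(* The 2 in [2 + e] accounts for the four atoms per frequency, as 4 <= v^2. *)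
exists e%:R, (480 * (5 + 50 * 1024 * (2 + e)%N%:R)) => b.
set beta := (d%:R - 1) * b; set q : R := 2 `^ (- a).
have /andP[q_gt0 q_lt1] : 0 < q < 1 by exact: decay_bounds.
have r_bounds : 0 < Num.sqrt q < 1.
  by rewrite sqrtr_gt0 q_gt0 /= -[ltRHS]sqrtr1 ltr_sqrt.
have [K K_ge0 K_bound] := poly_geometric_bound r_bounds (normr_ge0 beta).
pose rate_cst : R := q^-1 * (2 ^+ d) `^ a * (2 * d%:R) `^ `|(d%:R - 1) * (a + b)|.
(* The first summand comes from the averaged blocks, the second from the tail, both in units of F /
   sqrt v. *)
pose K' := 4 * K / Num.sqrt (1 - q) + K.
exists (75 * K' * rate_cst) => v v_ge2.
have v_gt0 : (0 < v)%N by apply: leq_trans v_ge2.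
pose J := (A * (trunc_log 2 v).+1)%N; exists (2 ^ J)%N; split.
  rewrite powR_mulrn// -natrX ler_nat; apply: leq_trans (card_Gamma_le _ _) _.
  exact: box_size_le.
move=> m m_ge.
have T_le : (4 * (2 ^ J).*2.+1 ^ d <= v ^ (2 + e))%N.
  by rewrite expnD leq_mul ?box_size_le// -[4%N]/(2 ^ 2)%N leq_exp2r.
have [m_gt0 kap_ok net_ok sparse_ok] := sampling_parameters v_ge2 T_le m_ge.
have kap_gt0 : (0 < 10 * 1024 * (trunc_log 2 v).+3)%N by rewrite !muln_gt0.
have [xi xiP] := sparse_sampling m_gt0 kap_gt0 kap_ok net_ok sparse_ok.
apply: ge_ereal_inf.
eexists; first by exists (fun j => grid_pt R (tnth xi j)) => // j; exact: grid_pt_in_torus.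
apply: ge_ereal_sup => _ [f [re_cont [im_cont [f_per f_blocks]]] <-].
have [n [n_gt0 le_v lt_v]] := block_parameter d v_ge2.
have p_le : (n.-1 <= trunc_log 2 v)%N.
  apply: (leq_trans (leq_pred n)); apply: trunc_log_max => //.
  by apply: leq_trans le_v; rewrite leq_pmulr// expn_gt0 n_gt0.
have [pJ qJ] := decay_le_inv a_gt0 A_ge v_gt0 erefl p_le.
have B_le j : normA_fj f j <= q ^+ j * (maxn j 1)%:R `^ beta.
  by rewrite -powR_decay; exact: f_blocks.
have tail J' := sum_tail a_gt0 K_bound n_gt0 B_le J' pJ qJ.
have E_gt0 := block_error_gt0 beta a_gt0 v_gt0 n_gt0.
have N_E := block_error_ok a_gt0 v_gt0 n_gt0 (normA_fj_ge0 f) B_le.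
have N_sum : (#|[set t : box d (2 ^ J) | (level (box_freq t) < n.-1)%N]%SET| +
    \sum_(n.-1 <= j < J.+1) block_size a v n j <= v)%N.
  rewrite -(ler_nat R) natrD.
  have := sum_block_size a_gt0 v n J.
  (* The frequencies of level below n - 1 number at most 2^(n-1) (n-1)^(d-1) <= v / 2: stopping one
     level before [n] frees half of the budget. *)
  have : (2 * #|[set t : box d (2 ^ J) | (level (box_freq t) < n.-1)%N]%SET| <= v)%N.
    apply: leq_trans le_v; apply: (@leq_trans (2 * (2 ^ n.-1 * n.-1 ^ d.-1))%N).
      by rewrite leq_mul2l card_level_lt.
    rewrite mulnA -expnS prednK// leq_mul2l; apply/orP; right.
    by case: (d.-1) => [|k]; rewrite ?expn0// leq_exp2r// leq_pred.
  rewrite -(ler_nat R) natrM; lra.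
have v_le : (v <= #|Gamma d (2 ^ J)|)%N.
  by apply: card_Gamma_ge => //; rewrite v_gt0 box_size_ge.
have [L LX LS_le] := least_squares_error m_gt0 xiP re_cont im_cont f_per E_gt0 N_E N_sum
  tail v_le.
apply: ge_ereal_inf; eexists; first by exists L.
apply: ge_ereal_sup => _ [u u_LS <-]; rewrite lee_fin.
apply: (le_trans (LS_le u u_LS)).
have v0 : 0 < v%:R :> R by rewrite ltr0n.
have := rate_bound (b := b) a_gt0 d_gt0 v_ge2 n_gt0 erefl le_v lt_v.
have := sum_block_error a_gt0 K_bound v n_gt0 J.
rewrite -/q -/beta.
set F := q ^+ _ * _; set S := \sum_(_ <= _ < _) _ => S_le.
rewrite -/rate_cst => F_le.
have K'_ge0 : 0 <= K' by rewrite addr_ge0// divr_ge0 ?sqrtr_ge0// mulr_ge0.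
apply: (@le_trans _ _ (75 * (K' * (F / Num.sqrt v%:R)))); last first.
  have := ler_wpM2l K'_ge0 F_le; lra.
rewrite ler_pM2l//; apply: le_trans (lerD S_le (lexx _)) _.
rewrite le_eqVlt; apply/orP; left; apply/eqP.
rewrite /K' sqrtrM ?ler0n// invfM.
by ring.
Qed.
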